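(* Let $C>0$, $z>0$ satisfy $z\le\min\{Ce^{-CC_\phi};\,2Ce^{-2CC_\phi}\}$ and, if $CC_\phi\le\ln2$, also $z<Ce^{-CC_\phi}$. Let $\alpha_0=\alpha_0(z,\phi,C)$ be the number defined in the context, let $\alpha\in(\alpha_0;1)$ and let $k\in\overline{\mathcal K_{\alpha C}}$. Then $$(\widehat P^*_\delta)^{[t/\delta]}k\to\widehat T^{\odot\alpha}(t)k,\quad\delta\to0,$$ in the space $\overline{\mathcal K_{\alpha C}}$ with norm $\|\cdot\|_{\mathcal K_C}$, for all $t\ge0$, uniformly on bounded intervals of $t$.
   Context: $\Gamma_0$ is the set of all finite subsets of $\mathbb R^d$, with the Lebesgue–Poisson measure $\lambda$: $\int_{\Gamma_0}G\,d\lambda=G(\emptyset)+\sum_{n\ge1}\frac1{n!}\int_{(\mathbb R^d)^n}G(\{x_1,\dots,x_n\})\,dx_1\cdots dx_n$. $|\eta|$ is the cardinality; $[\cdot]$ is the integer part. For $c>0$, $\mathcal L_c=L^1(\Gamma_0,c^{|\cdot|}d\lambda)$, and $\mathcal K_c=\{k:\Gamma_0\to\mathbb R\mid \|k\|_{\mathcal K_c}:=\|c^{-|\cdot|}k\|_{L^\infty(\lambda)}<\infty\}$, identified with the dual of $\mathcal L_c$ through $\langle\!\langle G,k\rangle\!\rangle=\int_{\Gamma_0}Gk\,d\lambda$. $\phi:\mathbb R^d\setminus\{0\}\to[0,\infty)$ is a measurable even function with $0<C_\phi:=\int_{\mathbb R^d}(1-e^{-\phi(x)})\,dx<\infty$;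 $E^\phi(x,\xi)=\sum_{y\in\xi}\phi(x-y)$; $e_\lambda(f,\eta)=\prod_{x\in\eta}f(x)$, $e_\lambda(f,\emptyset)=1$. The operator $\widehat L$ in $\mathcal L_C$ with domain $\mathcal L_{2C}$ is $$(\widehat LG)(\eta)=-|\eta|G(\eta)+z\sum_{\xi\subset\eta}\int_{\mathbb R^d}e^{-E^\phi(x,\xi)}G(\xi\cup x)\,e_\lambda(e^{-\phi(x-\cdot)}-1,\eta\setminus\xi)\,dx ;$$ under the stated conditions its closure generates a strongly continuous contraction semigroup $\widehat T(t)$ on $\mathcal L_C$. $\widehat L^*$, with domain $D(\widehat L^* )\subset\mathcal K_C$, and $\widehat T^*(t)$ are the adjoints in $\mathcal K_C$ with respect to $\langle\!\langle\cdot,\cdot\rangle\!\rangle$. Closures (overlines) are in the norm of $\mathcal K_C$. For $\alpha\in(\alpha_0;1)$ one has $\overline{\mathcal K_{\alpha C}}\subset\overline{D(\widehat L^* )}$ and $\overline{\mathcal K_{\alpha C}}$ is $\widehat T^*(t)$-invariant; $\widehat T^{\odot\alpha}(t)$ is the restriction of $\widehat T^*(t)$ to $\overline{\mathcal K_{\alpha C}}$, a $C_0$-semigroup there. Definition of $\alpha_0$: the conditions on $z$ imply $zC_\phi<e^{-1}$; let $x_1\in(0,1)$ be the smaller root of $xe^{-x}=zC_\phi$ (then $x_1<CC_\phi$). Put $\alpha_0=\max\{\frac12;\frac1{CC_\phi};\frac1C\}$ if $CC_\phi>1$, and $\alpha_0=\max\{\frac12;\frac{x_1}{CC_\phi};\frac1C\}$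 if $x_1<CC_\phi\le1$. For $\delta\in(0,1)$, $$(\widehat P^*_\delta k)(\eta)=\sum_{\omega\subset\eta}(1-\delta)^{|\eta\setminus\omega|}(z\delta)^{|\omega|}\prod_{y\in\eta\setminus\omega}e^{-E^\phi(y,\omega)}\int_{\Gamma_0}\prod_{y\in\xi}\bigl(e^{-E^\phi(y,\omega)}-1\bigr)k(\xi\cup(\eta\setminus\omega))\,d\lambda(\xi).$$ *)

(* Defs.v *)
From HB Require Import structures.
From mathcomp Require Import all_boot all_order all_algebra.
From mathcomp Require Import finmap.
From mathcomp Require Import all_classical all_reals all_analysis.
Set Implicit Arguments.
Unset Strict Implicit.
Unset Printing Implicit Defensive.
Import Order.TTheory GRing.Theory Num.Theory numFieldNormedType.Exports.
Local Open Scope classical_set_scope.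
Local Open Scope ring_scope.

Definition image_measure d d' (T : measurableType d) (U : measurableType d')
    (R : realType) (m : {measure set T -> \bar R}) (f : T -> U)
    (mf : measurable_fun [set: T] f) : {measure set U -> \bar R} :=
  measure_function_pushforward__canonical__measure_function_Measure m mf.

Section mu_pow.
Context {d} {T : measurableType d} {R : realType}.
Variable mu : {sigma_finite_measure set T -> \bar R}.

Definition tcons n (x : T * n.-tuple T) : n.+1.-tuple T :=
  [tuple of x.1 :: x.2].

Lemma measurable_tcons n : measurable_fun [set: T * n.-tuple T] (@tcons n).
Proof.
exact: (measurable_cons (f := fst) (g := snd) measurable_fst measurable_snd).
Qed.

Section cons_measure.
Variables (n : nat) (nu : {sigma_finite_measure set (n.-tuple T) -> \bar R}).

Definition cons_measure : set (n.+1.-tuple T) -> \bar R :=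
  image_measure (mu \x nu)%E (@measurable_tcons n).

HB.instance Definition _ := Measure.on cons_measure.

Lemma cons_measure_sigma_finite : sigma_finite setT cons_measure.
Proof.
have /sigma_finiteP[F [TF ndF Foo]] := sigma_finiteT mu.
have /sigma_finiteP[G [TG ndG Goo]] := sigma_finiteT nu.
pose un (t : n.+1.-tuple T) : T * n.-tuple T := (thead t, [tuple of behead t]).
have tconsK x : un (tcons x) = x.
  by case: x => a t; congr pair; exact: val_inj.
have mun : measurable_fun setT un.
  apply/measurable_fun_pairP; split; first exact: measurable_tnth.
  exact: measurable_behead.
exists (fun k => un @^-1` (F k `*` G k)).
  apply/seteqP; split => // t _.
  have [i _ Fi] : (\bigcup_k F k) (un t).1 by rewrite -TF.
  have [j _ Gj] : (\bigcup_k G k) (un t).2 by rewrite -TG.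
  exists (maxn i j) => //; split.
    by move: Fi; exact/subsetPset/ndF/leq_maxl.
  by move: Gj; exact/subsetPset/ndG/leq_maxr.
move=> k; have [mF Fk] := Foo k; have [mG Gk] := Goo k; split.
  by rewrite -[X in measurable X]setTI; apply: mun => //; exact: measurableX.
rewrite /cons_measure /= /pushforward (_ : _ @^-1` _ = F k `*` G k).
  by rewrite product_measure1E// lte_mul_pinfty// ge0_fin_numE.
by apply/seteqP; split => x; rewrite /preimage /mkset tconsK.
Qed.

HB.instance Definition _ :=
  Measure_isSigmaFinite.Build _ _ _ cons_measure cons_measure_sigma_finite.

End cons_measure.

(* [mu_pow n] is the n-fold product measure mu (x) ... (x) mu; for [n = 0] it is
   the unit mass on the empty tuple. *)
Fixpoint mu_pow n : {sigma_finite_measure set (n.-tuple T) -> \bar R} :=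
  if n is m.+1 then cons_measure (mu_pow m) else \d_[tuple].

End mu_pow.

Definition fset_display : measure_display -> measure_display.
Proof. exact. Qed.

Section measurable_fset.
Context {d} {T : measurableType d}.

Definition fset_of_tuple n (x : n.-tuple T) : {fset T} := seq_fset tt x.

(* A set of finite configurations is measurable iff, for every [n], the tuples
   (x_1, ..., x_n) with {x_1, ..., x_n} in it form a measurable set.  Tuples with
   repeated entries are not excluded: they give smaller configurations, and they
   are null for the product of a diffuse measure. *)
Definition fset_measurable : set (set {fset T}) :=
  [set A | forall n, measurable (@fset_of_tuple n @^-1` A)].

Lemma fset_measurable0 : fset_measurable set0.
Proof. by move=> n; rewrite preimage_set0. Qed.

Lemma fset_measurableC A : fset_measurable A -> fset_measurable (~` A).
Proof. by move=> mA n; rewrite preimage_setC; exact: measurableC (mA n). Qed.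

Lemma fset_measurable_bigcup (F : (set {fset T})^nat) :
  (forall i, fset_measurable (F i)) -> fset_measurable (\bigcup_i F i).
Proof.
move=> mF n; rewrite preimage_bigcup.
by apply: bigcupT_measurable => i; exact: mF.
Qed.

HB.instance Definition _ := isPointed.Build {fset T} fset0.
HB.instance Definition _ := @isMeasurable.Build (fset_display d) {fset T}
  fset_measurable fset_measurable0 fset_measurableC fset_measurable_bigcup.

Lemma measurable_fset_of_tuple n :
  measurable_fun [set: n.-tuple T] (@fset_of_tuple n).
Proof. by move=> _ A mA; rewrite setTI; exact: mA. Qed.

End measurable_fset.

(* \sum_n 1/n! * (image of mu^n under (x_1, ..., x_n) |-> {x_1, ..., x_n}). *)
Definition lebesgue_poisson d (T : measurableType d) (R : realType)
    (mu : {sigma_finite_measure set T -> \bar R}) :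
    {measure set {fset T} -> \bar R} :=
  mseries (fun n => mscale (n`!%:R^-1)%:nng
    (image_measure (mu_pow mu n) (@measurable_fset_of_tuple _ T n))) 0.

(* Operators and semigroups on a seminormed space, given by a subspace [D] of
   a module [E] and a seminorm [N] on [D]; elements of [D] at distance 0 are
   identified, so all identities hold up to [N]-null elements. *)
Section semigroup.
Context {R : realType} {E : lmodType R}.
Variables (D : set E) (N : E -> \bar R).

Definition contraction_semigroup (T : R -> E -> E) :=
  [/\ forall t, 0 <= t -> forall G, D G -> D (T t G),
      forall t, 0 <= t -> forall a G H, D G -> D H ->
        N (T t (a *: G + H) - (a *: T t G + T t H)) = 0%E,
      forall t, 0 <= t -> forall G, D G -> (N (T t G) <= N G)%E,
      (forall G, D G -> N (T 0 G - G) = 0%E) /\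
      (forall s t, 0 <= s -> 0 <= t -> forall G, D G ->
        N (T (s + t) G - T s (T t G)) = 0%E) &
      forall G, D G -> N (T t G - G) @[t --> 0^'+] --> 0%E].

Definition generator (T : R -> E -> E) (G H : E) :=
  [/\ D G, D H &
      N (t^-1 *: (T t G - G) - H) @[t --> 0^'+] --> 0%E].

(* Graph of the closure of the operator [A] with domain [dom]. *)
Definition op_closure (dom : set E) (A : E -> E) (G H : E) :=
  [/\ D G, D H &
      exists G_ : nat -> E, [/\ forall n, dom (G_ n),
        N (G_ n - G) @[n --> \oo] --> 0%E &
        N (A (G_ n) - H) @[n --> \oo] --> 0%E]].

Definition norm_closure (A : set E) : set E :=
  [set x | D x /\ forall e : R, 0 < e ->
    exists2 y, A y & (N (x - y) < e%:E)%E].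

End semigroup.

(* [measurableTypeR R] is the copy of [R] that carries [lebesgue_measure]. *)
Notation "''R[' R ]_ d" := (d.-tuple (measurableTypeR R))
  (at level 8, d at level 2, format "''R[' R ]_ d") : type_scope.

Section glauber.
Context {R : realType} {d : nat}.
Local Notation Rd := 'R[R]_d.
Local Notation Gamma0 := {fset Rd}.
Implicit Types (x y : Rd) (eta xi omega : Gamma0) (G k : Gamma0 -> R).
Implicit Types (phi : Rd -> R) (c C z delta alpha t : R).

Definition vzero : Rd := [tuple (0 : R) | i < d].
Definition vopp x : Rd := [tuple - (tnth x i : R) | i < d].
Definition vsub x y : Rd := [tuple (tnth x i : R) - tnth y i | i < d].

Definition leb : {sigma_finite_measure set Rd -> \bar R} :=
  mu_pow lebesgue_measure d.

Definition lambda : {measure set Gamma0 -> \bar R} := lebesgue_poisson leb.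

(* The elements of L_c and K_c are represented by functions; two of them are the
   same element when their difference has norm 0, i.e. when they agree
   lambda-almost everywhere. *)
Definition Lspc c : set (Gamma0 -> R) :=
  [set G | (fun eta => G eta * c ^+ #|` eta|) \in Lfun lambda 1%E].
Definition Lspc_norm c G : \bar R :=
  Lnorm lambda 1%E (fun eta => (G eta * c ^+ #|` eta|)%:E).

Definition Kspc c : set (Gamma0 -> R) :=
  [set k | (fun eta => c ^- #|` eta| * k eta) \in Lfun lambda +oo%E].
Definition Kspc_norm c k : \bar R :=
  Lnorm lambda +oo%E (fun eta => (c ^- #|` eta| * k eta)%:E).

Definition pairing G k : R := \int[lambda]_eta (G eta * k eta).

Definition Kspc_closure alpha C : set (Gamma0 -> R) :=
  norm_closure (Kspc C) (Kspc_norm C) (Kspc (alpha * C)).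

(* [phi] is a total function, but its value at the origin never matters: the
   configurations and points at which it is used form a null set. *)
Definition Cphi_int phi : \bar R := (\int[leb]_x (1 - expR (- phi x))%:E)%E.
Definition Cphi phi : R := fine (Cphi_int phi).

Definition Ephi phi x xi : R := \sum_(y <- xi) phi (vsub x y).

Definition e_lambda (f : Rd -> R) eta : R := \prod_(x <- eta) f x.

Definition Lhat phi z G eta : R :=
  - (#|` eta|%:R * G eta) +
  z * \sum_(xi <- fpowerset eta)
    \int[leb]_x (expR (- Ephi phi x xi) * G (x |` xi)%fset *
      e_lambda (fun y => expR (- phi (vsub x y)) - 1) (eta `\` xi)%fset).

(* [That] is the semigroup generated by the closure of [Lhat], where [Lhat] has
   domain L_{2C}. *)
Definition semigroup_of phi z C (That : R -> (Gamma0 -> R) -> (Gamma0 -> R)) :=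
  contraction_semigroup (Lspc C) (Lspc_norm C) That /\
  (forall G H, generator (Lspc C) (Lspc_norm C) That G H <->
     op_closure (Lspc C) (Lspc_norm C) (Lspc (2 * C)) (Lhat phi z) G H).

Definition adjoint_semigroup C
    (That Tstar : R -> (Gamma0 -> R) -> (Gamma0 -> R)) :=
  forall t, 0 <= t -> forall k, Kspc C k ->
    Kspc C (Tstar t k) /\
    forall G, Lspc C G -> pairing (That t G) k = pairing G (Tstar t k).

(* Restriction of [Tstar t] to the closure of K_{alpha C}; the value outside that
   set is a dummy. *)
Definition Tsun alpha C (Tstar : R -> (Gamma0 -> R) -> (Gamma0 -> R)) t :
    (Gamma0 -> R) -> (Gamma0 -> R) :=
  Tstar t \_ (Kspc_closure alpha C).

Definition Pstar phi z delta k eta : R :=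
  \sum_(omega <- fpowerset eta)
    (1 - delta) ^+ #|` (eta `\` omega)%fset| * (z * delta) ^+ #|` omega| *
    (\prod_(y <- (eta `\` omega)%fset) expR (- Ephi phi y omega)) *
    \int[lambda]_xi
      ((\prod_(y <- xi) (expR (- Ephi phi y omega) - 1)) *
       k (xi `|` (eta `\` omega))%fset).

(* The smaller root of x e^{-x} = z Cphi; it is the only one in (0, 1). *)
Definition small_root phi z : R :=
  inf [set x : R | 0 < x < 1 /\ x * expR (- x) = z * Cphi phi].

(* The case distinction is on C Cphi > 1 versus small_root < C Cphi <= 1; the
   conditions on [z] entail small_root < C Cphi. *)
Definition alpha0 phi z C : R :=
  let q := C * Cphi phi in
  if 1 < q then Num.max (Num.max 2^-1 q^-1) C^-1
  else Num.max (Num.max 2^-1 (small_root phi z / q)) C^-1.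

End glauber.

(* Main.v *)
Require Import Defs.
From HB Require Import structures.
From mathcomp Require Import all_boot all_order all_algebra.
From mathcomp Require Import finmap.
From mathcomp Require Import all_classical all_reals all_analysis.
From mathcomp Require Import measurable_realfun ess_sup_inf.
From mathcomp Require Import ring lra.
Set Implicit Arguments.
Unset Strict Implicit.
Unset Printing Implicit Defensive.
Import Order.TTheory GRing.Theory Num.Theory numFieldNormedType.Exports.
Local Open Scope classical_set_scope.
Local Open Scope ring_scope.

(* Write a = alpha C and L for the adjoint of Lhat.  By the Minlos lemma and Fubini,
   <Lhat G, k> = <G, L k> for G in L_{2C} and k bounded by a multiple of C^{|eta|},
   with an explicit formula for L whose terms are those of first order in delta of
   P*_delta.  The condition alpha > alpha0 means 1 < a and z exp(a Cphi) <= a; it makes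
   P*_delta preserve pointwise bounds by K a^{|eta|}, and the same holds at a = C, so
   P*_delta is also a contraction of K_C.  For a < b < C the operator L maps K_a into
   K_b and K_b into K_C, hence for k in K_a both T*(delta) k and P*_delta k equal
   k + delta L k up to O(delta^2) in K_C; for T*(delta) this is a Taylor expansion of
   <T(delta) G, k>, which uses no regularity of T* in time.  Summing the one-step
   errors, T*(n delta) k and (P*_delta)^n k differ by O(n delta^2).  Contractivity of
   both families in K_C extends the convergence to the closure of K_a. *)

(** Two descriptions of K_C have to be reconciled. P*_delta k at eta integrates k over unions of xi
    and zeta with zeta fixed, so its bounds are proved for representatives bounded at every
    configuration ([fbound]); truncation supplies them, and the Minlos lemma shows that changing k
    on a null set changes P*_delta k only on a null set. T*(t) k, on the other hand, is known only
    through its pairings, and [pairing_test] turns bounds on pairings with L_{2C} into almost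
    everywhere bounds.

    Each use of L costs a factor |eta|, paid for by enlarging the base of the power: n^2 a^n <= c
    b^n for a < b. Two uses need an intermediate base; it comes from the midpoint of alpha and 1,
    which satisfies the same stability inequality because every point of (alpha0, 1) does.

    In positive dimension Lebesgue measure is diffuse: tuples with repeated entries, and
    configurations meeting a given finite set, are null. This makes formulas on sets agree with
    integrals over tuples, and it hides the value of phi at the origin. *)

Ltac mpair := match goal with |- @measurable_fun _ _ ?X ?Y _ _ =>
  apply: (@measurable_fun_pair _ _ _ X) => //= end.

Lemma measurable_comp_pair d0 d1 d2 d3 (T0 : measurableType d0)
    (T1 : measurableType d1) (T2 : measurableType d2) (T3 : measurableType d3)
    (f : T1 * T2 -> T3) (g : T0 -> T1) (h : T0 -> T2) :
  measurable_fun setT f -> measurable_fun setT g -> measurable_fun setT h ->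
  measurable_fun setT (fun x => f (g x, h x)).
Proof.
by move=> mf mg mh; apply: (measurableT_comp mf); exact: measurable_fun_pair.
Qed.

Definition seq_display : measure_display -> measure_display.
Proof. exact. Qed.

(* Locked, so that unification does not unfold [seq_fset]. *)
HB.lock Definition fset_of (K : choiceType) (s : seq K) : {fset K} :=
  seq_fset tt s.
Arguments fset_of {K} s.

Section fset_of.
Context {K : choiceType}.
Implicit Types (a : K) (s t : seq K) (eta : {fset K}).

Lemma fset_ofE : @fset_of K = fun s : seq K => seq_fset tt s.
Proof. by rewrite unlock. Qed.

Lemma fset_of_nil : @fset_of K [::] = fset0.
Proof. by apply/fsetP => x; rewrite fset_ofE seq_fsetE in_fset0. Qed.

Lemma fset_of_cons a s : fset_of (a :: s) = (a |` fset_of s)%fset.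
Proof. by apply/fsetP => x; rewrite fset_ofE seq_fsetE !inE seq_fsetE. Qed.

Lemma fset_of_cat s t : fset_of (s ++ t) = (fset_of s `|` fset_of t)%fset.
Proof. by apply/fsetP => x; rewrite fset_ofE !inE !seq_fsetE mem_cat. Qed.

Lemma fset_of_enum (eta : {fset K}) : fset_of (enum_fset eta) = eta.
Proof. by apply/fsetP => x; rewrite fset_ofE seq_fsetE. Qed.

Lemma mem_fset_of s : fset_of s =i s.
Proof. by rewrite fset_ofE; exact: seq_fsetE. Qed.

Lemma fset_of_ind (Q : {fset K} -> Prop) : Q fset0 ->
  (forall a eta, a \notin eta -> Q eta -> Q (a |` eta)%fset) -> forall eta, Q eta.
Proof.
move=> Q0 QS eta; rewrite -[eta]fset_of_enum.
elim: (enum_fset eta) => [|a s IH]; first by rewrite fset_of_nil.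
rewrite fset_of_cons; have [ain|anin] := boolP (a \in fset_of s).
  by rewrite mem_fset1U.
exact: QS.
Qed.

End fset_of.

(** * Integration on finite configurations through lists *)

(* Functions of several configurations are integrated over tuples of lists: the
   sigma-algebra on [seq T] is the coarse one making concatenation jointly
   measurable, and [fset_of] transports statements to configurations. *)
Section measurable_seq.
Context {d} {T : measurableType d}.

Definition seq_of_tuple n (x : n.-tuple T) : seq T := x.

Definition seq_measurable : set (set (seq T)) :=
  [set A | forall n, measurable (@seq_of_tuple n @^-1` A)].

Lemma seq_measurable0 : seq_measurable set0.
Proof. by move=> n; rewrite preimage_set0. Qed.

Lemma seq_measurableC A : seq_measurable A -> seq_measurable (~` A).
Proof. by move=> mA n; rewrite preimage_setC; exact: measurableC (mA n). Qed.

Lemma seq_measurable_bigcup (F : (set (seq T))^nat) :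
  (forall i, seq_measurable (F i)) -> seq_measurable (\bigcup_i F i).
Proof.
move=> mF n; rewrite preimage_bigcup.
by apply: bigcupT_measurable => i; exact: mF.
Qed.

HB.instance Definition _ := isPointed.Build (seq T) [::].
HB.instance Definition _ := @isMeasurable.Build (seq_display d) (seq T)
  seq_measurable seq_measurable0 seq_measurableC seq_measurable_bigcup.

Lemma seq_measurableE (A : set (seq T)) :
  measurable A = (forall n, measurable (@seq_of_tuple n @^-1` A)).
Proof. by []. Qed.

Lemma measurable_seq_of_tuple n :
  measurable_fun [set: n.-tuple T] (@seq_of_tuple n).
Proof. by move=> _ A mA; rewrite setTI; exact: mA. Qed.

(** A measurable left inverse of [seq_of_tuple]; lists of another length go to the constant tuple of
    [point]. *)
Definition tuple_of_seq n (s : seq T) : n.-tuple T :=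
  insubd [tuple of nseq n point] s.

Lemma tuple_of_seqK n (s : seq T) : size s = n ->
  seq_of_tuple (tuple_of_seq n s) = s.
Proof. by move=> sn; rewrite /seq_of_tuple/= val_insubd sn eqxx. Qed.

Lemma seq_of_tupleK n (x : n.-tuple T) : tuple_of_seq n (seq_of_tuple x) = x.
Proof. exact: valKd. Qed.

Lemma measurable_tuple_of_seq n : measurable_fun [set: seq T] (tuple_of_seq n).
Proof.
move=> _ A mA; rewrite setTI seq_measurableE => m.
have [<-|mn] := eqVneq n m.
  rewrite (_ : _ @^-1` _ = A)//; apply/seteqP.
  by split=> x /=; rewrite seq_of_tupleK.
have -> : @seq_of_tuple m @^-1` (tuple_of_seq n @^-1` A) =
   [set x | A [tuple of nseq n point]].
  apply/seteqP; split=> x /=;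
  by rewrite /tuple_of_seq /insubd insubN ?size_tuple// eq_sym.
have [An|An] := pselect (A [tuple of nseq n point]).
  by rewrite (_ : [set _ | _] = setT)//; apply/seteqP; split.
by rewrite (_ : [set _ | _] = set0)//; apply/seteqP; split.
Qed.

Lemma measurable_size n : measurable [set s : seq T | size s = n].
Proof.
rewrite seq_measurableE => m; have [<-|mn] := eqVneq m n.
  by rewrite (_ : _ @^-1` _ = setT)//; apply/seteqP; split => // x _ /=;
     rewrite size_tuple.
rewrite (_ : _ @^-1` _ = set0)//; apply/seteqP; split => // x /=.
by rewrite size_tuple => /eqP; rewrite (negbTE mn).
Qed.

(** Lists of fixed length form countably many measurable pieces of [seq T], and on each of them
    [tuple_of_seq] reduces the question to tuples. The parameter space [P] allows functions of
    several lists to be treated one list at a time. *)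
Lemma measurable_fun_prod_seq d1 d' (P : measurableType d1)
    (U : measurableType d') (f : P * seq T -> U) :
  (forall n, measurable_fun setT (fun p : P * n.-tuple T => f (p.1, p.2 : seq T))) ->
  measurable_fun setT f.
Proof.
move=> mf.
have cover : [set: P * seq T] = \bigcup_n (setT `*` [set s | size s = n]).
  by apply/seteqP; split => // -[p s] _; exists (size s).
rewrite cover; apply/measurable_fun_bigcup => n.
  by apply: measurableX => //; exact: measurable_size.
apply: (eq_measurable_fun
   ((fun p : P * n.-tuple T => f (p.1, p.2 : seq T)) \o
    (fun q : P * seq T => (q.1, tuple_of_seq n q.2)))).
  move=> [p s]; rewrite inE => -[_ /= sn].
  by congr (f (_, _)); exact: tuple_of_seqK.
apply: measurable_funTS; apply: measurableT_comp; first exact: mf.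
apply: measurable_fun_pair => //.
by apply: measurableT_comp => //; exact: measurable_tuple_of_seq.
Qed.

Lemma measurable_fun_seq_prod d1 d' (P : measurableType d1)
    (U : measurableType d') (f : seq T * P -> U) :
  (forall n, measurable_fun setT (fun p : n.-tuple T * P => f (p.1 : seq T, p.2))) ->
  measurable_fun setT f.
Proof.
move=> mf.
rewrite (_ : f = (fun q : P * seq T => f (q.2, q.1)) \o (fun q => (q.2, q.1))).
  apply: measurableT_comp => /=; last mpair.
  apply: measurable_fun_prod_seq => n.
  rewrite (_ : (fun p => _) = (fun p : n.-tuple T * P => f (p.1 : seq T, p.2)) \o
     (fun q => (q.2, q.1)))//.
  by apply: measurableT_comp; [exact: mf|mpair].
by apply/funext => -[].
Qed.

Lemma measurable_seq_cons : measurable_fun setT (fun p : T * seq T => p.1 :: p.2).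
Proof.
apply: measurable_fun_prod_seq => n.
rewrite (_ : (fun p => _) = @seq_of_tuple n.+1 \o @tcons _ T n)//.
apply: measurableT_comp; first exact: measurable_seq_of_tuple.
exact: measurable_tcons.
Qed.

Lemma measurable_seq_cat :
  measurable_fun setT (fun p : seq T * seq T => p.1 ++ p.2).
Proof.
apply: measurable_fun_seq_prod; elim=> [|n IH].
  rewrite (_ : (fun p => _) = snd)//; apply/funext => -[t s] /=.
  by rewrite (tuple0 t).
pose g (p : n.+1.-tuple T * seq T) :=
  (thead p.1, ([tuple of behead p.1] : n.-tuple T, p.2)).
rewrite (_ : (fun p => _) = (fun q => q.1 :: q.2) \o
  (fun q : T * (n.-tuple T * seq T) => (q.1, (q.2.1 : seq T) ++ q.2.2)) \o g).
  apply: measurableT_comp.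
    apply: measurableT_comp; first exact: measurable_seq_cons.
    apply: measurable_fun_pair => //.
    exact: (measurableT_comp IH).
  apply: measurable_fun_pair.
    exact: measurableT_comp (measurable_tnth ord0) measurable_fst.
  apply: measurable_fun_pair => //.
  exact: measurableT_comp (@measurable_behead _ T n) measurable_fst.
by apply/funext => -[t s] /=; rewrite {1}(tuple_eta t).
Qed.

Lemma measurable_fset_of : measurable_fun [set: seq T] (@fset_of T).
Proof. by move=> _ A mA; rewrite setTI seq_measurableE fset_ofE => n; exact: mA. Qed.

Lemma fset_measurableE (A : set {fset T}) :
  measurable A = (forall n, measurable (@fset_of_tuple _ T n @^-1` A)).
Proof. by []. Qed.

(** The sigma-algebra on configurations is the final one for [fset_of], so nothing is lost by
    testing measurability on lists. *)
Lemma measurable_fun_fset d' (U : measurableType d') (f : {fset T} -> U) :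
  measurable_fun setT f <-> measurable_fun setT (f \o @fset_of T).
Proof.
split=> [mf|mf _ A mA]; first exact: measurableT_comp mf measurable_fset_of.
have := mf measurableT A mA; rewrite !setTI seq_measurableE fset_ofE.
by rewrite fset_measurableE.
Qed.

End measurable_seq.

Section seq_measure.
Context {d} {T : measurableType d} {R : realType}.
Variable mu : {sigma_finite_measure set T -> \bar R}.

(* [lebesgue_poisson mu] is its image under [fset_of]; its sigma-finiteness gives
   access to Fubini. *)
Definition seq_measure : set (seq T) -> \bar R :=
  mseries (fun n => mscale (n`!%:R^-1)%:nng
    (image_measure (mu_pow mu n) (@measurable_seq_of_tuple _ T n))) 0.

HB.instance Definition _ := Measure.on seq_measure.
Local Open Scope ereal_scope.

Lemma ge0_integral_seq_measure (F : seq T -> \bar R) :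
  measurable_fun setT F -> (forall s, 0 <= F s) ->
  \int[seq_measure]_s F s =
  \sum_(n <oo) (n`!%:R^-1)%:E * \int[mu_pow mu n]_x F x.
Proof.
move=> mF F0; rewrite ge0_integral_measure_series//.
apply: eq_eseriesr => n _; rewrite ge0_integral_mscale//.
congr (_ * _); rewrite ge0_integral_pushforward//.
exact: measurable_seq_of_tuple.
Qed.

Lemma integral_lebesgue_poisson (F : {fset T} -> \bar R) :
  measurable_fun setT F ->
  \int[lebesgue_poisson mu]_eta F eta = \int[seq_measure]_s F (fset_of s).
Proof.
have ge0 (G : {fset T} -> \bar R) : measurable_fun setT G ->
    (forall x, 0 <= G x) ->
    \int[lebesgue_poisson mu]_eta G eta = \int[seq_measure]_s G (fset_of s).
  move=> mG G0.
  rewrite (eq_measure_integral (image_measure seq_measure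
             (@measurable_fset_of _ T))).
    by rewrite ge0_integral_pushforward//; exact: measurable_fset_of.
  by move=> A mA _; rewrite /image_measure/= /pushforward fset_ofE.
move=> mF; rewrite integralE [RHS]integralE; congr (_ - _).
  rewrite ge0//; last exact: measurable_funepos.
  by apply: eq_integral => s _; rewrite !funeposE.
rewrite ge0//; last exact: measurable_funeneg.
by apply: eq_integral => s _; rewrite !funenegE.
Qed.

Lemma mu_pow0_integral (F : seq T -> \bar R) : (forall x, 0 <= F x) ->
  measurable_fun setT F -> \int[mu_pow mu 0]_x F x = F [::].
Proof.
move=> F0 mF; rewrite integral_dirac// ?diracT ?mul1e//.
exact: measurableT_comp mF (@measurable_seq_of_tuple _ T 0).
Qed.

Lemma mu_powS_integral n (F : seq T -> \bar R) : (forall x, 0 <= F x) ->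
  measurable_fun setT F ->
  \int[mu_pow mu n.+1]_x F x = \int[mu]_a \int[mu_pow mu n]_x F (a :: x).
Proof.
move=> F0 mF.
have mF' m : measurable_fun setT (fun x : m.-tuple T => F x).
  exact: measurableT_comp mF (@measurable_seq_of_tuple _ T m).
transitivity (\int[mu \x mu_pow mu n]_p F (tcons p)).
  exact: (ge0_integral_pushforward (@measurable_tcons _ T n)
    (mu \x mu_pow mu n) measurableT (mF' _) (fun x _ => F0 x)).
rewrite fubini_tonelli1//.
exact: measurableT_comp (mF' _) (@measurable_tcons _ T n).
Qed.

Lemma measurable_prod_seq d1 (P : measurableType d1) (v : P * T -> R) :
  measurable_fun setT v ->
  measurable_fun setT (fun p : P * seq T => (\prod_(y <- p.2) v (p.1, y))%R).
Proof.
move=> mv; apply: measurable_fun_prod_seq; elim=> [|n IH].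
  rewrite (_ : (fun p => _) = cst 1%R)//; apply/funext => -[p x] /=.
  by rewrite (tuple0 x) big_nil.
rewrite (_ : (fun p => _) = (fun p : P * n.+1.-tuple T =>
   v (p.1, thead p.2) * \prod_(y <- [tuple of behead p.2]) v (p.1, y))%R); last first.
  by apply/funext => -[p x] /=; rewrite {1}(tuple_eta x) big_cons.
have mp : measurable_fun setT (fun p : P * n.+1.-tuple T => thead p.2).
  exact: measurableT_comp (measurable_tnth ord0) measurable_snd.
have mb : measurable_fun setT (fun p : P * n.+1.-tuple T =>
    [tuple of behead p.2] : n.-tuple T).
  exact: measurableT_comp (@measurable_behead _ T n) measurable_snd.
apply: measurable_funM.
  exact: (measurable_comp_pair mv measurable_fst mp).
exact: (measurable_comp_pair IH measurable_fst mb).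
Qed.

Lemma measurable_prod_seq1 (v : T -> R) : measurable_fun setT v ->
  measurable_fun setT (fun s : seq T => (\prod_(y <- s) v y)%R).
Proof.
move=> mv.
have := @measurable_prod_seq _ T (v \o snd).
move=> /(_ (measurableT_comp mv measurable_snd)) /=.
by move=> /(measurable_fun_pair2 point).
Qed.

Lemma mu_pow_prod n (v : T -> R) : measurable_fun setT v ->
  (forall x, (0 <= v x)%R) -> \int[mu]_x (v x)%:E < +oo ->
  \int[mu_pow mu n]_x (\prod_(y <- x) v y)%:E =
  ((fine (\int[mu]_x (v x)%:E)) ^+ n)%:E.
Proof.
move=> mv v0 vfin.
have v_fin : \int[mu]_x (v x)%:E \is a fin_num.
  by rewrite ge0_fin_numE// integral_ge0// => x _; rewrite lee_fin.
have p0 (s : seq T) : (0 <= \prod_(y <- s) v y)%R by rewrite prodr_ge0.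
have p0' (s : seq T) : 0 <= (\prod_(y <- s) v y)%:E by rewrite lee_fin.
have mp : measurable_fun setT (fun s : seq T => (\prod_(y <- s) v y)%:E).
  by apply/measurable_EFinP; exact: measurable_prod_seq1.
elim: n => [|n IH].
  by rewrite (mu_pow0_integral p0' mp) big_nil expr0.
rewrite (mu_powS_integral n p0' mp).
set I := fine _ in IH *.
transitivity (\int[mu]_a ((I ^+ n)%:E * (v a)%:E)).
  apply: eq_integral => a _; rewrite muleC -IH -ge0_integralZl ?lee_fin//.
  - by apply: eq_integral => x _; rewrite big_cons EFinM.
  exact: measurableT_comp mp (@measurable_seq_of_tuple _ T n).
rewrite ge0_integralZl ?lee_fin// ?exprn_ge0 ?fine_ge0 ?integral_ge0//.
- by rewrite -(fineK v_fin) -EFinM -exprSr.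
- exact/measurable_EFinP.
- by move=> x _; rewrite lee_fin.
- by move=> x _; rewrite lee_fin.
Qed.

(** By independence the term of index n is the n-th power of the integral of [v] over n!, so the
    exponential series appears. All exponential constants below come from this formula. *)
Lemma seq_measure_prod (v : T -> R) : measurable_fun setT v ->
  (forall x, (0 <= v x)%R) -> \int[mu]_x (v x)%:E < +oo ->
  \int[seq_measure]_s (\prod_(y <- s) v y)%:E =
  (expR (fine (\int[mu]_x (v x)%:E)))%:E.
Proof.
move=> mv v0 vfin; rewrite ge0_integral_seq_measure; last 2 first.
- by apply/measurable_EFinP; exact: measurable_prod_seq1.
- by move=> s; rewrite lee_fin prodr_ge0.
under eq_eseriesr => n _ do rewrite mu_pow_prod//.
set r := fine _.
transitivity (limn (fun n => (series (exp_coeff r) n)%:E)).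
  congr (limn _); apply/funext => n.
  rewrite /series/= -sumEFin; apply: eq_bigr => i _.
  by rewrite -EFinM mulrC.
by rewrite EFin_lim//; exact: is_cvg_series_exp_coeff.
Qed.

(** If the sets F_k of finite measure exhaust the base space, the lists with all entries in F_k
    exhaust [seq T]; the exponential formula for the indicator of F_k bounds their measure by exp
    (mu F_k). *)
Lemma seq_measure_sigma_finite : sigma_finite setT seq_measure.
Proof.
have /sigma_finiteP[F [TF ndF Foo]] := sigma_finiteT mu.
have mv k : measurable_fun setT (\1_(F k) : T -> R).
  by have [mF _] := Foo k; exact: measurable_indic.
pose E k := [set s : seq T | (\prod_(y <- s) \1_(F k) y)%R = 1%R :> R].
exists E.
  apply/seteqP; split => // s _.
  suff [k Fk] : exists k, forall y, y \in s -> F k y.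
    exists k => //; rewrite /E/= big1_seq// => y /andP[_ /Fk ys].
    by rewrite indicE mem_set.
  elim: s => [|a s [k Fk]]; first by exists 0%N.
  have [i _ Fi] : (\bigcup_k F k) a by rewrite -TF.
  exists (maxn i k) => y; rewrite inE => /predU1P[->|/Fk].
    by move: Fi; exact/subsetPset/ndF/leq_maxl.
  exact/subsetPset/ndF/leq_maxr.
move=> k; have [mF Fk] := Foo k.
have mE : measurable (E k).
  have := measurable_prod_seq1 (mv k).
  move=> /(_ measurableT [set 1%R] (measurable_set1 _)).
  by rewrite setTI.
split => //.
have -> : seq_measure (E k) = \int[seq_measure]_s (\1_(E k) s)%:E.
  by rewrite integral_indic// setIT.
have vfin : \int[mu]_x (\1_(F k) x)%:E < +oo by rewrite integral_indic// setIT.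
apply: le_lt_trans (_ : _ <= \int[seq_measure]_s (\prod_(y <- s) \1_(F k) y)%:E) _.
  apply: ge0_le_integral => //.
  - exact/measurable_EFinP/measurable_indic.
  - by apply/measurable_EFinP; exact: measurable_prod_seq1.
  - move=> s _; rewrite lee_fin indicE; case: (boolP (s \in E k)) => [|_].
      by rewrite inE /E/= => ->.
    by rewrite prodr_ge0.
by rewrite seq_measure_prod// ltry.
Qed.

HB.instance Definition _ :=
  Measure_isSigmaFinite.Build _ _ _ seq_measure seq_measure_sigma_finite.

End seq_measure.

(** * Sums over splittings and the Minlos lemma *)

Section splitsum.
Context {K : choiceType} {V : nmodType}.
Implicit Types (f : {fset K} -> {fset K} -> V) (eta : {fset K}).

Definition splitsum f eta : V :=
  \sum_(omega <- fpowerset eta) f omega (eta `\` omega)%fset.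

Lemma splitsum0 f : splitsum f fset0 = f fset0 fset0.
Proof. by rewrite /splitsum fpowerset0 big_seq_fset1 fsetD0. Qed.

Lemma fpowersetU1 a eta : a \notin eta ->
  perm_eq (fpowerset (a |` eta)%fset)
    ([seq (a |` omega)%fset | omega <- fpowerset eta] ++ fpowerset eta).
Proof.
move=> an; apply: uniq_perm => [//||omega].
  rewrite cat_uniq fset_uniq andbT; apply/andP; split.
    rewrite map_inj_in_uniq; first exact: fset_uniq.
    move=> x y; rewrite !fpowersetE => xe ye xy.
    have ax : a \notin x by apply: contra an; exact: fsubsetP.
    have ay : a \notin y by apply: contra an; exact: fsubsetP.
    by rewrite -(fsetU1K ax) -(fsetU1K ay) xy.
  apply/hasPn => omega; rewrite fpowersetE => oe; apply/mapP => -[x _ oE].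
  by move: an; rewrite (fsubsetP oe)// oE fset1U1.
rewrite mem_cat !fpowersetE; apply/idP/orP => [sub|[/mapP[x]|]].
- have [ao|ao] := boolP (a \in omega); last first.
    by right; move: sub; rewrite -fsubDset mem_fsetD1.
  left; apply/mapP; exists (omega `\ a)%fset; last by rewrite fsetD1K.
  by rewrite fpowersetE fsubDset.
- by rewrite fpowersetE => xe ->; exact: fsetUS.
- by move=> oe; apply: fsubset_trans oe _; exact: fsubsetU1.
Qed.

(** The new point joins either the first part or the second. This recursion drives the inductions on
    [splitsum], in particular those for measurability and for the Minlos lemma. *)
Lemma splitsumU1 f a eta : a \notin eta ->
  splitsum f (a |` eta)%fset =
  splitsum (fun omega zeta => f (a |` omega)%fset zeta) eta +
  splitsum (fun omega zeta => f omega (a |` zeta)%fset) eta.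
Proof.
move=> an; rewrite /splitsum (perm_big _ (fpowersetU1 an))/= big_cat/= big_map.
congr (_ + _); rewrite big_seq [RHS]big_seq; apply: eq_bigr => omega.
  rewrite fpowersetE => oe; congr (f _ _); apply/fsetP => x; rewrite !inE.
  by have [->|] := eqVneq x a; rewrite ?(negbTE an) ?andbF.
rewrite fpowersetE => oe; congr (f _ _).
have ao : a \notin omega by apply: contra an; exact: fsubsetP.
apply/fsetP => x; rewrite !inE.
by have [->|] := eqVneq x a; rewrite ?(negbTE ao).
Qed.

Lemma eq_splitsum f g eta :
  (forall omega, (omega `<=` eta)%fset ->
     f omega (eta `\` omega)%fset = g omega (eta `\` omega)%fset) ->
  splitsum f eta = splitsum g eta.
Proof.
move=> fg; rewrite /splitsum big_seq [RHS]big_seq; apply: eq_bigr => omega.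
by rewrite fpowersetE => /fg.
Qed.

Lemma splitsumD f g eta :
  splitsum (fun omega zeta => f omega zeta + g omega zeta) eta =
  splitsum f eta + splitsum g eta.
Proof. by rewrite /splitsum big_split. Qed.

End splitsum.

(** * Measurability of functions of finite configurations *)

Section measurable_fset_ops.
Context {d} {T : measurableType d} {R : realType}.
Hypothesis mdiag : measurable [set p : T * T | p.1 = p.2].

Lemma measurable_eqb : measurable_fun setT (fun p : T * T => p.1 == p.2).
Proof.
apply: (measurable_fun_bool true); rewrite setTI.
rewrite (_ : _ @^-1` _ = [set p : T * T | p.1 = p.2])//.
by apply/seteqP; split => -[x y] /= /eqP.
Qed.

Lemma measurable_in_seq : measurable_fun setT (fun p : T * seq T => p.1 \in p.2).
Proof.
apply: measurable_fun_prod_seq; elim=> [|n IH].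
  rewrite (_ : (fun p => _) = cst false)//; apply/funext => -[a x] /=.
  by rewrite (tuple0 x).
rewrite (_ : (fun p => _) = (fun p : T * n.+1.-tuple T =>
    (p.1 == thead p.2) || (p.1 \in [tuple of behead p.2]))); last first.
  by apply/funext => -[p x] /=; rewrite {1}(tuple_eta x) inE.
apply: measurable_or.
  exact: (measurable_comp_pair measurable_eqb measurable_fst
           (measurableT_comp (measurable_tnth ord0) measurable_snd)).
exact: (measurable_comp_pair IH measurable_fst
  (measurableT_comp (@measurable_behead _ T n) measurable_snd)).
Qed.

Lemma measurable_fset_rec d1 d2 (P : measurableType d1) (U : measurableType d2)
    (F : P * {fset T} -> U) (G0 : P -> U) (G : P * T -> {fset T} -> U) :
  measurable_fun setT G0 -> (forall p, F (p, fset0) = G0 p) ->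
  (forall p a eta, a \notin eta -> F (p, a |` eta)%fset = G (p, a) eta) ->
  forall n, measurable_fun setT (fun q : P * T * n.-tuple T => G q.1 (fset_of q.2)) ->
  measurable_fun setT (fun p : P * n.-tuple T => F (p.1, fset_of p.2)) ->
  measurable_fun setT (fun p : P * n.+1.-tuple T => F (p.1, fset_of p.2)).
Proof.
move=> mG0 F0 FU n mG mF.
have mt : measurable_fun setT (fun p : P * n.+1.-tuple T => thead p.2).
  exact: measurableT_comp (measurable_tnth ord0) measurable_snd.
have mb : measurable_fun setT (fun p : P * n.+1.-tuple T =>
    [tuple of behead p.2] : n.-tuple T).
  exact: measurableT_comp (@measurable_behead _ T n) measurable_snd.
rewrite (_ : (fun p => _) = (fun p : P * n.+1.-tuple T =>
  if thead p.2 \in (behead_tuple p.2 : seq T) then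
    F (p.1, fset_of (behead_tuple p.2))
  else G (p.1, thead p.2) (fset_of (behead_tuple p.2)))); last first.
  apply/funext => -[p x] /=; rewrite {1}(tuple_eta x) fset_of_cons.
  case: ifPn => tx; first by rewrite mem_fset1U// mem_fset_of.
  by rewrite FU// mem_fset_of.
apply: measurable_fun_ifT => /=.
- exact: (measurable_comp_pair measurable_in_seq mt
           (measurableT_comp (@measurable_seq_of_tuple _ T n) mb)).
- exact: (measurable_comp_pair mF measurable_fst mb).
- by apply: (measurable_comp_pair mG _ mb); mpair.
Qed.

Lemma measurable_big_fset d1 (P : measurableType d1) (idx : R)
    (op : Monoid.com_law idx) (v : P * T -> R) :
  measurable_fun setT (fun x : R * R => op x.1 x.2) ->
  measurable_fun setT v ->
  measurable_fun setT (fun p : P * seq T => \big[op/idx]_(y <- fset_of p.2) v (p.1, y)).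
Proof.
move=> mop mv; apply: measurable_fun_prod_seq; elim=> [|n IH].
  rewrite (_ : (fun p => _) = cst idx)//; apply/funext => -[p x] /=.
  by rewrite (tuple0 x) fset_of_nil big_seq_fset0.
apply: (@measurable_fset_rec _ _ P R
  (fun p => \big[op/idx]_(y <- p.2) v (p.1, y)) (cst idx)
  (fun q eta => op (v q) (\big[op/idx]_(y <- eta) v (q.1, y)))) => //.
- by move=> p /=; rewrite big_seq_fset0.
- by move=> p a eta an /=; rewrite big_fsetU1.
- apply: (measurable_comp_pair mop (measurableT_comp mv measurable_fst)).
  exact: (measurable_comp_pair IH (measurableT_comp measurable_fst measurable_fst) measurable_snd).
Qed.

Lemma measurable_prod_fset d1 (P : measurableType d1) (v : P * T -> R) :
  measurable_fun setT v ->
  measurable_fun setT (fun p : P * seq T => \prod_(y <- fset_of p.2) v (p.1, y)).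
Proof. by apply: measurable_big_fset; exact: measurable_funM. Qed.

Lemma measurable_sum_fset d1 (P : measurableType d1) (v : P * T -> R) :
  measurable_fun setT v ->
  measurable_fun setT (fun p : P * seq T => \sum_(y <- fset_of p.2) v (p.1, y)).
Proof. by apply: measurable_big_fset; exact: measurable_funD. Qed.

Lemma measurable_card_fset :
  measurable_fun setT (fun s : seq T => #|` fset_of s|%:R : R).
Proof.
have := @measurable_sum_fset _ T (cst 1) (measurable_cst _).
move=> /(measurable_fun_pair2 point).
rewrite (_ : (fun y => _) = (fun s : seq T => #|` fset_of s|%:R : R))//.
by apply/funext => s /=; rewrite big_const_seq count_predT iter_addr_0.
Qed.

Lemma measurable_pow_card_fset (c : R) :
  measurable_fun setT (fun s : seq T => c ^+ #|` fset_of s|).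
Proof.
have := @measurable_prod_fset _ T (cst c) (measurable_cst _).
move=> /(measurable_fun_pair2 point).
rewrite (_ : (fun y => _) = (fun s : seq T => c ^+ #|` fset_of s|))//.
by apply/funext => s /=; rewrite big_const_seq count_predT iter_mulr_1.
Qed.

(** The induction is on the length of the tuple with the parameter space generalized, since
    [splitsumU1] turns the head of the tuple into an additional parameter. *)
Lemma measurable_splitsum d1 (P : measurableType d1)
    (f : P -> {fset T} -> {fset T} -> R) :
  measurable_fun setT (fun p : P * (seq T * seq T) =>
     f p.1 (fset_of p.2.1) (fset_of p.2.2)) ->
  measurable_fun setT (fun p : P * seq T => splitsum (f p.1) (fset_of p.2)).
Proof.
move=> mf; apply: measurable_fun_prod_seq => n.
elim: n d1 P f mf => [|n IH] d1 P f mf.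
  rewrite (_ : (fun p => _) = (fun p : P * 0.-tuple T =>
    f p.1 (fset_of [::]) (fset_of [::]))); last first.
    by apply/funext => -[p x] /=; rewrite (tuple0 x) fset_of_nil splitsum0.
  have := measurable_fun_pair1 ([::], [::]) mf.
  by move=> /measurableT_comp; apply.
pose f1 (q : P * T) omega zeta := f q.1 (q.2 |` omega)%fset zeta.
pose f2 (q : P * T) omega zeta := f q.1 omega (q.2 |` zeta)%fset.
have mq1 : measurable_fun setT (fun q : P * T * (seq T * seq T) => q.1.1).
  exact: measurableT_comp measurable_fst measurable_fst.
have mq2 : measurable_fun setT (fun q : P * T * (seq T * seq T) => q.1.2).
  exact: measurableT_comp measurable_snd measurable_fst.
have ms1 : measurable_fun setT (fun q : P * T * (seq T * seq T) => q.2.1).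
  exact: measurableT_comp measurable_fst measurable_snd.
have ms2 : measurable_fun setT (fun q : P * T * (seq T * seq T) => q.2.2).
  exact: measurableT_comp measurable_snd measurable_snd.
have mf1 : measurable_fun setT (fun q : P * T * (seq T * seq T) =>
     f1 q.1 (fset_of q.2.1) (fset_of q.2.2)).
  rewrite /f1; under eq_fun do rewrite -fset_of_cons.
  apply: (measurable_comp_pair mf mq1 (measurable_fun_pair
    (measurable_comp_pair measurable_seq_cons mq2 ms1) ms2)).
have mf2 : measurable_fun setT (fun q : P * T * (seq T * seq T) =>
     f2 q.1 (fset_of q.2.1) (fset_of q.2.2)).
  rewrite /f2; under eq_fun do rewrite -fset_of_cons.
  apply: (measurable_comp_pair mf mq1 (measurable_fun_pair
    ms1 (measurable_comp_pair measurable_seq_cons mq2 ms2))).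
apply: (@measurable_fset_rec _ _ P R (fun p => splitsum (f p.1) p.2)
  (fun p => f p fset0 fset0)
  (fun q eta => splitsum (f1 q) eta + splitsum (f2 q) eta)).
- rewrite -fset_of_nil; have := measurable_fun_pair1 ([::], [::]) mf; exact.
- by move=> p /=; rewrite splitsum0.
- by move=> p a eta an /=; rewrite splitsumU1.
- by apply: measurable_funD; [exact: (IH _ _ f1)|exact: (IH _ _ f2)].
- exact: (IH _ _ f).
Qed.

End measurable_fset_ops.

(** * Diffuse base measures and the Minlos lemma *)

Section minlos.
Context {d} {T : measurableType d} {R : realType}.
Variable mu : {sigma_finite_measure set T -> \bar R}.
Hypothesis mdiag : measurable [set p : T * T | p.1 = p.2].
Hypothesis diffuse : forall x : T, mu [set x] = 0%E.
Local Open Scope ereal_scope.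

Let nu := seq_measure mu.

Lemma measurable_set1_diag (a : T) : measurable [set a].
Proof.
have := measurable_xsection a mdiag; congr (measurable _).
by apply/seteqP; split=> b; rewrite /xsection /= inE /=.
Qed.

Let measurable_in a :
  measurable_fun setT (fun s : seq T => (a \in s)%:R%:E : \bar R).
Proof.
apply/measurable_EFinP; rewrite (_ : (fun s => _) =
  (fun s : seq T => if a \in s then 1%R else 0%R : R)).
  apply: measurable_fun_ifT => //.
  exact: (measurable_fun_pair2 a (measurable_in_seq mdiag)).
by apply/funext => s /=; case: (_ \in _).
Qed.

(** Heads equal to [a] form a null set because [mu] is diffuse; for every other head, membership is
    decided by the tail. *)
Lemma mu_pow_notin n (a : T) :
  \int[mu_pow mu n]_x (a \in (x : seq T))%:R%:E = 0.
Proof.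
have m0 := measurable_in a.
have p0 (s : seq T) : 0 <= ((a \in s)%:R%:E : \bar R) by rewrite lee_fin ler0n.
elim: n => [|n IH]; first by rewrite (mu_pow0_integral _ p0 m0).
rewrite (mu_powS_integral _ n p0 m0).
have m1 : measurable_fun setT (fun b : T =>
    \int[mu_pow mu n]_x (a \in b :: (x : seq T))%:R%:E).
  apply: (measurable_fun_fubini_tonelli_F
    (fun p : T * n.-tuple T => (a \in p.1 :: p.2)%:R%:E)) => //=.
  apply: (measurableT_comp m0).
  exact: (measurable_comp_pair measurable_seq_cons measurable_fst
    (measurableT_comp (@measurable_seq_of_tuple _ T n) measurable_snd)).
rewrite (ge0_ae_eq_integral _ m1 (measurable_cst 0))//.
- by rewrite integral0.
- by move=> b _; apply: integral_ge0 => x _; exact: p0.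
exists [set a]; split; [exact: measurable_set1_diag|exact: diffuse|].
move=> b /= /not_implyP[_]; apply: contra_notP => ba.
rewrite -IH; apply: eq_integral => x _; rewrite inE.
by have [ab|//] := eqVneq a b; case: ba.
Qed.

(** The recursion for [F] is required only at points outside the configuration, which suffices
    because almost every tail avoids a given head. *)
Lemma mu_powS_fset n (F : {fset T} -> \bar R) (G : T -> {fset T} -> \bar R) :
  measurable_fun setT (F \o fset_of) -> (forall eta, 0 <= F eta) ->
  measurable_fun setT (fun p : T * seq T => G p.1 (fset_of p.2)) ->
  (forall a eta, 0 <= G a eta) ->
  (forall a eta, a \notin eta -> F (a |` eta)%fset = G a eta) ->
  \int[mu_pow mu n.+1]_x F (fset_of x) =
  \int[mu]_a \int[mu_pow mu n]_x G a (fset_of x).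
Proof.
move=> mF F0 mG G0 FG.
rewrite (@mu_powS_integral _ _ _ mu n (fun s => F (fset_of s)))//.
apply: eq_integral => a _.
have mst := @measurable_seq_of_tuple _ T n.
apply: ge0_ae_eq_integral => //.
- apply: (measurableT_comp mF (measurable_comp_pair measurable_seq_cons
    (measurable_cst a) mst)).
- by have := measurable_comp_pair mG (measurable_cst a) mst.
have m0 : measurable_fun setT (fun x : n.-tuple T =>
    (a \in (x : seq T))%:R%:E : \bar R).
  exact: measurableT_comp (measurable_in a) mst.
have := mu_pow_notin n a.
rewrite (eq_integral (fun x : n.-tuple T => `|(a \in (x : seq T))%:R%:E|)); last first.
  by move=> x _ /=; rewrite normr_nat.
move=> /(ae_eq_integral_abs _ measurableT m0).1.
apply: filterS => x /(_ I) /= ax _; rewrite fset_of_cons FG//.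
rewrite mem_fset_of; apply/negP => axx.
by move: ax; rewrite axx => -[] /eqP; rewrite oner_eq0.
Qed.

Lemma seq_measure_disjoint (eta : {fset T}) :
  {ae nu, forall s, [disjoint fset_of s & eta]%fset}.
Proof.
elim/(@fset_of_ind T): eta => [|a eta _ IH].
  by apply: (filterS _ (filterT : {ae nu, forall s, True})) => s _; exact: fdisjointX0.
have m0 := measurable_in a.
have : {ae nu, forall s, a \notin s}.
  have : \int[nu]_s (a \in s)%:R%:E = 0.
    rewrite ge0_integral_seq_measure//.
    by apply: eseries0 => n _ _; rewrite mu_pow_notin mule0.
  rewrite (eq_integral (fun x : seq T => `|(a \in x)%:R%:E|)); last first.
    by move=> x _ /=; rewrite normr_nat.
  move=> /(ae_eq_integral_abs _ measurableT m0).1.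
  apply: filterS => x /(_ I) /= ax; apply/negP => axx.
  by move: ax; rewrite axx => -[] /eqP; rewrite oner_eq0.
apply: filterS2 IH => s se as_.
by rewrite fdisjointXU fdisjointX1 mem_fset_of as_.
Qed.

(** The two products differ only on tuples with a repeated entry. The induction through
    [mu_powS_fset] shows that such tuples do not contribute, without describing them. *)
Lemma mu_pow_prod_fset n (v : T -> R) : measurable_fun setT v ->
  (forall x, (0 <= v x)%R) ->
  \int[mu_pow mu n]_x (\prod_(y <- fset_of x) v y)%:E =
  \int[mu_pow mu n]_x (\prod_(y <- x) v y)%:E.
Proof.
move=> mv v0.
have mp : measurable_fun setT (fun s : seq T => (\prod_(y <- s) v y)%:E).
  by apply/measurable_EFinP; exact: measurable_prod_seq1.
have mpf : measurable_fun setT (fun s : seq T => (\prod_(y <- fset_of s) v y)%R).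
  have := measurable_prod_fset mdiag (measurableT_comp mv measurable_snd).
  by move=> /(_ _ T)/(measurable_fun_pair2 point).
have p0 (s : seq T) : 0 <= (\prod_(y <- s) v y)%:E by rewrite lee_fin prodr_ge0.
elim: n => [|n IH].
  rewrite (mu_pow0_integral _ p0 mp) (@mu_pow0_integral _ _ _ mu
    (fun s => (\prod_(y <- fset_of s) v y)%:E))//.
  - by rewrite fset_of_nil ?big_seq_fset0 ?big_nil.
  - exact/measurable_EFinP.
rewrite (mu_powS_integral _ n p0 mp) (@mu_powS_fset n
  (fun eta => (\prod_(y <- eta) v y)%:E)
  (fun a eta => (v a)%:E * (\prod_(y <- eta) v y)%:E))//.
- apply: eq_integral => a _.
  rewrite ge0_integralZl ?lee_fin//; last first.
    apply/measurable_EFinP.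
    exact: measurableT_comp mpf (@measurable_seq_of_tuple _ T n).
  rewrite IH -ge0_integralZl ?lee_fin//; last first.
    exact: measurableT_comp mp (@measurable_seq_of_tuple _ T n).
  by apply: eq_integral => x _; rewrite big_cons.
- exact/measurable_EFinP.
- apply/measurable_EFinP; apply: measurable_funM.
    exact: measurableT_comp mv measurable_fst.
  exact: measurableT_comp mpf measurable_snd.
- by move=> a eta; rewrite mule_ge0// lee_fin.
- by move=> a eta ae; rewrite big_fsetU1//= EFinM.
Qed.

Lemma seq_measure_prod_fset (v : T -> R) : measurable_fun setT v ->
  (forall x, (0 <= v x)%R) -> \int[mu]_x (v x)%:E < +oo ->
  \int[nu]_s (\prod_(y <- fset_of s) v y)%:E =
  (expR (fine (\int[mu]_x (v x)%:E)))%:E.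
Proof.
move=> mv v0 vfin.
have mpf : measurable_fun setT (fun s : seq T => (\prod_(y <- fset_of s) v y)%R).
  have := measurable_prod_fset mdiag (measurableT_comp mv measurable_snd).
  by move=> /(_ _ T)/(measurable_fun_pair2 point).
rewrite -seq_measure_prod// !ge0_integral_seq_measure.
- by apply: eq_eseriesr => n _; rewrite mu_pow_prod_fset.
- exact/measurable_EFinP.
- by move=> s; rewrite lee_fin prodr_ge0.
- by apply/measurable_EFinP; exact: measurable_prod_seq1.
- by move=> s; rewrite lee_fin prodr_ge0.
Qed.

Implicit Types (H : {fset T} -> {fset T} -> R).

Definition measurable2 H := measurable_fun setT
  (fun p : seq T * seq T => H (fset_of p.1) (fset_of p.2)).

Let I2 m l H := \int[mu_pow mu m]_x \int[mu_pow mu l]_y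
  (H (fset_of x) (fset_of y))%:E.

Let mI2 d1 (P : measurableType d1) (F : P * seq T -> R) l :
  measurable_fun setT F -> (forall p, (0 <= F p)%R) ->
  measurable_fun setT (fun p => \int[mu_pow mu l]_y (F (p, y : seq T))%:E).
Proof.
move=> mF F0; apply: (measurable_fun_fubini_tonelli_F
  (fun p : P * l.-tuple T => (F (p.1, p.2 : seq T))%:E)) => //=.
  apply/measurable_EFinP; exact: (measurable_comp_pair mF measurable_fst
    (measurableT_comp (@measurable_seq_of_tuple _ T l) measurable_snd)).
by move=> p; rewrite lee_fin.
Qed.

Let H1 H a omega zeta := H (a |` omega)%fset zeta.
Let H2 H a omega zeta := H omega (a |` zeta)%fset.

Let mH1 H : measurable2 H -> measurable_fun setT (fun p : T * (seq T * seq T) =>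
  H1 H p.1 (fset_of p.2.1) (fset_of p.2.2)).
Proof.
move=> mH; rewrite /H1; under eq_fun do rewrite -fset_of_cons.
apply: (measurable_comp_pair mH).
  exact: (measurable_comp_pair measurable_seq_cons measurable_fst
    (measurableT_comp measurable_fst measurable_snd)).
exact: measurableT_comp measurable_snd measurable_snd.
Qed.

Let mH2 H : measurable2 H -> measurable_fun setT (fun p : T * (seq T * seq T) =>
  H2 H p.1 (fset_of p.2.1) (fset_of p.2.2)).
Proof.
move=> mH; rewrite /H2; under eq_fun do rewrite -fset_of_cons.
apply: (measurable_comp_pair mH).
  exact: measurableT_comp measurable_fst measurable_snd.
exact: (measurable_comp_pair measurable_seq_cons measurable_fst
    (measurableT_comp measurable_snd measurable_snd)).
Qed.

Let I2_ge0 m l H : (forall x y, (0 <= H x y)%R) -> 0 <= I2 m l H.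
Proof.
by move=> H0; apply: integral_ge0 => x _; apply: integral_ge0 => y _; rewrite lee_fin.
Qed.

Let I2_1 m l H : measurable2 H -> (forall x y, (0 <= H x y)%R) ->
  \int[mu]_a I2 m l (H1 H a) = I2 m.+1 l H.
Proof.
move=> mH H0; rewrite /I2 (@mu_powS_integral _ _ _ mu m (fun s =>
  \int[mu_pow mu l]_y (H (fset_of s) (fset_of y))%:E)).
- by apply: eq_integral => a _; apply: eq_integral => x _; rewrite fset_of_cons.
- by move=> s; apply: integral_ge0 => y _; rewrite lee_fin.
- exact: (mI2 l mH (fun p => H0 _ _)).
Qed.

Let I2_2 m l H : measurable2 H -> (forall x y, (0 <= H x y)%R) ->
  \int[mu]_a I2 m l (H2 H a) = I2 m l.+1 H.
Proof.
move=> mH H0; rewrite /I2.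
transitivity (\int[mu_pow mu m]_x \int[mu]_a \int[mu_pow mu l]_y
    (H (fset_of x) (fset_of (a :: y)))%:E); last first.
  apply: eq_integral => x _; rewrite (@mu_powS_integral _ _ _ mu l (fun s =>
    (H (fset_of x) (fset_of s))%:E))//.
  - by move=> s; rewrite lee_fin.
  - by apply/measurable_EFinP; exact: measurable_fun_pair2 mH.
rewrite -(fubini_tonelli (fun p : T * m.-tuple T => \int[mu_pow mu l]_y
    (H (fset_of p.2) (fset_of (p.1 :: y)))%:E))/=.
- apply: eq_integral => a _; apply: eq_integral => x _; apply: eq_integral => y _.
  by rewrite fset_of_cons.
- pose F (q : (T * m.-tuple T) * seq T) := H (fset_of q.1.2) (fset_of (q.1.1 :: q.2)).
  apply: (@mI2 _ _ F l) => [|q]; last by rewrite /F.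
  apply: (measurable_comp_pair mH).
    apply: (measurableT_comp (@measurable_seq_of_tuple _ T m)).
    exact: measurableT_comp measurable_snd measurable_fst.
  exact: (measurable_comp_pair measurable_seq_cons
    (measurableT_comp measurable_fst measurable_fst) measurable_snd).
- by move=> p; apply: integral_ge0 => y _; rewrite lee_fin.
Qed.

Let splitsum_ge0 H eta : (forall x y, (0 <= H x y)%R) -> (0 <= splitsum H eta)%R.
Proof. by move=> H0; rewrite /splitsum sumr_ge0. Qed.

Let msplit H : measurable2 H -> measurable_fun setT (fun s => splitsum H (fset_of s)).
Proof.
move=> mH; have := @measurable_splitsum _ _ R mdiag _ T (fun=> H).
move=> /(_ (measurableT_comp mH measurable_snd)).
by move=> /(measurable_fun_pair2 point).
Qed.

(** The binomial coefficient counts the positions assigned to the first part; by symmetry of the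
    product measure each choice gives the same integral. In the induction the two sums of
    [splitsumU1] are merged by Pascal's rule. *)
Lemma mu_pow_splitsum n H : measurable2 H -> (forall x y, (0 <= H x y)%R) ->
  \int[mu_pow mu n]_x (splitsum H (fset_of x))%:E =
  \sum_(m < n.+1) ('C(n, m)%:R)%:E * I2 m (n - m) H.
Proof.
have mst l := @measurable_seq_of_tuple _ T l.
elim: n H => [|n IH] H mH H0.
  rewrite big_ord_recl big_ord0 adde0 bin0 mul1e /I2.
  rewrite (@mu_pow0_integral _ _ _ mu (fun s => (splitsum H (fset_of s))%:E)).
  - rewrite (@mu_pow0_integral _ _ _ mu (fun s =>
      \int[mu_pow mu 0]_y (H (fset_of s) (fset_of y))%:E)).
    + rewrite (@mu_pow0_integral _ _ _ mu (fun s =>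
        (H (fset_of [::]) (fset_of s))%:E)).
      * by rewrite fset_of_nil splitsum0.
      * by move=> s; rewrite lee_fin.
      * by apply/measurable_EFinP; exact: measurable_fun_pair2 mH.
    + by move=> s; apply: integral_ge0 => y _; rewrite lee_fin.
    + exact: (mI2 0 mH (fun p => H0 _ _)).
  - by move=> s; rewrite lee_fin splitsum_ge0.
  - by apply/measurable_EFinP; exact: msplit.
have mHa1 a : measurable2 (H1 H a) by have := measurable_fun_pair2 a (mH1 mH).
have mHa2 a : measurable2 (H2 H a) by have := measurable_fun_pair2 a (mH2 mH).
rewrite (@mu_powS_fset n (fun eta => (splitsum H eta)%:E)
   (fun a eta => (splitsum (H1 H a) eta)%:E + (splitsum (H2 H a) eta)%:E)).
- have mI m l (Ha : T -> {fset T} -> {fset T} -> R) :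
    measurable_fun setT (fun p : T * (seq T * seq T) =>
      Ha p.1 (fset_of p.2.1) (fset_of p.2.2)) -> (forall a x y, (0 <= Ha a x y)%R) ->
      measurable_fun setT (fun a => I2 m l (Ha a)).
    move=> mHa Ha0; apply: (measurable_fun_fubini_tonelli_F (fun p : T * m.-tuple T =>
       \int[mu_pow mu l]_y (Ha p.1 (fset_of p.2) (fset_of y))%:E)).
      pose F (q : T * m.-tuple T * seq T) := Ha q.1.1 (fset_of q.1.2) (fset_of q.2).
      apply: (@mI2 _ _ F l) => [|q]; last by rewrite /F.
      have mg : measurable_fun setT (fun q : T * m.-tuple T * seq T => q.1.1).
        exact: measurableT_comp measurable_fst measurable_fst.
      have mh : measurable_fun setT (fun q : T * m.-tuple T * seq T =>
          (seq_of_tuple q.1.2, q.2)).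
        mpair; apply: (measurableT_comp (mst m)).
        exact: measurableT_comp measurable_snd measurable_fst.
      exact: (measurable_comp_pair mHa mg mh).
    by move=> p; apply: integral_ge0 => y _; rewrite lee_fin.
  have H10 a x y : (0 <= H1 H a x y)%R by exact: H0.
  have H20 a x y : (0 <= H2 H a x y)%R by exact: H0.
  have i0 m l : 0 <= I2 m l H by exact: I2_ge0.
  have i1 m l a : 0 <= I2 m l (H1 H a) by apply: I2_ge0 => x y; exact: H10.
  have i2 m l a : 0 <= I2 m l (H2 H a) by apply: I2_ge0 => x y; exact: H20.
  have -> : (fun a => \int[mu_pow mu n]_x ((splitsum (H1 H a) (fset_of x))%:E +
      (splitsum (H2 H a) (fset_of x))%:E)) = (fun a =>
      \sum_(m < n.+1) ('C(n, m)%:R)%:E * (I2 m (n - m) (H1 H a) + I2 m (n - m) (H2 H a))).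
    apply/funext => a; rewrite ge0_integralD//=.
    + rewrite !IH// -big_split/=; apply: eq_bigr => m _.
      by rewrite (ge0_muleDr _ (i1 _ _ a) (i2 _ _ a)).
    + by move=> x _; rewrite lee_fin splitsum_ge0.
    + apply/measurable_EFinP; exact: measurableT_comp (msplit (mHa1 a)) (mst n).
    + by move=> x _; rewrite lee_fin splitsum_ge0.
    + apply/measurable_EFinP; exact: measurableT_comp (msplit (mHa2 a)) (mst n).
  rewrite ge0_integral_sum//; last 2 first.
  + move=> m; apply: emeasurable_funM => //.
    by apply: emeasurable_funD; apply: mI => //; [exact: mH1|exact: mH2].
  + by move=> m a _; rewrite mule_ge0 ?lee_fin// adde_ge0.
  have -> : \sum_(m < n.+1) \int[mu]_a (('C(n, m)%:R)%:E *
      (I2 m (n - m) (H1 H a) + I2 m (n - m) (H2 H a))) =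
      \sum_(m < n.+1) ('C(n, m)%:R)%:E * (I2 m.+1 (n - m) H + I2 m (n - m).+1 H).
    apply: eq_bigr => m _; rewrite ge0_integralZl ?lee_fin//.
    + rewrite ge0_integralD//.
      * by rewrite I2_1// I2_2.
      * by apply: mI => //; exact: mH1.
      * by apply: mI => //; exact: mH2.
    + by apply: emeasurable_funD; apply: mI => //; [exact: mH1|exact: mH2].
    + by move=> a _; rewrite adde_ge0.
  (* Pascal's rule is applied to all coefficients but the first; the two resulting sums match the
     two on the left after shifting indices, the surplus term having coefficient C(n, n + 1) = 0. *)
  rewrite [RHS]big_ord_recl/= bin0 subn0.
  under [X in _ = _ + X]eq_bigr => i _.
    rewrite /bump/= add1n binS natrD EFinD ge0_muleDl ?lee_fin// subSS; over.
  rewrite big_split/= addeA.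
  under eq_bigr => i _ do rewrite (ge0_muleDr _ (i0 _ _) (i0 _ _)).
  rewrite big_split/= [LHS]addeC; congr (_ + _).
  rewrite big_ord_recl/= bin0 subn0; congr (_ + _).
  rewrite [RHS]big_ord_recr/= bin_small// mul0e adde0.
  by apply: eq_bigr => i _; rewrite /bump/= add1n subnSK.
- by apply/measurable_EFinP; exact: msplit.
- by move=> eta; rewrite lee_fin splitsum_ge0.
- apply: emeasurable_funD; apply/measurable_EFinP.
    exact: (measurable_splitsum mdiag (mH1 mH)).
  exact: (measurable_splitsum mdiag (mH2 mH)).
- by move=> a eta; apply: adde_ge0; rewrite lee_fin; apply: splitsum_ge0 => x y;
  exact: H0.
- by move=> a eta ae; rewrite splitsumU1.
Qed.

(* Minlos lemma. *)
Lemma seq_measure_splitsum H : measurable2 H -> (forall x y, (0 <= H x y)%R) ->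
  \int[nu]_s (splitsum H (fset_of s))%:E =
  \int[nu]_s \int[nu]_t (H (fset_of s) (fset_of t))%:E.
Proof.
move=> mH H0.
pose c m : \bar R := (m`!%:R^-1)%:E.
have c0 m : 0 <= c m by rewrite lee_fin invr_ge0.
(* C(n, m) / n! = 1 / (m! (n - m)!). Setting the terms with m > n to 0 makes the summation range a
   full quadrant, on which nonnegative sums can be exchanged. *)
pose a m n := if (m <= n)%N then c m * c (n - m)%N * I2 m (n - m) H else 0.
have a0 m n : 0 <= a m n.
  by rewrite /a; case: ifP => // _; rewrite !mule_ge0 ?I2_ge0.
transitivity (\sum_(n <oo) \sum_(m <oo) a m n).
  rewrite ge0_integral_seq_measure//; last 2 first.
  - by apply/measurable_EFinP; exact: msplit.
  - by move=> s; rewrite lee_fin splitsum_ge0.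
  apply: eq_eseriesr => n _; rewrite mu_pow_splitsum//.
  rewrite (nneseries_split 0 n.+1)//= add0n eseries0 ?adde0; last first.
    by move=> m nm _; rewrite /a leqNgt nm.
  rewrite big_mkord ge0_sume_distrr; last first.
    by move=> i _; rewrite mule_ge0 ?lee_fin ?I2_ge0.
  apply: eq_bigr => -[m /= mn] _; rewrite /a -ltnS mn muleA; congr (_ * _).
  rewrite /c -!EFinM; congr EFin.
  rewrite ltnS in mn; rewrite -(bin_fact mn) !natrM.
  have f0 k : (k`!%:R : R)%R != 0%R by rewrite pnatr_eq0 -lt0n fact_gt0.
  have b0 : ('C(n, m)%:R : R)%R != 0%R by rewrite pnatr_eq0 -lt0n bin_gt0.
  by field; rewrite b0 !f0.
rewrite nneseries_interchange//.
rewrite ge0_integral_seq_measure; last 2 first.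
- apply: (measurable_fun_fubini_tonelli_F (fun p : seq T * seq T =>
    (H (fset_of p.1) (fset_of p.2))%:E)).
    exact/measurable_EFinP.
  by move=> p; rewrite lee_fin.
- by move=> s; apply: integral_ge0 => y _; rewrite lee_fin.
apply: eq_eseriesr => m _.
(* For fixed m the terms with n < m vanish, and the shift n = l + m makes the coefficients of m and
   l separate. *)
rewrite (nneseries_split 0 m)//= add0n big_nat big1 ?add0e; last first.
  by move=> i /andP[_ im]; rewrite /a leqNgt im.
rewrite -nneseries_addn//.
transitivity (\sum_(l <oo) c m * (c l * I2 m l H)).
  by apply: eq_eseriesr => l _; rewrite /a leq_addl addnK muleA.
rewrite nneseriesZl; last by move=> l _; rewrite mule_ge0 ?I2_ge0.
congr (_ * _).
rewrite (eq_integral (fun x : m.-tuple T => \sum_(l <oo) (c l *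
    \int[mu_pow mu l]_y (H (fset_of x) (fset_of y))%:E))); last first.
  move=> x _; rewrite ge0_integral_seq_measure//.
  - by apply/measurable_EFinP; exact: measurable_fun_pair2 mH.
  - by move=> s; rewrite lee_fin.
have mIx l : measurable_fun setT (fun x : m.-tuple T =>
    \int[mu_pow mu l]_y (H (fset_of x) (fset_of y))%:E).
  exact: measurableT_comp (mI2 l mH (fun p => H0 _ _)) (@measurable_seq_of_tuple _ T m).
rewrite integral_nneseries//.
- apply: eq_eseriesr => l _; rewrite ge0_integralZl//.
  by move=> x _; apply: integral_ge0 => y _; rewrite lee_fin.
- by move=> l; apply: emeasurable_funM.
- move=> l x _; rewrite mule_ge0//.
  by apply: integral_ge0 => y _; rewrite lee_fin.
Qed.

End minlos.

(** * Counting splittings by cardinality *)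

Section splitsum_card.
Context {K : choiceType} {R : comPzRingType}.
Implicit Types (eta omega zeta : {fset K}).

Lemma splitsum_cardU1 (V : nmodType) (F : nat -> nat -> V) a eta : a \notin eta ->
  splitsum (fun omega zeta => F #|` omega| #|` zeta|) (a |` eta)%fset =
  splitsum (fun omega zeta => F #|` omega|.+1 #|` zeta|) eta +
  splitsum (fun omega zeta => F #|` omega| #|` zeta|.+1) eta.
Proof.
move=> an; rewrite splitsumU1//; congr (_ + _); apply: eq_splitsum => omega oe.
  by rewrite cardfsU1 (contra (fsubsetP oe a) an).
by rewrite cardfsU1 in_fsetD (negbTE an) andbF.
Qed.

(** Binomial theorem with the subsets listed individually. *)
Lemma splitsum_expr (u v : R) eta :
  splitsum (fun omega zeta => u ^+ #|` omega| * v ^+ #|` zeta|) eta =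
  (u + v) ^+ #|` eta|.
Proof.
elim/(@fset_of_ind K): eta => [|a eta an IH].
  by rewrite splitsum0 !cardfs0 !expr0 mulr1.
rewrite (splitsum_cardU1 (fun i j => u ^+ i * v ^+ j))// cardfsU1 an add1n exprS -IH.
rewrite mulrDl /splitsum !mulr_sumr; congr (_ + _); apply: eq_bigr => omega _.
  by rewrite exprS mulrA.
by rewrite exprS mulrCA.
Qed.

(** The indicator keeps the single term with empty [omega] in the form of a [splitsum], so that it
    can be combined term by term with other such sums. *)
Lemma splitsum_card0 (F : {fset K} -> {fset K} -> R) eta :
  splitsum (fun omega zeta => (#|` omega| == 0)%N%:R * F omega zeta) eta = F fset0 eta.
Proof.
elim/(@fset_of_ind K): eta F => [|a eta an IH] F.
  by rewrite splitsum0 cardfs0 mul1r.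
rewrite splitsumU1// (IH (fun omega zeta => F omega (a |` zeta)%fset)).
rewrite {1}/splitsum big1 ?add0r// => omega _.
by rewrite cardfs_eq0; case: eqP => [h|]; rewrite ?mul0r//;
   have := fset1U1 a omega; rewrite h in_fset0.
Qed.

(** Each of the |eta| singletons leaves |eta| - 1 points. For empty [eta] the truncated predecessor
    is harmless because of the factor 0. *)
Lemma splitsum_card1 (F : nat -> R) eta :
  splitsum (fun omega zeta => (#|` omega| == 1)%N%:R * F #|` zeta|) eta =
  #|` eta|%:R * F #|` eta|.-1.
Proof.
elim/(@fset_of_ind K): eta F => [|a eta an IH] F.
  by rewrite splitsum0 cardfs0 !mul0r.
rewrite (splitsum_cardU1 (fun i j => (i == 1)%N%:R * F j))//.
rewrite (IH (F \o S)) (splitsum_card0 (fun _ zeta => F #|` zeta|)).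
rewrite cardfsU1 an add1n/= -natr1 mulrDl mul1r addrC; congr (_ + _).
by case: #|` eta| => [|n]//=; rewrite !mul0r.
Qed.

Lemma splitsumZ (c : R) (F : {fset K} -> {fset K} -> R) eta :
  splitsum (fun omega zeta => c * F omega zeta) eta = c * splitsum F eta.
Proof. by rewrite /splitsum mulr_sumr. Qed.

Lemma card_split omega eta : (omega `<=` eta)%fset ->
  (#|` omega| + #|` (eta `\` omega)%fset|)%N = #|` eta|.
Proof. by move=> oe; rewrite cardfsD (fsetIidPr oe) subnKC// fsubset_leq_card. Qed.

End splitsum_card.

Lemma le_splitsum {K : choiceType} {R : realDomainType}
    (F G : {fset K} -> {fset K} -> R) (eta : {fset K}) :
  (forall omega, (omega `<=` eta)%fset ->
     F omega (eta `\` omega)%fset <= G omega (eta `\` omega)%fset) ->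
  splitsum F eta <= splitsum G eta.
Proof.
move=> FG; rewrite /splitsum big_seq [leRHS]big_seq; apply: ler_sum => omega.
by rewrite fpowersetE => /FG.
Qed.

Lemma ler_norm_splitsum {K : choiceType} {R : realDomainType}
    (F : {fset K} -> {fset K} -> R) (eta : {fset K}) :
  `|splitsum F eta| <= splitsum (fun omega zeta => `|F omega zeta|) eta.
Proof. exact: ler_norm_sum. Qed.

(** * Elementary inequalities for powers *)

Section geometric.
Context {R : realType}.

(** With s = sqrt (b / a) > 1 one has n (s - 1) <= s^n; squaring gives the claim with c = (s -
    1)^{-2}. *)
Lemma sqr_pow_bound (a b : R) : 0 < a -> a < b ->
  exists2 c, 0 < c & forall n, n%:R ^+ 2 * a ^+ n <= c * b ^+ n.
Proof.
move=> a0 ab; pose s := Num.sqrt (b / a).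
have r1 : 1 < b / a by rewrite ltr_pdivlMr// mul1r.
have s1 : 1 < s by rewrite /s -(sqrtr1 R) ltr_sqrt// (lt_trans ltr01).
have s1' : 0 < s - 1 by rewrite subr_gt0.
exists ((s - 1) ^- 2) => [|n]; first by rewrite invr_gt0 exprn_gt0.
have bE : b = s ^+ 2 * a.
  by rewrite sqr_sqrtr ?divfK ?gt_eqF// ltW// (lt_trans ltr01).
have sn : n%:R * (s - 1) <= s ^+ n.
  elim: n => [|n IH]; first by rewrite mul0r.
  have sn1 : 1 <= s ^+ n by rewrite exprn_ege1// ltW.
  have : s ^+ n * (s - 1) >= s - 1 by rewrite ler_peMl// ltW.
  rewrite -natr1 exprS; lra.
rewrite bE exprMn -exprM mulrA ler_wpM2r ?exprn_ge0 ?(ltW a0)//.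
rewrite mulrC ler_pdivlMr ?exprn_gt0// -exprMn mulnC exprM ler_pXn2r//.
  by rewrite nnegrE mulr_ge0// ltW.
by rewrite nnegrE exprn_ge0// ltW// (lt_trans ltr01).
Qed.

Lemma bernoulli_sub (x : R) n : 0 <= x <= 1 -> 1 - n%:R * x <= (1 - x) ^+ n.
Proof.
move=> /andP[x0 x1]; elim: n => [|n IH]; first by rewrite mul0r subr0.
rewrite exprS; have y0 : 0 <= 1 - x by lra.
have h1 : (1 - x) ^+ n <= 1 by rewrite exprn_ile1//; lra.
have : x * (1 - x) ^+ n <= x by rewrite ler_piMr.
rewrite -natr1; lra.
Qed.

End geometric.

(** * Real-valued integrals: parameters, domination, Fubini *)

Lemma measurable_Rintegral_param d1 d2 (P : measurableType d1) (T : measurableType d2)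
    (R : realType) (nu : {sigma_finite_measure set T -> \bar R}) (F : P * T -> R) :
  measurable_fun setT F -> measurable_fun setT (fun p => \int[nu]_y F (p, y)).
Proof.
move=> mF; apply: (measurableT_comp (fine_measurable measurableT)).
have mE : measurable_fun setT (EFin \o F) by exact/measurable_EFinP.
rewrite (_ : (fun p => _) = (fun p => (\int[nu]_y ((EFin \o F)^\+ (p, y)))%E) \-
   (fun p => (\int[nu]_y ((EFin \o F)^\- (p, y)))%E))%E; last first.
  apply/funext => p; rewrite integralE; congr (_ - _)%E.
    by apply: eq_integral => y _; rewrite !funeposE.
  by apply: eq_integral => y _; rewrite !funenegE.
apply: emeasurable_funB.
  apply: (measurable_fun_fubini_tonelli_F ((EFin \o F)^\+)%E) => //.
  exact: measurable_funepos.
apply: (measurable_fun_fubini_tonelli_F ((EFin \o F)^\-)%E) => //.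
exact: measurable_funeneg.
Qed.

Lemma fsetDUK (K : choiceType) (A B : {fset K}) :
  (A `<=` B)%fset -> (B `\` A `|` A)%fset = B.
Proof.
move=> AB; apply/fsetP => x; rewrite !inE.
by case: (boolP (x \in A)) => [/(fsubsetP AB) ->|]//=; rewrite orbF.
Qed.

Section Rintegral_dom.
Context d (T : measurableType d) (R : realType) (nu : {measure set T -> \bar R}).
Variables (F G : T -> R) (C : R).
Hypotheses (mF : measurable_fun setT F) (mG : measurable_fun setT G).
Hypothesis FG : forall x, `|F x| <= G x.
Hypothesis GC : (\int[nu]_x (G x)%:E <= C%:E)%E.

Lemma integral_norm_dom : (\int[nu]_x `|(F x)%:E| <= C%:E)%E.
Proof.
apply: le_trans GC; apply: ge0_le_integral => //.
- by apply: measurableT_comp => //; exact/measurable_EFinP.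
- exact/measurable_EFinP.
- by move=> x _; rewrite lee_fin.
Qed.

Lemma integrable_dom : nu.-integrable setT (EFin \o F).
Proof.
apply/integrableP; split; first exact/measurable_EFinP.
by apply: le_lt_trans integral_norm_dom _; rewrite ltry.
Qed.

Lemma ler_norm_Rintegral_dom : `|\int[nu]_x F x| <= C.
Proof.
by rewrite -lee_fin EFin_normr_Rintegral//; [|exact: integrable_dom];
   apply: le_trans integral_norm_dom; apply: le_abse_integral => //; exact/measurable_EFinP.
Qed.

End Rintegral_dom.

Section Rintegral_extra.
Context d (T : measurableType d) (R : realType) (nu : {measure set T -> \bar R}).
Implicit Types (f : T -> R).

(** A finite extended integral forces both the positive and the negative part to have finite
    integral; every other value is infinite and is sent to 0 by [fine]. This convention allows
    scaling and the norm inequality to be stated below without integrability. *)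
Lemma Rintegral_nonintegrable f : measurable_fun setT f ->
  ~ nu.-integrable setT (EFin \o f) -> \int[nu]_x f x = 0.
Proof.
move=> mf nif; rewrite /Rintegral.
have mE : measurable_fun setT (EFin \o f) by exact/measurable_EFinP.
have [|] := boolP ((\int[nu]_x (f x)%:E)%E \is a fin_num); last first.
  by case: (\int[nu]_x _)%E.
rewrite integralE fin_numB => /andP[fp fn]; exfalso; apply: nif.
apply/integrableP; split => //.
rewrite (eq_integral (fun x => ((EFin \o f)^\+ x + (EFin \o f)^\- x)%E)); last first.
  by move=> x _; exact: (congr1 (@^~ x) (fune_abse (EFin \o f))).
rewrite ge0_integralD//; [|exact: measurable_funepos|exact: measurable_funeneg].
by rewrite lte_add_pinfty// ltey_eq ?fp ?fn.
Qed.

Lemma Rintegral_scaler f c : measurable_fun setT f ->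
  \int[nu]_x (f x * c) = (\int[nu]_x f x) * c.
Proof.
move=> mf; have [->|c0] := eqVneq c 0.
  by rewrite mulr0; under eq_Rintegral do rewrite mulr0; rewrite Rintegral_cst ?mul0r.
have [fi|fi] := pselect (nu.-integrable setT (EFin \o f)).
  by rewrite RintegralZr.
rewrite [X in _ = X * _]Rintegral_nonintegrable// mul0r Rintegral_nonintegrable//.
  exact: measurable_funM.
move=> ffi; apply: fi.
have := integrableZr measurableT c^-1 ffi.
by apply: eq_integrable => // x _ /=; rewrite -EFinM mulfK.
Qed.

Lemma le_EFin_norm_Rintegral f : measurable_fun setT f ->
  (`|\int[nu]_x f x|%:E <= \int[nu]_x `|(f x)%:E|)%E.
Proof.
move=> mf; have [fi|fi] := pselect (nu.-integrable setT (EFin \o f)).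
  rewrite EFin_normr_Rintegral//; apply: le_abse_integral => //.
  exact/measurable_EFinP.
by rewrite Rintegral_nonintegrable// normr0; exact: integral_ge0.
Qed.

Lemma ae_eq_Rintegral f h : measurable_fun setT f -> measurable_fun setT h ->
  {ae nu, forall x, f x = h x} -> \int[nu]_x f x = \int[nu]_x h x.
Proof.
move=> mf mh fh; congr fine; apply: ae_eq_integral => //.
- exact/measurable_EFinP.
- exact/measurable_EFinP.
- by apply: filterS fh => x -> _.
Qed.

End Rintegral_extra.

Section Rintegral_fubini.
Context d1 d2 (T1 : measurableType d1) (T2 : measurableType d2) (R : realType).
Variables (m1 : {sigma_finite_measure set T1 -> \bar R}).
Variables (m2 : {sigma_finite_measure set T2 -> \bar R}) (f : T1 * T2 -> R).
Hypothesis mf : measurable_fun setT f.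
Hypothesis fi : (\int[m1]_x \int[m2]_y `|(f (x, y))%:E| < +oo)%E.

Lemma integrable_prod : (m1 \x m2)%E.-integrable setT (EFin \o f).
Proof. by apply/integrable12ltyP => //; exact/measurable_EFinP. Qed.

Lemma Rintegral12 : \int[m1]_x \int[m2]_y f (x, y) = \int[(m1 \x m2)%E]_z f z.
Proof.
rewrite {1 3}/Rintegral; congr fine; rewrite -integral12_prod_meas1; last exact: integrable_prod.
apply: ae_eq_integral => //.
- by apply/measurable_EFinP; exact: measurable_Rintegral_param.
- exact: measurable_fubini_F integrable_prod.
apply: filterS (ae_integrable1 integrable_prod) => x fx _.
rewrite /Rintegral fineK//; exact: integrable_fin_num.
Qed.

Lemma Rintegral21 : \int[m2]_y \int[m1]_x f (x, y) = \int[(m1 \x m2)%E]_z f z.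
Proof.
rewrite {1 3}/Rintegral; congr fine; rewrite -integral21_prod_meas1; last exact: integrable_prod.
apply: ae_eq_integral => //.
- apply/measurable_EFinP; apply: (@measurable_Rintegral_param _ _ _ _ _ _
    (fun p : T2 * T1 => f (p.2, p.1))).
  exact: (measurable_comp_pair mf measurable_snd measurable_fst).
- exact: measurable_fubini_G integrable_prod.
apply: filterS (ae_integrable2 integrable_prod) => x fx _.
rewrite /Rintegral fineK//; exact: integrable_fin_num.
Qed.

Lemma Rintegral_swap :
  \int[m1]_x \int[m2]_y f (x, y) = \int[m2]_y \int[m1]_x f (x, y).
Proof. by rewrite Rintegral12 Rintegral21. Qed.

End Rintegral_fubini.

(** * The operators attached to a kernel with values in [0, 1] *)

Section kernel.
Context {d} {T : measurableType d} {R : realType}.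
Variable mu : {sigma_finite_measure set T -> \bar R}.
Hypothesis mdiag : measurable [set p : T * T | p.1 = p.2].
Hypothesis diffuse : forall x : T, mu [set x] = 0%E.
Variables (g : T -> T -> R) (kappa : R).
Hypothesis mg : measurable_fun setT (fun p : T * T => g p.1 p.2).
Hypothesis g_ge0 : forall x y, 0 <= g x y.
Hypothesis g_le1 : forall x y, g x y <= 1.
Hypothesis g_kappa : forall x, (\int[mu]_y (1 - g y x)%:E <= kappa%:E)%E.
Implicit Types (eta omega zeta xi : {fset T}) (k : {fset T} -> R).
Implicit Types a b c z delta K : R.

Let nu := seq_measure mu.
Let lam := lebesgue_poisson mu.

(** For g x y = e^{-phi(x - y)} this is e^{-E^phi(y, omega)}. *)
Definition gprod (y : T) omega : R := \prod_(x <- omega) g y x.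

(** The factor of the summand of P*_delta that contains neither z nor delta; singletons [omega] give
    the nondiagonal part of L. *)
Definition Aop k omega zeta : R := (\prod_(y <- zeta) gprod y omega) *
  \int[lam]_xi ((\prod_(y <- xi) (gprod y omega - 1)) * k (xi `|` zeta)%fset).

Lemma gprod_ge0 y omega : 0 <= gprod y omega.
Proof. exact: prodr_ge0. Qed.

Lemma gprod_le1 y omega : gprod y omega <= 1.
Proof. by apply: prodr_ile1 => x; rewrite g_ge0 g_le1. Qed.

Lemma gprod0 y : gprod y fset0 = 1.
Proof. by rewrite /gprod big_seq_fset0. Qed.

Lemma measurable_gprod :
  measurable_fun setT (fun p : seq T * T => gprod p.2 (fset_of p.1)).
Proof.
have := measurable_prod_fset mdiag mg => m.
exact: (measurable_comp_pair m measurable_snd measurable_fst).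
Qed.

Lemma measurable_prod_gprod (h : R -> R) : measurable_fun setT h ->
  measurable_fun setT (fun p : seq T * seq T =>
    \prod_(y <- fset_of p.2) h (gprod y (fset_of p.1))).
Proof.
move=> mh; apply: (@measurable_prod_fset _ T R mdiag _ (seq T)
  (fun p => h (gprod p.2 (fset_of p.1)))).
exact: measurableT_comp mh measurable_gprod.
Qed.

Lemma measurable_fsetU (k : {fset T} -> R) : measurable_fun setT k ->
  measurable2 (fun xi zeta => k (xi `|` zeta)%fset).
Proof.
move=> /measurable_fun_fset mk; rewrite /measurable2.
by under eq_fun do rewrite -fset_of_cat; exact: measurableT_comp mk measurable_seq_cat.
Qed.

Lemma Rintegral_lebesgue_poisson (f : {fset T} -> R) : measurable_fun setT f ->
  \int[lam]_eta f eta = \int[nu]_s f (fset_of s).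
Proof.
move=> mf; rewrite /Rintegral integral_lebesgue_poisson//.
exact/measurable_EFinP.
Qed.

Definition Akernel k omega zeta xi : R :=
  (\prod_(y <- xi) (gprod y omega - 1)) * k (xi `|` zeta)%fset.

Lemma measurable_Akernel k : measurable_fun setT k ->
  measurable_fun setT (fun q : (seq T * seq T) * seq T =>
    Akernel k (fset_of q.1.1) (fset_of q.1.2) (fset_of q.2)).
Proof.
move=> mk; apply: measurable_funM.
  have mh : measurable_fun setT (fun x : R => x - 1).
    by apply: measurable_funB => //; exact: measurable_cst.
  exact: (measurable_comp_pair (measurable_prod_gprod mh)
    (measurableT_comp measurable_fst measurable_fst) measurable_snd).
exact: (measurable_comp_pair (measurable_fsetU mk) measurable_snd
  (measurableT_comp measurable_snd measurable_fst)).
Qed.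

Lemma measurable_Akernel1 k omega zeta : measurable_fun setT k ->
  measurable_fun setT (Akernel k omega zeta).
Proof.
move=> mk; apply/measurable_fun_fset; rewrite -[omega]fset_of_enum -[zeta]fset_of_enum.
exact: (measurable_fun_pair2 (enum_fset omega, enum_fset zeta) (measurable_Akernel mk)).
Qed.

Lemma AopE k omega zeta : measurable_fun setT k ->
  Aop k omega zeta = (\prod_(y <- zeta) gprod y omega) *
    \int[nu]_s Akernel k omega zeta (fset_of s).
Proof.
by move=> mk; rewrite /Aop -Rintegral_lebesgue_poisson//; exact: measurable_Akernel1.
Qed.

Lemma measurable_Aop k : measurable_fun setT k -> measurable2 (Aop k).
Proof.
move=> mk; rewrite /measurable2; under eq_fun do rewrite AopE//.
apply: measurable_funM; first exact: (measurable_prod_gprod (@measurable_id _ R setT)).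
exact: (measurable_Rintegral_param nu (measurable_Akernel mk)).
Qed.

(* With [g x y] = e^{-phi(x - y)}, [Pst] is the operator P*_delta, [Lst] the formal
   adjoint of Lhat, which is [Lh] below; [Lst] collects the terms of first order in
   delta of [Pst]. *)
Definition Pst z delta k eta : R := splitsum (fun omega zeta =>
  (1 - delta) ^+ #|` zeta| * (z * delta) ^+ #|` omega| * Aop k omega zeta) eta.

Definition Lst z k eta : R := - (#|` eta|%:R * k eta) +
  z * splitsum (fun omega zeta => (#|` omega| == 1)%N%:R * Aop k omega zeta) eta.

Lemma measurable_splitsum_fset (H : {fset T} -> {fset T} -> R) :
  measurable2 H -> measurable_fun setT (splitsum H).
Proof.
move=> mH; apply/measurable_fun_fset; have := @measurable_splitsum _ _ R mdiag _ T (fun=> H).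
move=> /(_ (measurableT_comp mH measurable_snd)).
by move=> /(measurable_fun_pair2 point).
Qed.

Lemma measurable_card (h : R -> R) : measurable_fun setT h ->
  measurable_fun setT (fun eta => h #|` eta|%:R).
Proof.
move=> mh; apply/measurable_fun_fset.
exact: measurableT_comp mh (measurable_card_fset mdiag).
Qed.

Lemma measurable_card1 :
  measurable_fun setT (fun eta => (#|` eta| == 1)%N%:R : R).
Proof.
rewrite (_ : (fun eta => _) = (fun eta => \1_[set 1%R] (#|` eta|%:R : R))).
  by apply: measurable_card; exact: measurable_indic.
apply/funext => eta; rewrite indicE; congr (nat_of_bool _)%:R.
apply/idP/idP => [/eqP ->|]; first by rewrite inE.
by rewrite inE/= => /eqP; rewrite pnatr_eq1.
Qed.

Lemma measurable_pow_card a : measurable_fun setT (fun eta => a ^+ #|` eta|).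
Proof. by apply/measurable_fun_fset; exact: measurable_pow_card_fset. Qed.

Lemma measurable2_fst (f : {fset T} -> R) : measurable_fun setT f ->
  measurable2 (fun omega zeta => f omega).
Proof. by move=> /measurable_fun_fset mf; exact: measurableT_comp mf measurable_fst. Qed.

Lemma measurable2_snd (f : {fset T} -> R) : measurable_fun setT f ->
  measurable2 (fun omega zeta => f zeta).
Proof. by move=> /measurable_fun_fset mf; exact: measurableT_comp mf measurable_snd. Qed.

Lemma measurable_Pst z delta k : measurable_fun setT k ->
  measurable_fun setT (Pst z delta k).
Proof.
move=> mk; apply: measurable_splitsum_fset; apply: measurable_funM; last first.
  exact: measurable_Aop.
apply: measurable_funM.
  exact: (measurable2_snd (measurable_pow_card (1 - delta))).
exact: (measurable2_fst (measurable_pow_card (z * delta))).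
Qed.

Lemma measurable_Lst z k : measurable_fun setT k ->
  measurable_fun setT (Lst z k).
Proof.
move=> mk; apply: measurable_funD.
  by apply: measurableT_comp => //; apply: measurable_funM => //;
     exact: (measurable_card (@measurable_id _ R setT)).
apply: measurable_funM => //; apply: measurable_splitsum_fset.
apply: measurable_funM; last exact: measurable_Aop.
exact: (measurable2_fst measurable_card1).
Qed.

(* The bound defining the norm of K_a, but required at every configuration. *)
Definition fbound a K k :=
  measurable_fun setT k /\ forall eta, `|k eta| <= K * a ^+ #|` eta|.

Lemma fbound_ge0 a K k : fbound a K k -> 0 <= K.
Proof. by move=> [_ /(_ fset0)]; rewrite cardfs0 mulr1; exact: le_trans. Qed.

Lemma measurable_gprod1 omega : measurable_fun setT (fun y => gprod y omega).
Proof.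
by rewrite -[omega]fset_of_enum; exact: (measurable_fun_pair2 _ measurable_gprod).
Qed.

(** Union bound: 1 - u v <= (1 - u) + (1 - v) for u, v in [0, 1], one factor for each point of
    [omega]. *)
Lemma integral_gprod_le omega :
  (\int[mu]_y (1 - gprod y omega)%:E <= (kappa * #|` omega|%:R)%:E)%E.
Proof.
elim/(@fset_of_ind T): omega => [|a omega an IH].
  under eq_integral do rewrite gprod0 subrr.
  by rewrite integral0 cardfs0 mulr0.
have mga : measurable_fun setT (fun y => g y a).
  exact: (measurable_fun_pair1 a mg).
have m1 (h : T -> R) : measurable_fun setT h ->
    measurable_fun setT (fun y => (1 - h y)%:E).
  by move=> mh; apply/measurable_EFinP; apply: measurable_funB.
apply: (@le_trans _ _ (\int[mu]_y ((1 - g y a)%:E + (1 - gprod y omega)%:E))%E).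
  apply: ge0_le_integral => //.
  - by move=> y _; rewrite lee_fin subr_ge0 gprod_le1.
  - exact: (m1 _ (measurable_gprod1 _)).
  - by apply: emeasurable_funD; apply: m1 => //; exact: measurable_gprod1.
  - move=> y _; rewrite -EFinD lee_fin /gprod big_fsetU1//= -/(gprod y omega).
    have := mulr_ge0 (_ : 0 <= 1 - g y a) (_ : 0 <= 1 - gprod y omega).
    by rewrite !subr_ge0 gprod_le1 g_le1 => /(_ isT isT); lra.
rewrite ge0_integralD//; first last.
- exact: (m1 _ (measurable_gprod1 _)).
- by move=> y _; rewrite lee_fin subr_ge0 gprod_le1.
- exact: m1.
- by move=> y _; rewrite lee_fin subr_ge0.
by rewrite cardfsU1 an add1n -natr1 mulrDr mulr1 addrC EFinD leeD.
Qed.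

(** The exponential formula with exponent at most a kappa |omega|. This is the origin of the
    constant exp (a kappa) in the stability condition. *)
Lemma integral_prod_gprod_le a omega : 0 <= a ->
  (\int[nu]_s (\prod_(y <- fset_of s) (a * (1 - gprod y omega)))%:E <=
   (expR (a * kappa) ^+ #|` omega|)%:E)%E.
Proof.
move=> a0; have m1 : measurable_fun setT (fun y => (1 - gprod y omega)).
  by apply: measurable_funB => //; exact: measurable_gprod1.
have i1 : (\int[mu]_y (a * (1 - gprod y omega))%:E <=
    (a * (kappa * #|` omega|%:R))%:E)%E.
  under eq_integral do rewrite EFinM.
  rewrite ge0_integralZl//.
  - by rewrite EFinM; apply: lee_wpmul2l => //; exact: integral_gprod_le.
  - exact/measurable_EFinP.
  - by move=> y _; rewrite lee_fin subr_ge0 gprod_le1.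
rewrite seq_measure_prod_fset//.
- rewrite lee_fin -expRM_natr ler_expR -mulrA -lee_fin fineK//.
  rewrite ge0_fin_numE ?(le_lt_trans i1) ?ltry//.
  by apply: integral_ge0 => y _; rewrite lee_fin mulr_ge0// subr_ge0 gprod_le1.
- by apply: measurable_funM.
- by move=> y; rewrite mulr_ge0// subr_ge0 gprod_le1.
- by rewrite (le_lt_trans i1) ?ltry.
Qed.

(** [xi] and [zeta] may overlap, so their union has at most |xi| + |zeta| points; 1 <= a turns this
    into a bound on the power. *)
Lemma Akernel_le a K k omega zeta xi : 1 <= a -> fbound a K k ->
  `|Akernel k omega zeta xi| <=
  K * a ^+ #|` zeta| * \prod_(y <- xi) (a * (1 - gprod y omega)).
Proof.
move=> a1 kb; have K0 := fbound_ge0 kb; have a0 : 0 <= a by lra.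
rewrite /Akernel normrM big_split/= big_const_seq count_predT iter_mulr_1.
rewrite normr_prod; under eq_bigr do rewrite distrC ger0_norm ?subr_ge0 ?gprod_le1//.
rewrite [leRHS]mulrA [leRHS]mulrC ler_wpM2l//.
  by apply: prodr_ge0 => y _; rewrite subr_ge0 gprod_le1.
apply: le_trans (kb.2 _) _; rewrite -mulrA ler_wpM2l// -exprD.
apply: ler_weXn2l => //; rewrite addnC.
by rewrite -(cardfsUI xi zeta) leq_addr.
Qed.

Let mprod a omega : measurable_fun setT
  (fun s => \prod_(y <- fset_of s) (a * (1 - gprod y omega))).
Proof.
rewrite -[omega]fset_of_enum.
have mh : measurable_fun setT (fun x : R => a * (1 - x)).
  by apply: measurable_funM => //; exact: measurable_funB.
exact: (measurable_fun_pair2 _ (measurable_prod_gprod mh)).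
Qed.

Let mA k omega zeta : measurable_fun setT k ->
  measurable_fun setT (fun s => Akernel k omega zeta (fset_of s)).
Proof. by move=> /(measurable_Akernel1 omega zeta)/measurable_fun_fset. Qed.

Let Akernel_dom a K k omega zeta : 1 <= a -> fbound a K k ->
  (\int[nu]_s (K * a ^+ #|` zeta| *
      \prod_(y <- fset_of s) (a * (1 - gprod y omega)))%:E <=
   (K * a ^+ #|` zeta| * expR (a * kappa) ^+ #|` omega|)%:E)%E.
Proof.
move=> a1 kb; have K0 := fbound_ge0 kb; have a0 : 0 <= a by lra.
have Ka : 0 <= K * a ^+ #|` zeta| by rewrite mulr_ge0// exprn_ge0.
under eq_integral do rewrite EFinM.
rewrite ge0_integralZl//.
- by rewrite [leRHS]EFinM; apply: lee_wpmul2l => //; exact: integral_prod_gprod_le.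
- exact/measurable_EFinP.
- move=> s _; rewrite lee_fin; apply: prodr_ge0 => y _.
  by rewrite mulr_ge0// subr_ge0 gprod_le1.
Qed.

Lemma Akernel_integrable a K k omega zeta : 1 <= a -> fbound a K k ->
  nu.-integrable setT (EFin \o (fun s => Akernel k omega zeta (fset_of s))).
Proof.
move=> a1 kb.
apply: (integrable_dom (mA omega zeta kb.1) (_ : measurable_fun setT (fun s =>
  K * a ^+ #|` zeta| * \prod_(y <- fset_of s) (a * (1 - gprod y omega)))) _
  (Akernel_dom omega zeta a1 kb)).
  exact: measurable_funM.
by move=> s; exact: Akernel_le.
Qed.

Lemma Aop_le a K k omega zeta : 1 <= a -> fbound a K k ->
  `|Aop k omega zeta| <= K * a ^+ #|` zeta| * expR (a * kappa) ^+ #|` omega|.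
Proof.
move=> a1 kb; rewrite (AopE _ _ kb.1) normrM -[leRHS]mul1r ler_pM//.
  rewrite ger0_norm; last by apply: prodr_ge0 => y _; exact: gprod_ge0.
  by apply: prodr_ile1 => y; rewrite gprod_ge0 gprod_le1.
apply: (ler_norm_Rintegral_dom (mA omega zeta kb.1) (_ : measurable_fun setT (fun s =>
  K * a ^+ #|` zeta| * \prod_(y <- fset_of s) (a * (1 - gprod y omega)))) _
  (Akernel_dom omega zeta a1 kb)).
  exact: measurable_funM.
by move=> s; exact: Akernel_le.
Qed.

(** For empty [omega] the product over [xi] is the indicator of the empty configuration, which has
    unit mass. *)
Lemma Aop0 k zeta : measurable_fun setT k -> Aop k fset0 zeta = k zeta.
Proof.
move=> mk; rewrite AopE//.
rewrite (eq_bigr (fun=> 1)) => [|y _]; last by rewrite gprod0.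
rewrite big1// mul1r.
have AE s : Akernel k fset0 zeta (fset_of s) = k zeta * \prod_(y <- fset_of s) 0.
  rewrite /Akernel mulrC; under eq_bigr do rewrite gprod0 subrr.
  have [->|/fset0Pn[y ys]] := eqVneq (fset_of s) fset0; first by rewrite fset0U.
  by rewrite (big_fsetD1 y ys)/= mul0r !mulr0.
under eq_Rintegral do rewrite AE.
have i1 : (\int[nu]_s (\prod_(y <- fset_of s) 0)%:E = 1%:E :> \bar R)%E.
  rewrite (seq_measure_prod_fset mdiag diffuse (measurable_cst (0 : R)))//.
    by rewrite integral0/= expR0.
  by rewrite integral0 ltry.
rewrite RintegralZl// ?/Rintegral ?i1 ?mulr1//.
apply/integrableP; split.
  apply/measurable_EFinP; have := @measurable_prod_fset _ T R mdiag _ T (cst 0)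
    (measurable_cst _).
  by move=> /(measurable_fun_pair2 point).
under eq_integral => s _ do rewrite /= ger0_norm ?prodr_ge0//.
by rewrite i1 ltry.
Qed.

Lemma AopB a K1 K2 k1 k2 omega zeta : 1 <= a -> fbound a K1 k1 -> fbound a K2 k2 ->
  Aop (k1 - k2) omega zeta = Aop k1 omega zeta - Aop k2 omega zeta.
Proof.
move=> a1 b1 b2; rewrite (AopE _ _ (measurable_funB b1.1 b2.1)) (AopE _ _ b1.1) (AopE _ _ b2.1).
rewrite -mulrBr -RintegralB//.
- by congr (_ * _); apply: eq_Rintegral => s _; rewrite /Akernel -mulrBr.
- exact: Akernel_integrable b1.
- exact: Akernel_integrable b2.
Qed.

Lemma PstB z delta a K1 K2 k1 k2 eta : 1 <= a -> fbound a K1 k1 -> fbound a K2 k2 ->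
  Pst z delta (k1 - k2) eta = Pst z delta k1 eta - Pst z delta k2 eta.
Proof.
move=> a1 b1 b2; rewrite /Pst /splitsum -sumrB; apply: eq_bigr => omega _.
by rewrite (AopB _ _ a1 b1 b2) mulrBr.
Qed.

(** By the binomial theorem the sum is at most K (delta z exp (a kappa) + (1 - delta) a)^{|eta|},
    and the stability condition replaces the base by a convex combination of a with itself. The
    constant [K] is preserved, so the bound survives iteration. *)
Lemma Pst_fbound z delta a K k : 1 <= a -> 0 < z -> 0 < delta < 1 ->
  z * expR (a * kappa) <= a -> fbound a K k -> fbound a K (Pst z delta k).
Proof.
move=> a1 z0 /andP[d0 d1] za kb; have K0 := fbound_ge0 kb.
split; first by apply: measurable_Pst; exact: kb.1.
move=> eta; apply: le_trans (ler_norm_splitsum _ _) _.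
have dz0 : 0 <= z * delta by rewrite mulr_ge0 ?ltW.
have d10 : 0 <= 1 - delta by lra.
have a0 : 0 <= a by lra.
apply: (@le_trans _ _ (K * splitsum (fun omega zeta =>
    (z * delta * expR (a * kappa)) ^+ #|` omega| * ((1 - delta) * a) ^+ #|` zeta|) eta)).
  rewrite -splitsumZ; apply: le_splitsum => omega _.
  rewrite normrM ger0_norm ?mulr_ge0 ?exprn_ge0// !exprMn.
  apply: le_trans (ler_wpM2l _ (Aop_le _ _ a1 kb)) _.
    by rewrite !mulr_ge0 ?exprn_ge0// ltW.
  by rewrite le_eqVlt; apply/orP; left; apply/eqP; ring.
rewrite splitsum_expr ler_wpM2l//; apply: lerXn2r; rewrite ?nnegrE//.
  by rewrite addr_ge0// mulr_ge0// expR_ge0.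
have : delta * (z * expR (a * kappa)) <= delta * a by rewrite ler_wpM2l// ltW.
lra.
Qed.

(** With n = |eta|, the singletons contribute at most K z exp (a kappa) n a^{n-1} <= K n a^n, as
    does the diagonal term. The factor n is weakened to n^2 so that one hypothesis on a and b serves
    both this bound and [Pst_consistency]. *)
Lemma Lst_fbound z a b K k c : 1 <= a -> 0 < z -> z * expR (a * kappa) <= a ->
  (forall n, n%:R ^+ 2 * a ^+ n <= c * b ^+ n) -> fbound a K k ->
  fbound b (2 * K * c) (Lst z k).
Proof.
move=> a1 z0 za abc kb; have K0 := fbound_ge0 kb.
split; first by apply: measurable_Lst; exact: kb.1.
have a0 : 0 <= a by lra.
move=> eta; apply: (@le_trans _ _ (2 * K * (#|` eta|%:R ^+ 2 * a ^+ #|` eta|))); last first.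
  by rewrite -[leRHS]mulrA ler_wpM2l// mulr_ge0.
apply: le_trans (ler_normD _ _) _; rewrite normrN !normrM (gtr0_norm z0).
have sE : z * `|splitsum (fun omega zeta => (#|` omega| == 1)%N%:R * Aop k omega zeta) eta| <=
    K * (#|` eta|%:R * a ^+ #|` eta|).
  apply: (@le_trans _ _ (z * (K * expR (a * kappa) * (#|` eta|%:R * a ^+ #|` eta|.-1)))).
    apply: ler_wpM2l; first exact: ltW.
    rewrite -(splitsum_card1 (fun n => a ^+ n)) -splitsumZ.
    apply: le_trans (ler_norm_splitsum _ _) _; apply: le_splitsum => omega _.
    rewrite normrM normr_nat; have := Aop_le omega (eta `\` omega)%fset a1 kb.
    case: eqP => [->|_]; last by rewrite !mul0r mulr0.
    by rewrite !mul1r expr1 mulrAC.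
  case: #|` eta| => [|n]; first by rewrite !mul0r !mulr0.
  rewrite /= exprS.
  have : (z * expR (a * kappa)) * (K * n.+1%:R * a ^+ n) <= a * (K * n.+1%:R * a ^+ n).
    by rewrite ler_wpM2r// !mulr_ge0// exprn_ge0.
  lra.
have nn : #|` eta|%:R <= #|` eta|%:R ^+ 2 :> R.
  by rewrite -natrX ler_nat; case: #|` eta| => // n; rewrite expnS expn1 leq_pmulr.
have : `|#|` eta|%:R| * `|k eta| <= #|` eta|%:R * (K * a ^+ #|` eta|).
  by rewrite normr_nat ler_wpM2l// kb.2.
have : K * (#|` eta|%:R * a ^+ #|` eta|) <= K * (#|` eta|%:R ^+ 2 * a ^+ #|` eta|).
  by rewrite ler_wpM2l// ler_wpM2r// exprn_ge0.
move: sE; lra.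
Qed.

(** Terms with [omega] empty or a singleton cancel against k + delta L k up to second order, and
    larger [omega] carry at least delta^2. The majorants of the remaining coefficients sum to 2 n
    delta (1 - (1 - delta)^{n-1}) with n = |eta|, which Bernoulli's inequality bounds by 2 n^2
    delta^2. *)
Lemma Pst_consistency z delta a b K k c : 1 <= a -> 0 < z -> 0 < delta < 1 ->
  z * expR (a * kappa) <= a ->
  (forall n, n%:R ^+ 2 * a ^+ n <= c * b ^+ n) -> fbound a K k -> forall eta,
  `|Pst z delta k eta - k eta - delta * Lst z k eta| <=
  2 * K * c * delta ^+ 2 * b ^+ #|` eta|.
Proof.
move=> a1 z0 /andP[d0 d1] za abc kb eta.
have K0 := fbound_ge0 kb; have a0 : 0 <= a by lra.
set E := expR (a * kappa) in za; have E0 : 0 < E by exact: expR_gt0.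
have d10 : 0 <= 1 - delta by lra.
have d11 : 1 - delta <= 1 by lra.
(* Coefficient of [Aop k omega zeta] in the error, for |omega| = j and |zeta| = l. *)
pose coef (j l : nat) := (1 - delta) ^+ l * (z * delta) ^+ j -
  (j == 0)%N%:R * (1 - delta * l%:R) - delta * z * (j == 1)%N%:R.
(* Majorant with the absolute value resolved: Bernoulli's inequality settles the sign for j = 0, (1
   - delta)^l <= 1 for j = 1, and z E <= a removes z and E for j >= 1. *)
pose coef' (j l : nat) := delta ^+ j * (1 - delta) ^+ l +
  (j == 0)%N%:R * (delta * l%:R - 1) +
  (j == 1)%N%:R * (delta - 2 * delta * (1 - delta) ^+ l).
have bern n : 1 - n%:R * delta <= (1 - delta) ^+ n.
  by apply: bernoulli_sub; apply/andP; split; lra.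
have coefP j l : `|coef j l| * E ^+ j <= coef' j l * a ^+ j.
  rewrite /coef /coef'; case: j => [|[|j]] /=.
  - rewrite !mulr1 !mul1r !mulr0 !mul0r ger0_norm; last by have := bern l; lra.
    lra.
  - rewrite !mul0r !mul1r !mulr1 !expr1 subr0 addr0.
    have y1 : (1 - delta) ^+ l <= 1 by exact: exprn_ile1.
    rewrite (_ : _ - _ = - (delta * z * (1 - (1 - delta) ^+ l))); last by ring.
    rewrite normrN ger0_norm; last by rewrite !mulr_ge0 ?subr_ge0 // ltW.
    have : z * E * (delta * (1 - (1 - delta) ^+ l)) <=
           a * (delta * (1 - (1 - delta) ^+ l)).
      by rewrite ler_wpM2r// mulr_ge0 ?subr_ge0// ltW.
    lra.
  - rewrite !mul0r !mulr0 !subr0 !addr0 ger0_norm; last first.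
      by rewrite mulr_ge0// exprn_ge0// mulr_ge0// ltW.
    have zEa : (z * E) ^+ j.+2 <= a ^+ j.+2.
      by apply: lerXn2r; rewrite ?nnegrE// mulr_ge0// ltW.
    rewrite (_ : _ * E ^+ j.+2 =
      delta ^+ j.+2 * (1 - delta) ^+ l * (z * E) ^+ j.+2); last first.
      by rewrite !exprMn; ring.
    by rewrite ler_wpM2l// mulr_ge0 ?exprn_ge0// ltW.
have -> : Pst z delta k eta - k eta - delta * Lst z k eta =
    splitsum (fun omega zeta => coef #|` omega| #|` zeta| * Aop k omega zeta) eta.
  (* The term with empty [omega] is k eta itself by [Aop0]; written as a sum over splittings, it can
     be subtracted under the sum. *)
  have e0 := splitsum_card0 (fun omega zeta =>
    (1 - delta * #|` zeta|%:R) * Aop k omega zeta) eta.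
  rewrite Aop0 in e0; last exact: kb.1.
  rewrite /Pst /Lst; set S1 := splitsum (fun _ _ => (_ == 1)%N%:R * _) eta.
  rewrite (_ : _ - _ - _ = splitsum (fun omega zeta => (1 - delta) ^+ #|` zeta| *
     (z * delta) ^+ #|` omega| * Aop k omega zeta) eta -
     (1 - delta * #|` eta|%:R) * k eta - delta * z * S1); last by ring.
  rewrite -e0 /S1 -splitsumZ /splitsum -!sumrB; apply: eq_bigr => omega _.
  by rewrite /coef; ring.
apply: le_trans (ler_norm_splitsum _ _) _.
apply: (@le_trans _ _ (K * a ^+ #|` eta| *
    splitsum (fun omega zeta => coef' #|` omega| #|` zeta|) eta)).
  rewrite -splitsumZ; apply: le_splitsum => omega oe.
  rewrite normrM -(card_split oe) addnC.
  apply: le_trans (ler_wpM2l _ (Aop_le _ _ a1 kb)) _ => //; rewrite -/E.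
  have := ler_wpM2l (mulr_ge0 K0 (exprn_ge0 #|` (eta `\` omega)%fset| a0))
    (coefP #|` omega| #|` (eta `\` omega)%fset|).
  by rewrite exprD; lra.
have -> : splitsum (fun omega zeta => coef' #|` omega| #|` zeta|) eta =
   2 * #|` eta|%:R * delta * (1 - (1 - delta) ^+ #|` eta|.-1).
  rewrite /coef' !splitsumD splitsum_expr.
  rewrite (splitsum_card0 (fun _ zeta => delta * #|` zeta|%:R - 1)).
  rewrite (splitsum_card1 (fun l => delta - 2 * delta * (1 - delta) ^+ l)).
  by rewrite (addrC delta) subrK expr1n; ring.
apply: (@le_trans _ _ (2 * K * delta ^+ 2 * (#|` eta|%:R ^+ 2 * a ^+ #|` eta|))).
  case: #|` eta| => [|n]; first by rewrite mulr0n expr0n/= !(mulr0, mul0r).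
  have y : 1 - (1 - delta) ^+ n <= n.+1%:R * delta.
    have := bern n; rewrite -natr1; lra.
  have P0 : 0 <= 2 * K * a ^+ n.+1 * n.+1%:R * delta.
    by rewrite !mulr_ge0 ?exprn_ge0// ltW.
  have := ler_wpM2l P0 y; rewrite /=; lra.
have := ler_wpM2l (_ : 0 <= 2 * K * delta ^+ 2) (abc #|` eta|).
by rewrite !mulr_ge0 ?exprn_ge0 ?(ltW d0)// => /(_ isT); lra.
Qed.

(** P*_delta k at eta involves k on unions of [xi] with a subset [zeta] of eta, so an exceptional
    null set must be avoided for almost every [xi] and for all [zeta] inside eta at once. One use of
    the Minlos lemma makes almost every [zeta] good, a second one gives almost every eta only good
    subsets. *)
Lemma Pst_ae_eq z delta k1 k2 : measurable_fun setT k1 -> measurable_fun setT k2 ->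
  {ae lam, forall eta, k1 eta = k2 eta} ->
  {ae lam, forall eta, Pst z delta k1 eta = Pst z delta k2 eta}.
Proof.
move=> mk1 mk2 k12.
pose N := [set eta | k1 eta != k2 eta].
have mN : measurable N.
  rewrite -[N]setTI (_ : N = (k1 \- k2) @^-1` (~` [set 0])); last first.
    by apply/seteqP; split=> eta; rewrite /N/= -subr_eq0 => /eqP.
  by apply: (measurable_funB mk1 mk2) => //; exact: measurableC.
have N0 : lam N = 0%E.
  have [A [mA' A0 kA]] := k12; apply: (subset_measure0 mN mA' _ A0).
  by move=> eta /= /eqP e; apply: kA.
have m1N : measurable_fun setT (\1_N : {fset T} -> R) by exact: measurable_indic.
pose H omega zeta : R := \1_N (zeta `|` omega)%fset.
have mH : measurable2 H.
  have := measurable_fsetU m1N; rewrite /measurable2 /H.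
  by under [X in _ -> measurable_fun _ X]eq_fun do rewrite fsetUC.
have H0 x y : 0 <= H x y by rewrite /H.
(* The measure of the lists whose union with [zeta] falls in [N]. Its integral is 0: by the Minlos
   lemma it equals that of a sum in which every splitting of eta returns eta. *)
pose W zeta := (\int[nu]_t (H zeta (fset_of t))%:E)%E.
have mW : measurable_fun setT (W \o fset_of).
  apply: (measurable_fun_fubini_tonelli_F (fun p : seq T * seq T =>
    (H (fset_of p.1) (fset_of p.2))%:E)) => //; first exact/measurable_EFinP.
  by move=> p; rewrite lee_fin.
have W0 : (\int[nu]_s W (fset_of s) = 0)%E.
  rewrite -(seq_measure_splitsum mdiag diffuse mH H0).
  rewrite -(@integral_lebesgue_poisson _ _ _ mu (fun eta => (splitsum H eta)%:E)); last first.
    by apply/measurable_EFinP; exact: measurable_splitsum_fset.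
  rewrite (ge0_ae_eq_integral _ _ (measurable_cst 0%E))//.
  - by rewrite integral0.
  - by apply/measurable_EFinP; exact: measurable_splitsum_fset.
  - by move=> eta _; rewrite lee_fin /splitsum sumr_ge0.
  exists N; split => // eta /= /not_implyP[_]; apply: contra_notP => eN.
  congr EFin; rewrite /splitsum big_seq big1// => omega; rewrite fpowersetE => oe.
  by rewrite /H fsetDUK// indicE memNset.
have W_ae : {ae nu, forall s, W (fset_of s) = 0%E}.
  have := W0; rewrite (eq_integral (fun s => `|W (fset_of s)|%E)); last first.
    by move=> s _; rewrite gee0_abs// /W integral_ge0// => t _; rewrite lee_fin.
  by move=> /(ae_eq_integral_abs _ measurableT mW).1; apply: filterS => s /(_ I).
pose V zeta : R := \1_(~` [set 0%E]) (W zeta).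
have mV : measurable_fun setT V.
  apply/measurable_fun_fset; apply: measurableT_comp mW.
  by apply: measurable_indic; exact: measurableC.
have mV2 := measurable2_snd mV.
have V0 (x y : {fset T}) : 0 <= V y by rewrite /V.
have : (\int[lam]_eta (splitsum (fun omega zeta => V zeta) eta)%:E = 0)%E.
  rewrite integral_lebesgue_poisson; last first.
    by apply/measurable_EFinP; exact: measurable_splitsum_fset.
  rewrite (seq_measure_splitsum mdiag diffuse mV2 V0).
  rewrite (eq_integral (cst 0%E)) ?integral0// => s _.
  rewrite (ge0_ae_eq_integral _ _ (measurable_cst 0%E)) ?integral0//.
  - by apply/measurable_EFinP; exact/measurable_fun_fset.
  - by move=> t _; rewrite lee_fin.
  apply: filterS W_ae => t Wt _; rewrite /V Wt indicE memNset//=; exact.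
rewrite (eq_integral (fun eta => `|(splitsum (fun omega zeta => V zeta) eta)%:E|%E)); last first.
  by move=> eta _; rewrite gee0_abs// lee_fin /splitsum sumr_ge0.
move=> /(ae_eq_integral_abs _ measurableT _).1 => /(_ _).
have mS : measurable_fun setT (fun eta => (splitsum (fun omega zeta => V zeta) eta)%:E).
  by apply/measurable_EFinP; exact: measurable_splitsum_fset.
move=> /(_ mS); apply: filterS => eta /(_ I)[] /eqP.
rewrite /splitsum psumr_eq0// => /allP Ve.
rewrite /Pst; apply: eq_splitsum => omega oe; congr (_ * _).
have {Ve} : V (eta `\` omega)%fset = 0.
  by have /Ve /= /eqP : omega \in fpowerset eta by rewrite fpowersetE.
set zeta := (eta `\` omega)%fset; rewrite /V indicE => Vz.
have Wz : W zeta = 0%E.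
  apply/eqP; apply: contraPT Vz => /eqP Wz.
  by rewrite mem_set//= => /eqP; rewrite oner_eq0.
rewrite !AopE//; congr (_ * _); rewrite /Rintegral; congr fine.
apply: ae_eq_integral => //.
- by apply/measurable_EFinP; exact: mA.
- by apply/measurable_EFinP; exact: mA.
have mHz : measurable_fun setT (fun t => (H zeta (fset_of t))%:E).
  apply/measurable_EFinP; rewrite -[zeta]fset_of_enum.
  exact: (measurable_fun_pair2 _ mH).
have := Wz; rewrite /W (eq_integral (fun t => `|(H zeta (fset_of t))%:E|%E)); last first.
  by move=> t _; rewrite gee0_abs// lee_fin.
move=> /(ae_eq_integral_abs _ measurableT mHz).1; apply: filterS => t /(_ I)[].
rewrite /H indicE => Ht _; rewrite /Akernel; congr (_ * _)%:E.
apply/eqP; apply: contraPT Ht => kt; rewrite mem_set//=.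
by move=> /eqP; rewrite oner_eq0.
Qed.

(** Minlos lemma for signed functions, from the nonnegative case applied to positive and negative
    parts, both dominated by the absolute value. *)
Lemma integrable_Rsplitsum (H : {fset T} -> {fset T} -> R) : measurable2 H ->
  (\int[nu]_s \int[nu]_t `|(H (fset_of s) (fset_of t))%:E| < +oo)%E ->
  nu.-integrable setT (fun s => (splitsum H (fset_of s))%:E) /\
  \int[nu]_s splitsum H (fset_of s) =
  \int[nu]_s \int[nu]_t H (fset_of s) (fset_of t).
Proof.
move=> mH Hi.
have mHn : measurable2 (fun x y => `|H x y|).
  by apply: measurableT_comp mH; exact: normr_measurable.
pose P x y := Num.max (H x y) 0; pose N x y := Num.max (- H x y) 0.
have mP : measurable2 P.
  by apply: measurable_maxr => //; exact: measurable_cst.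
have mN : measurable2 N.
  apply: measurable_maxr; last exact: measurable_cst.
  by apply: measurableT_comp mH; exact: oppr_measurable.
have P0 x y : 0 <= P x y by rewrite /P le_max lexx orbT.
have N0 x y : 0 <= N x y by rewrite /N le_max lexx orbT.
have PN x y : H x y = P x y - N x y.
  by rewrite /P /N; case: (leP 0 (H x y)) => h; case: (leP 0 (- H x y)) => h'; lra.
have PH x y : P x y <= `|H x y| by rewrite /P ge_max normr_ge0 ler_norm.
have NH x y : N x y <= `|H x y| by rewrite /N ge_max normr_ge0 -normrN ler_norm.
have SH (Q : {fset T} -> {fset T} -> R) : measurable2 Q ->
    measurable_fun setT (fun s => splitsum Q (fset_of s)).
  by move=> /measurable_splitsum_fset/measurable_fun_fset.
have dom (Q : {fset T} -> {fset T} -> R) : measurable2 Q -> (forall x y, 0 <= Q x y) ->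
    (forall x y, Q x y <= `|H x y|) ->
    [/\ (\int[nu]_s \int[nu]_t (Q (fset_of s) (fset_of t))%:E < +oo)%E,
        (nu \x nu)%E.-integrable setT (fun p => (Q (fset_of p.1) (fset_of p.2))%:E),
        nu.-integrable setT (fun s => (splitsum Q (fset_of s))%:E) &
        \int[nu]_s splitsum Q (fset_of s) =
        \int[(nu \x nu)%E]_p Q (fset_of p.1) (fset_of p.2)].
  move=> mQ Q0 QH.
  have Qi : (\int[nu]_s \int[nu]_t (Q (fset_of s) (fset_of t))%:E < +oo)%E.
    apply: le_lt_trans Hi; apply: ge0_le_integral => //.
    - by move=> s _; apply: integral_ge0 => t _; rewrite lee_fin.
    - apply: (measurable_fun_fubini_tonelli_F (fun p : seq T * seq T =>
        (Q (fset_of p.1) (fset_of p.2))%:E)); first exact/measurable_EFinP.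
      by move=> p; rewrite lee_fin.
    - apply: (measurable_fun_fubini_tonelli_F (fun p : seq T * seq T =>
        `|(H (fset_of p.1) (fset_of p.2))%:E|%E)) => //; exact/measurable_EFinP.
    - move=> s _; apply: ge0_le_integral => //.
      + by move=> t _; rewrite lee_fin.
      + by apply/measurable_EFinP; exact: measurable_fun_pair2 mQ.
      + by apply/measurable_EFinP; exact: measurable_fun_pair2 mHn.
      + by move=> t _; rewrite lee_fin.
  have Qi' : (nu \x nu)%E.-integrable setT (fun p => (Q (fset_of p.1) (fset_of p.2))%:E).
    apply: (@integrable_prod _ _ _ _ _ nu nu (fun p => Q (fset_of p.1) (fset_of p.2))) => //.
    by under eq_integral => s _ do under eq_integral do rewrite /= ger0_norm//.
  split => //.
    apply/integrableP; split; first by apply/measurable_EFinP; exact: SH.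
    under eq_integral do rewrite /= ger0_norm ?sumr_ge0//.
    by rewrite seq_measure_splitsum.
  rewrite /Rintegral seq_measure_splitsum// fubini_tonelli1//.
    exact/measurable_EFinP.
  by move=> p; rewrite lee_fin.
have [_ Pi2 Pi1 PE] := dom P mP P0 PH; have [_ Ni2 Ni1 NE] := dom N mN N0 NH.
have HE s : splitsum H s = splitsum P s - splitsum N s.
  by rewrite /splitsum -sumrB; apply: eq_bigr => omega _; rewrite PN.
split.
  rewrite (_ : (fun s => _) = (fun s => (splitsum P (fset_of s))%:E -
    (splitsum N (fset_of s))%:E)%E); first exact: integrableB.
  by apply/funext => s; rewrite HE.
under eq_Rintegral do rewrite HE.
rewrite RintegralB// PE NE -RintegralB//.
rewrite (@Rintegral12 _ _ _ _ _ nu nu (fun p => H (fset_of p.1) (fset_of p.2)))//.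
by apply: eq_Rintegral => p _; rewrite PN.
Qed.

(** The empty tuple gives no point and a longer tuple gives a single one only if its entries
    coincide, a null event. An integral over one point thus becomes one over configurations, to
    which the Minlos lemma applies. *)
Lemma ge0_integral_singleton (F : {fset T} -> R) : measurable_fun setT F ->
  (forall eta, 0 <= F eta) ->
  (\int[nu]_s ((#|` fset_of s| == 1)%N%:R * F (fset_of s))%:E =
   \int[mu]_x (F [fset x]%fset)%:E)%E.
Proof.
move=> mF F0; have mF' : measurable_fun setT (F \o fset_of) by exact/measurable_fun_fset.
have m1 : measurable_fun setT (fun s : seq T => (#|` fset_of s| == 1)%N%:R : R).
  exact: ((measurable_fun_fset _).1 measurable_card1).
have m1F : measurable_fun setT (fun s => ((#|` fset_of s| == 1)%N%:R * F (fset_of s))%:E).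
  by apply/measurable_EFinP; exact: measurable_funM.
have p0 eta : (0 <= ((#|` eta| == 1)%N%:R * F eta)%:E)%E by rewrite lee_fin mulr_ge0.
rewrite ge0_integral_seq_measure// (nneseries_split 0 2)//=; last first.
  by move=> n _; rewrite mule_ge0 ?lee_fin ?invr_ge0//; exact: integral_ge0.
have m0 : measurable_fun setT (fun s : seq T => (#|` fset_of s| == 0)%N%:R : R).
  have := (measurable_fun_fset _).1
    (measurable_card (measurable_indic (measurable_set1 (0 : R)))).
  rewrite (_ : _ \o _ = (fun s : seq T => (#|` fset_of s| == 0)%N%:R : R))//.
  apply/funext => s /=; rewrite indicE; congr (nat_of_bool _)%:R.
  apply/idP/idP => [|/eqP ->]; last by rewrite inE.
  by rewrite inE/= => /eqP; rewrite pnatr_eq0.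
have step n : (\int[mu_pow mu n.+1]_x ((#|` fset_of x| == 1)%N%:R * F (fset_of x))%:E =
    \int[mu]_a \int[mu_pow mu n]_x
      ((#|` fset_of x| == 0)%N%:R * F (a |` fset_of x)%fset)%:E)%E.
  rewrite (mu_powS_fset mdiag diffuse n (F := fun eta => ((#|` eta| == 1)%N%:R * F eta)%:E)
    (G := fun (a : T) eta => ((#|` eta| == 0)%N%:R * F (a |` eta)%fset)%:E))//.
  - apply/measurable_EFinP; apply: measurable_funM.
      exact: measurableT_comp m0 measurable_snd.
    under eq_fun do rewrite -fset_of_cons.
    exact: measurableT_comp mF' measurable_seq_cons.
  - by move=> a eta; rewrite lee_fin mulr_ge0.
  - by move=> a eta an; rewrite cardfsU1 an.
rewrite eseries0 ?adde0; last first.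
  move=> [//|[//|n]] _ _; rewrite step.
  rewrite (eq_integral (cst 0%E)) ?integral0 ?mule0// => a _.
  rewrite (eq_integral (cst 0%E)) ?integral0// => x _.
  rewrite cardfs_eq0; case: eqP => [x0|_]; last by rewrite mul0r.
  have : thead x \in fset_of x by rewrite mem_fset_of mem_tnth.
  by rewrite x0 in_fset0.
rewrite big_nat_recl// big_nat1 step fact0 invr1 !mul1e.
rewrite (@mu_pow0_integral _ _ _ mu
  (fun s => ((#|` fset_of s| == 1)%N%:R * F (fset_of s))%:E))//.
rewrite fset_of_nil cardfs0 mul0r add0e; apply: eq_integral => a _.
rewrite (@mu_pow0_integral _ _ _ mu
  (fun s => ((#|` fset_of s| == 0)%N%:R * F (a |` fset_of s)%fset)%:E)).
- by rewrite fset_of_nil cardfs0 mul1r fsetU0.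
- by move=> s; rewrite lee_fin mulr_ge0.
- apply/measurable_EFinP; apply: measurable_funM => //.
  under eq_fun do rewrite -fset_of_cons.
  exact: measurableT_comp mF' (measurable_fun_pair2 a measurable_seq_cons).
Qed.

Lemma Rintegral_singleton (F : {fset T} -> R) : measurable_fun setT F ->
  \int[mu]_x F [fset x]%fset = \int[nu]_s ((#|` fset_of s| == 1)%N%:R * F (fset_of s)).
Proof.
move=> mF; rewrite /Rintegral [in LHS]integralE [in RHS]integralE; congr (fine (_ - _)%E).
- have mP : measurable_fun setT (fun eta => Num.max (F eta) 0).
    by apply: measurable_maxr => //; exact: measurable_cst.
  transitivity (\int[mu]_x (Num.max (F [fset x]%fset) 0)%:E)%E.
    by apply: eq_integral => x _; rewrite funeposE EFin_max.
  rewrite -(ge0_integral_singleton mP) => [|eta]; last by rewrite le_max lexx orbT.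
  apply: eq_integral => s _; rewrite funeposE -EFin_max; congr EFin.
  by case: eqP => _; rewrite ?mul1r// !mul0r maxxx.
- have mP : measurable_fun setT (fun eta => Num.max (- F eta) 0).
    apply: measurable_maxr; last exact: measurable_cst.
    exact: measurableT_comp (@oppr_measurable R setT) mF.
  transitivity (\int[mu]_x (Num.max (- F [fset x]%fset) 0)%:E)%E.
    by apply: eq_integral => x _; rewrite funenegE EFin_max EFinN.
  rewrite -(ge0_integral_singleton mP) => [|eta]; last by rewrite le_max lexx orbT.
  apply: eq_integral => s _; rewrite funenegE -EFinN -EFin_max; congr EFin.
  by case: eqP => _; rewrite ?mul1r// !mul0r oppr0 maxxx.
Qed.

(** * Duality between [Lh] and [Lst] *)

Hypothesis gC : forall x y, g x y = g y x.

Definition Bop (G : {fset T} -> R) xi zeta : R :=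
  \int[mu]_x (gprod x xi * G (x |` xi)%fset * \prod_(y <- zeta) (g x y - 1)).

Definition Lh z (G : {fset T} -> R) eta : R :=
  - (#|` eta|%:R * G eta) + z * splitsum (Bop G) eta.

(** The integrand of [Bop] with the integration point replaced by a configuration [omega]; the two
    agree on singletons, the symmetry of [g] being used for the factors over [zeta]. *)
Definition Bkernel (G : {fset T} -> R) xi zeta omega : R :=
  (\prod_(y <- xi) gprod y omega) * G (omega `|` xi)%fset *
  \prod_(y <- zeta) (gprod y omega - 1).

Let mgm1 : measurable_fun setT (fun x : R => x - 1).
Proof. by apply: measurable_funB => //; exact: measurable_cst. Qed.

Lemma measurable_Bkernel (G : {fset T} -> R) : measurable_fun setT G ->
  measurable_fun setT (fun q : (seq T * seq T) * seq T =>
    Bkernel G (fset_of q.1.1) (fset_of q.1.2) (fset_of q.2)).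
Proof.
move=> mG.
have m11 : measurable_fun setT (fun q : (seq T * seq T) * seq T => q.1.1).
  exact: measurableT_comp measurable_fst measurable_fst.
have m12 : measurable_fun setT (fun q : (seq T * seq T) * seq T => q.1.2).
  exact: measurableT_comp measurable_snd measurable_fst.
apply: measurable_funM; first apply: measurable_funM.
- exact: (measurable_comp_pair (measurable_prod_gprod (@measurable_id _ R setT))
    measurable_snd m11).
- exact: (measurable_comp_pair (measurable_fsetU mG) measurable_snd m11).
- exact: (measurable_comp_pair (measurable_prod_gprod mgm1) measurable_snd m12).
Qed.

Let m1s : measurable_fun setT (fun s : seq T => (#|` fset_of s| == 1)%N%:R : R).
Proof. exact: ((measurable_fun_fset _).1 measurable_card1). Qed.

Lemma BopE (G : {fset T} -> R) xi zeta : measurable_fun setT G ->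
  Bop G xi zeta =
  \int[nu]_s ((#|` fset_of s| == 1)%N%:R * Bkernel G xi zeta (fset_of s)).
Proof.
move=> mG; rewrite -Rintegral_singleton; last first.
  apply/measurable_fun_fset; rewrite -[xi]fset_of_enum -[zeta]fset_of_enum.
  exact: (measurable_fun_pair2 (enum_fset xi, enum_fset zeta) (measurable_Bkernel mG)).
apply: eq_Rintegral => x _; rewrite /Bkernel; congr (_ * _ * _).
  by apply: eq_bigr => y _; rewrite /gprod big_seq_fset1.
by apply: eq_bigr => y _; rewrite /gprod big_seq_fset1 gC.
Qed.

Lemma measurable_Bop (G : {fset T} -> R) : measurable_fun setT G -> measurable2 (Bop G).
Proof.
move=> mG; rewrite /measurable2; under eq_fun do rewrite BopE//.
apply: (measurable_Rintegral_param nu (F := fun q : (seq T * seq T) * seq T =>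
  (#|` fset_of q.2| == 1)%N%:R *
  Bkernel G (fset_of q.1.1) (fset_of q.1.2) (fset_of q.2))).
apply: measurable_funM; last exact: measurable_Bkernel.
exact: measurableT_comp m1s measurable_snd.
Qed.

Lemma measurable_Lh z (G : {fset T} -> R) : measurable_fun setT G ->
  measurable_fun setT (Lh z G).
Proof.
move=> mG; apply: measurable_funD.
  by apply: measurableT_comp => //; apply: measurable_funM => //;
     exact: (measurable_card (@measurable_id _ R setT)).
by apply: measurable_funM => //; apply: measurable_splitsum_fset; exact: measurable_Bop.
Qed.

Section duality.
Variables (C K : R) (k G : {fset T} -> R).
Hypotheses (C1 : 1 <= C) (kb : fbound C K k) (mG : measurable_fun setT G).
Hypothesis Gi :
  (\int[nu]_s (`|G (fset_of s)| * (2 * C) ^+ #|` fset_of s|)%:E < +oo)%E.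

Let C0 : 0 <= C. Proof. by apply: le_trans C1. Qed.
Let K0 : 0 <= K. Proof. exact: fbound_ge0 kb. Qed.
Let mk : measurable_fun setT k. Proof. exact: kb.1. Qed.

(** Common integrand of both sides of the duality: integrating out [zeta] leaves [G] times [Aop],
    integrating out [omega] leaves [Bop] times [k]. *)
Let Psi omega xi zeta : R :=
  (#|` omega| == 1)%N%:R * ((\prod_(y <- xi) gprod y omega) * G (omega `|` xi)%fset) *
  Akernel k omega xi zeta.

Let mPsi : measurable_fun setT (fun q : (seq T * seq T) * seq T =>
  Psi (fset_of q.1.1) (fset_of q.1.2) (fset_of q.2)).
Proof.
have m11 : measurable_fun setT (fun q : (seq T * seq T) * seq T => q.1.1).
  exact: measurableT_comp measurable_fst measurable_fst.
have m12 : measurable_fun setT (fun q : (seq T * seq T) * seq T => q.1.2).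
  exact: measurableT_comp measurable_snd measurable_fst.
apply: measurable_funM; last exact: measurable_Akernel.
apply: measurable_funM; first exact: measurableT_comp m1s m11.
apply: measurable_funM.
  exact: (measurable_comp_pair (measurable_prod_gprod (@measurable_id _ R setT)) m11 m12).
exact: (measurable_comp_pair (measurable_fsetU mG) m11 m12).
Qed.

Let mPsi' (f1 f2 f3 : (seq T * seq T) * seq T -> seq T) : measurable_fun setT f1 ->
  measurable_fun setT f2 -> measurable_fun setT f3 ->
  measurable_fun setT (fun q => Psi (fset_of (f1 q)) (fset_of (f2 q)) (fset_of (f3 q))).
Proof.
move=> m1 m2 m3.
exact: (measurable_comp_pair mPsi (measurable_fun_pair m1 m2) m3).
Qed.

Let PsiA omega xi : \int[nu]_r Psi omega xi (fset_of r) =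
  (#|` omega| == 1)%N%:R * G (omega `|` xi)%fset * Aop k omega xi.
Proof.
rewrite /Psi AopE// RintegralZl//; first by ring.
exact: Akernel_integrable kb.
Qed.

Let PsiB xi zeta : \int[nu]_w Psi (fset_of w) xi zeta = Bop G xi zeta * k (zeta `|` xi)%fset.
Proof.
rewrite BopE// -Rintegral_scaler.
  by apply: eq_Rintegral => w _; rewrite /Psi /Bkernel /Akernel; ring.
apply: measurable_funM => //.
rewrite -[xi]fset_of_enum -[zeta]fset_of_enum.
exact: (measurable_fun_pair2 (enum_fset xi, enum_fset zeta) (measurable_Bkernel mG)).
Qed.

(** The reason for the domain L_{2C}: n <= 2^n absorbs the number of singletons of a
    configuration. *)
Let npow n : n%:R * C ^+ n.-1 <= (2 * C) ^+ n.
Proof.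
case: n => [|n]; first by rewrite mul0r expr0.
rewrite exprMn ler_pM ?exprn_ge0//.
  by rewrite -natrX ler_nat ltnW// ltn_expl.
by rewrite ler_weXn2l.
Qed.

Let Gk_int : nu.-integrable setT
  (fun s => (#|` fset_of s|%:R * G (fset_of s) * k (fset_of s))%:E).
Proof.
have mG' := (measurable_fun_fset _).1 mG; have mk' := (measurable_fun_fset _).1 mk.
have mc := measurable_card_fset (R := R) mdiag.
have mgc : measurable_fun setT (fun s =>
    (`|G (fset_of s)| * (2 * C) ^+ #|` fset_of s|)%:E).
  apply/measurable_EFinP; apply: measurable_funM; last exact: measurable_pow_card_fset.
  by apply: measurableT_comp => //; exact: mG'.
have gc0 (s : seq T) : setT s -> (0 <= (`|G (fset_of s)| * (2 * C) ^+ #|` fset_of s|)%:E)%E.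
  by move=> _; rewrite lee_fin mulr_ge0// exprn_ge0// mulr_ge0.
have KGi : (\int[nu]_s (K%:E * (`|G (fset_of s)| * (2 * C) ^+ #|` fset_of s|)%:E) < +oo)%E.
  rewrite (ge0_integralZl nu measurableT mgc gc0); last by rewrite lee_fin.
  by apply: lte_mul_pinfty => //; rewrite lee_fin.
apply/integrableP; split.
  apply/measurable_EFinP; apply: measurable_funM; last exact: mk'.
  by apply: measurable_funM; [exact: mc|exact: mG'].
apply: le_lt_trans KGi; apply: ge0_le_integral => //.
- apply: measurableT_comp => //; apply/measurable_EFinP; apply: measurable_funM; last exact: mk'.
  by apply: measurable_funM; [exact: mc|exact: mG'].
- exact: emeasurable_funM.
- move=> s _; rewrite -EFinM lee_fin !normrM normr_nat.
  set n := #|` fset_of s|.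
  have n2 : n%:R * C ^+ n <= (2 * C) ^+ n.
    rewrite exprMn ler_wpM2r ?exprn_ge0// -natrX ler_nat ltnW// ltn_expl//.
  have := ler_wpM2l (mulr_ge0 (ler0n R n) (normr_ge0 (G (fset_of s)))) (kb.2 (fset_of s)).
  have := ler_wpM2l (mulr_ge0 K0 (normr_ge0 (G (fset_of s)))) n2.
  rewrite -/n; lra.
Qed.

Let mF3 : measurable_fun setT (fun q : (seq T * seq T) * seq T =>
  `|(Psi (fset_of q.1.1) (fset_of q.1.2) (fset_of q.2))%:E|%E).
Proof. by apply: measurableT_comp => //; exact/measurable_EFinP. Qed.

(** After [zeta] is integrated out by the bound on [Akernel], the Minlos lemma merges [omega] and
    [xi] into one configuration, over which [npow] reduces finiteness to [Gi]. *)
Let Psi_int :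
  (\int[nu]_w \int[nu]_s \int[nu]_r
     `|(Psi (fset_of w) (fset_of s) (fset_of r))%:E| < +oo)%E.
Proof.
pose E := expR (C * kappa).
have E0 : 0 <= E by exact: expR_ge0.
pose Hh omega xi := (#|` omega| == 1)%N%:R * (`|G (omega `|` xi)%fset| * (K * C ^+ #|` xi| * E)).
have Hh0 x y : 0 <= Hh x y by rewrite /Hh !mulr_ge0 ?exprn_ge0.
have mHh : measurable2 Hh.
  apply: measurable_funM; first exact: measurableT_comp m1s measurable_fst.
  apply: measurable_funM.
    apply: measurableT_comp (@normr_measurable R setT) _.
    exact: measurable_fsetU.
  by apply: measurable_funM => //; apply: measurable_funM => //;
     exact: (measurable2_snd (measurable_pow_card C)).
have inner omega xi : (\int[nu]_r `|(Psi omega xi (fset_of r))%:E| <= (Hh omega xi)%:E)%E.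
  apply: (integral_norm_dom (F := fun r => Psi omega xi (fset_of r)) (G := fun r =>
    (#|` omega| == 1)%N%:R * `|G (omega `|` xi)%fset| * `|Akernel k omega xi (fset_of r)|)).
  - rewrite -[omega]fset_of_enum -[xi]fset_of_enum.
    exact: (measurable_fun_pair2 (enum_fset omega, enum_fset xi) mPsi).
  - apply: measurable_funM => //; apply: measurableT_comp => //; exact: mA.
  - move=> r; rewrite /Psi !normrM normr_nat ler_wpM2r// ler_wpM2l//.
    rewrite ler_piMl// ger0_norm ?prodr_ge0// => [|y _]; last exact: gprod_ge0.
    by apply: prodr_ile1 => y; rewrite gprod_ge0 gprod_le1.
  under eq_integral do rewrite EFinM.
  rewrite ge0_integralZl ?lee_fin ?mulr_ge0//; last first.
    by apply/measurable_EFinP; apply: measurableT_comp => //; exact: mA.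
  apply: (@le_trans _ _ (((#|` omega| == 1)%N%:R * `|G (omega `|` xi)%fset|)%:E *
     (K * C ^+ #|` xi| * E ^+ #|` omega|)%:E)%E).
    apply: lee_wpmul2l; first by rewrite lee_fin mulr_ge0.
    apply: (integral_norm_dom (mA omega xi mk) (_ : measurable_fun setT (fun s =>
      K * C ^+ #|` xi| * \prod_(y <- fset_of s) (C * (1 - gprod y omega)))) _
      (Akernel_dom omega xi C1 kb)).
      exact: measurable_funM.
    by move=> s; exact: Akernel_le.
  rewrite -EFinM lee_fin /Hh.
  by case: eqP => [->|_]; [rewrite expr1 mulrA|rewrite !mul0r].
apply: (@le_lt_trans _ _ (\int[nu]_w \int[nu]_s (Hh (fset_of w) (fset_of s))%:E)%E).
  have mi : measurable_fun setT (fun p : seq T * seq T =>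
      \int[nu]_r `|(Psi (fset_of p.1) (fset_of p.2) (fset_of r))%:E|)%E.
    exact: (measurable_fun_fubini_tonelli_F _ mF3).
  apply: ge0_le_integral => //.
  - by move=> w _; apply: integral_ge0 => s _; exact: integral_ge0.
  - apply: (measurable_fun_fubini_tonelli_F _ mi) => p; exact: integral_ge0.
  - apply: (measurable_fun_fubini_tonelli_F (fun p : seq T * seq T =>
      (Hh (fset_of p.1) (fset_of p.2))%:E)); first exact/measurable_EFinP.
    by move=> p; rewrite lee_fin.
  - move=> w _; apply: ge0_le_integral => //.
    + by move=> s _; exact: integral_ge0.
    + exact: (measurable_fun_pair2 w mi).
    + by apply/measurable_EFinP; exact: (measurable_fun_pair2 w mHh).
rewrite -(seq_measure_splitsum mdiag diffuse mHh Hh0).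
have Gi' : (\int[nu]_s ((K * E)%:E *
    (`|G (fset_of s)| * (2 * C) ^+ #|` fset_of s|)%:E) < +oo)%E.
  rewrite ge0_integralZl ?lee_fin ?mulr_ge0//.
  - by rewrite lte_mul_pinfty ?lee_fin ?mulr_ge0.
  - apply/measurable_EFinP; apply: measurable_funM.
      by apply: measurableT_comp => //; exact: ((measurable_fun_fset _).1 mG).
    exact: measurable_pow_card_fset.
  - by move=> s _; rewrite lee_fin mulr_ge0// exprn_ge0// mulr_ge0.
apply: le_lt_trans Gi'; apply: ge0_le_integral => //.
- by move=> s _; rewrite lee_fin /splitsum sumr_ge0.
- by apply/measurable_EFinP; exact: ((measurable_fun_fset _).1 (measurable_splitsum_fset mHh)).
- apply: emeasurable_funM => //; apply/measurable_EFinP; apply: measurable_funM.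
    by apply: measurableT_comp => //; exact: ((measurable_fun_fset _).1 mG).
  exact: measurable_pow_card_fset.
- move=> s _; rewrite -EFinM lee_fin.
  (* Both parts together give back the whole configuration, so |G| leaves the sum and only the count
     of singletons remains. *)
  rewrite (@eq_splitsum _ _ _ (fun omega zeta => (K * E * `|G (fset_of s)|) *
     ((#|` omega| == 1)%N%:R * C ^+ #|` zeta|))); last first.
    by move=> omega oe; rewrite /Hh fsetUC fsetDUK//; ring.
  rewrite splitsumZ (splitsum_card1 (fun n => C ^+ n)) [leRHS]mulrA ler_wpM2l//.
  by rewrite !mulr_ge0.
Qed.

Let Psi_swap_in (s : seq T) :
  (\int[nu]_r \int[nu]_w `|(Psi (fset_of w) (fset_of s) (fset_of r))%:E| =
   \int[nu]_w \int[nu]_r `|(Psi (fset_of w) (fset_of s) (fset_of r))%:E|)%E.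
Proof.
apply: (fubini_tonelli (fun p : seq T * seq T =>
  `|(Psi (fset_of p.2) (fset_of s) (fset_of p.1))%:E|%E)) => //.
exact: (measurable_comp_pair mF3 (measurable_fun_pair measurable_snd (measurable_cst s))
  measurable_fst).
Qed.

Let mi12 : measurable_fun setT (fun p : seq T * seq T =>
  \int[nu]_r `|(Psi (fset_of p.1) (fset_of p.2) (fset_of r))%:E|)%E.
Proof. exact: (measurable_fun_fubini_tonelli_F _ mF3). Qed.

Let Psi_int' :
  (\int[nu]_s \int[nu]_w \int[nu]_r
     `|(Psi (fset_of w) (fset_of s) (fset_of r))%:E| < +oo)%E.
Proof.
rewrite (fubini_tonelli (fun p : seq T * seq T =>
  \int[nu]_r `|(Psi (fset_of p.2) (fset_of p.1) (fset_of r))%:E|)%E) ?Psi_int//.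
  exact: (measurable_comp_pair mi12 measurable_snd measurable_fst).
by move=> p; exact: integral_ge0.
Qed.

(** [H1] and [H2] are [Psi] with [omega], respectively [zeta], integrated out. Up to the factor z,
    their sums over splittings are the nondiagonal parts of (Lhat G) k and of G (L k). *)
Let H1 xi zeta := \int[nu]_w Psi (fset_of w) xi zeta.
Let H2 omega xi := \int[nu]_r Psi omega xi (fset_of r).

Let S1E s : splitsum (Bop G) s * k s = splitsum H1 s.
Proof.
rewrite /splitsum mulr_suml big_seq [RHS]big_seq; apply: eq_bigr => omega.
by rewrite fpowersetE => oe; rewrite /H1 PsiB fsetDUK.
Qed.

Let S2E s : G s * splitsum (fun omega zeta => (#|` omega| == 1)%N%:R * Aop k omega zeta) s =
  splitsum H2 s.
Proof.
rewrite /splitsum mulr_sumr big_seq [RHS]big_seq; apply: eq_bigr => omega.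
by rewrite fpowersetE => oe; rewrite /H2 PsiA fsetUC fsetDUK//; ring.
Qed.

Let mH1 : measurable2 H1.
Proof.
apply: (measurable_Rintegral_param nu (F := fun q : (seq T * seq T) * seq T =>
  Psi (fset_of q.2) (fset_of q.1.1) (fset_of q.1.2))).
apply: mPsi' => //.
  exact: measurableT_comp measurable_fst measurable_fst.
exact: measurableT_comp measurable_snd measurable_fst.
Qed.

Let mH2 : measurable2 H2.
Proof. exact: (measurable_Rintegral_param nu mPsi). Qed.

Let norm_le_int (h : seq T -> R) : measurable_fun setT h ->
  (`|(\int[nu]_w h w)%:E| <= \int[nu]_w `|(h w)%:E|)%E.
Proof. exact: le_EFin_norm_Rintegral. Qed.

Let mPsi1 xi zeta : measurable_fun setT (fun w => Psi (fset_of w) xi zeta).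
Proof.
rewrite -[xi]fset_of_enum -[zeta]fset_of_enum.
exact: (measurable_comp_pair mPsi (pair2_measurable (enum_fset xi : seq T))
  (measurable_cst (enum_fset zeta))).
Qed.

Let mPsi3 omega xi : measurable_fun setT (fun r => Psi omega xi (fset_of r)).
Proof.
rewrite -[omega]fset_of_enum -[xi]fset_of_enum.
exact: (measurable_fun_pair2 (enum_fset omega, enum_fset xi) mPsi).
Qed.

Let mabs1 : measurable_fun setT (fun p : seq T * seq T =>
  \int[nu]_w `|(Psi (fset_of w) (fset_of p.1) (fset_of p.2))%:E|)%E.
Proof.
apply: (measurable_fun_fubini_tonelli_F (fun q : (seq T * seq T) * seq T =>
  `|(Psi (fset_of q.2) (fset_of q.1.1) (fset_of q.1.2))%:E|%E)) => //.
apply: measurableT_comp => //; apply/measurable_EFinP; apply: mPsi' => //.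
  exact: measurableT_comp measurable_fst measurable_fst.
exact: measurableT_comp measurable_snd measurable_fst.
Qed.

Let mabs2 (H : {fset T} -> {fset T} -> R) : measurable2 H ->
  measurable_fun setT (fun p : seq T * seq T => `|(H (fset_of p.1) (fset_of p.2))%:E|%E).
Proof. by move=> mH; apply: measurableT_comp => //; exact/measurable_EFinP. Qed.

Let dom2 (H : {fset T} -> {fset T} -> R) (F : seq T * seq T -> \bar R) :
  measurable2 H -> measurable_fun setT F -> (forall p, 0 <= F p)%E ->
  (forall p, `|(H (fset_of p.1) (fset_of p.2))%:E| <= F p)%E ->
  (\int[nu]_s \int[nu]_t F (s, t) < +oo)%E ->
  (\int[nu]_s \int[nu]_t `|(H (fset_of s) (fset_of t))%:E| < +oo)%E.
Proof.
move=> mH mF F0 HF; apply: le_lt_trans; apply: ge0_le_integral => //.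
- by move=> s _; exact: integral_ge0.
- exact: (measurable_fun_fubini_tonelli_F _ (mabs2 mH)).
- exact: (measurable_fun_fubini_tonelli_F _ mF).
- move=> s _; apply: ge0_le_integral => //.
  + exact: (measurable_fun_pair2 s (mabs2 mH)).
  + exact: (measurable_fun_pair2 s mF).
  + by move=> t _; exact: (HF (s, t)).
Qed.

Let H1i : (\int[nu]_s \int[nu]_t `|(H1 (fset_of s) (fset_of t))%:E| < +oo)%E.
Proof.
apply: (dom2 mH1 mabs1) => [p|p|]; first exact: integral_ge0.
  exact: (norm_le_int (mPsi1 _ _)).
rewrite /=; under eq_integral do rewrite Psi_swap_in.
exact: Psi_int'.
Qed.

Let H2i : (\int[nu]_s \int[nu]_t `|(H2 (fset_of s) (fset_of t))%:E| < +oo)%E.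
Proof.
apply: (dom2 mH2 mi12) => [p|p|]; first exact: integral_ge0.
  exact: (norm_le_int (mPsi3 _ _)).
exact: Psi_int.
Qed.

(** The inner exchange of integrals is justified only where the double integral of |Psi| is finite,
    which is the case for almost every middle variable. *)
Let H12 : \int[nu]_s \int[nu]_t H1 (fset_of s) (fset_of t) =
  \int[nu]_s \int[nu]_t H2 (fset_of s) (fset_of t).
Proof.
transitivity (\int[nu]_s \int[nu]_w H2 (fset_of w) (fset_of s)); last first.
  apply/esym; exact: (@Rintegral_swap _ _ _ _ _ nu nu
    (fun p => H2 (fset_of p.1) (fset_of p.2)) mH2 H2i).
apply: ae_eq_Rintegral.
- exact: (measurable_Rintegral_param nu mH1).
- apply: (measurable_Rintegral_param nu
    (F := fun p : seq T * seq T => H2 (fset_of p.2) (fset_of p.1))).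
  exact: (measurable_comp_pair mH2 measurable_snd measurable_fst).
have ms : measurable_fun setT (fun s : seq T => \int[nu]_w \int[nu]_r
    `|(Psi (fset_of w) (fset_of s) (fset_of r))%:E|)%E.
  apply: (measurable_fun_fubini_tonelli_F (fun p : seq T * seq T =>
    \int[nu]_r `|(Psi (fset_of p.2) (fset_of p.1) (fset_of r))%:E|)%E).
    exact: (measurable_comp_pair mi12 measurable_snd measurable_fst).
  by move=> p; exact: integral_ge0.
have si : nu.-integrable setT (fun s : seq T => \int[nu]_w \int[nu]_r
    `|(Psi (fset_of w) (fset_of s) (fset_of r))%:E|)%E.
  apply/integrableP; split => //.
  rewrite (eq_integral (fun s : seq T => \int[nu]_w \int[nu]_r
    `|(Psi (fset_of w) (fset_of s) (fset_of r))%:E|)%E); first exact: Psi_int'.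
  by move=> s _; rewrite gee0_abs// integral_ge0// => w _; exact: integral_ge0.
have := integrable_ae measurableT si; apply: filterS => s /(_ I) sfin.
apply: (@Rintegral_swap _ _ _ _ _ nu nu
  (fun p => Psi (fset_of p.2) (fset_of s) (fset_of p.1))).
  exact: (measurable_comp_pair mPsi (measurable_fun_pair measurable_snd (measurable_cst s))
    measurable_fst).
by rewrite /= Psi_swap_in ltey_eq sfin.
Qed.

Lemma integrable_Lh z :
  nu.-integrable setT (fun s => (Lh z G (fset_of s) * k (fset_of s))%:E).
Proof.
have [i1 _] := integrable_Rsplitsum mH1 H1i; clear H12 H1i H2i.
have := integrableB measurableT (integrableZl measurableT z i1) Gk_int.
apply: eq_integrable => // s _ /=.
by rewrite -EFinM -EFinB -S1E /Lh; congr EFin; ring.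
Qed.

(** The diagonal terms agree pointwise. For the others, the Minlos lemma turns both sides into
    triple integrals of [Psi] in different orders. *)
Lemma Lh_duality z : \int[lam]_eta (Lh z G eta * k eta) = \int[lam]_eta (G eta * Lst z k eta).
Proof.
have [i1 e1] := integrable_Rsplitsum mH1 H1i.
have [i2 e2] := integrable_Rsplitsum mH2 H2i.
have {e1 e2} e12 := etrans e1 (etrans H12 (esym e2)); clear H12 H1i H2i.
rewrite !Rintegral_lebesgue_poisson; first last.
- by apply: measurable_funM => //; exact: measurable_Lh.
- by apply: measurable_funM => //; exact: measurable_Lst.
transitivity (\int[nu]_s (z * splitsum H1 (fset_of s) -
    #|` fset_of s|%:R * G (fset_of s) * k (fset_of s))).
  by apply: eq_Rintegral => s _; rewrite -S1E /Lh; ring.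
transitivity (\int[nu]_s (z * splitsum H2 (fset_of s) -
    #|` fset_of s|%:R * G (fset_of s) * k (fset_of s))); last first.
  by apply: eq_Rintegral => s _; rewrite -S2E /Lst; ring.
have iz (H : {fset T} -> {fset T} -> R) : nu.-integrable setT
    (fun s => (splitsum H (fset_of s))%:E) ->
    nu.-integrable setT (fun s => (z * splitsum H (fset_of s))%:E).
  by move=> /(integrableZl measurableT z); apply: eq_integrable => // s _; rewrite EFinM.
rewrite (RintegralB measurableT (iz _ i1) Gk_int).
rewrite (RintegralB measurableT (iz _ i2) Gk_int).
by rewrite (RintegralZl z measurableT i1) (RintegralZl z measurableT i2) e12.
Qed.

End duality.

End kernel.

(** * Taylor estimates for contraction semigroups *)

Section convergence.
Context {R : realType}.

Lemma cvge0_lt (U : Type) (F : set_system U) (f : U -> \bar R) (e : R) :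
  Filter F -> f @ F --> 0%E -> 0 < e -> \forall x \near F, (f x < e%:E)%E.
Proof.
move=> FF f0 e0; have : nbhs (0%E : \bar R) [set y | (y < e%:E)%E].
  by apply: open_nbhs_nbhs; split; [exact: open_ereal_lt_ereal|rewrite /= lte_fin].
by move=> /f0.
Qed.

Lemma near_at_right0 (P : R -> Prop) : (\forall t \near 0^'+, P t) ->
  exists2 e : R, 0 < e & forall t, 0 < t < e -> P t.
Proof.
move=> [e /= e0 eP]; exists e => // t /andP[t0 te]; apply: eP => //=.
by rewrite sub0r normrN gtr0_norm.
Qed.

(* A mean value inequality in which the increments of [f] are only controlled on
   short forward steps. *)
Lemma telescope_bound (f : R -> R) (delta c : R) : 0 <= delta ->
  (forall e, 0 < e -> exists2 s0, 0 < s0 & forall s t, 0 < s < s0 -> 0 <= t ->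
     t + s <= delta -> `|f (t + s) - f t| <= s * (c + e)) ->
  `|f delta - f 0| <= delta * c.
Proof.
rewrite le_eqVlt => /predU1P[<- _|d0 H]; first by rewrite subrr normr0 mul0r.
apply/ler_addgt0Pr => e e0.
have ed : 0 < e / delta by rewrite divr_gt0.
have [s0 s00 Hs] := H _ ed.
pose m := (Num.truncn (delta / s0)).+1.
have m0 : 0 < m%:R :> R by rewrite ltr0n.
pose s := delta / m%:R.
have ss0 : 0 < s < s0.
  rewrite divr_gt0//= ltr_pdivrMr// mulrC -ltr_pdivrMr//.
  exact: truncnS_gt.
have IH j : (j <= m)%N -> `|f (j%:R * s) - f 0| <= j%:R * (s * (c + e / delta)).
  elim: j => [|j IH] jm; first by rewrite !mul0r subrr normr0.
  have js : 0 <= j%:R * s by rewrite mulr_ge0// ltW; case/andP: ss0.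
  have jd : j%:R * s + s <= delta.
    rewrite -[X in _ + X]mul1r -mulrDl natr1 /s mulrA ler_pdivrMr// mulrC.
    by rewrite ler_wpM2l ?ler_nat// ltW.
  have := Hs s (j%:R * s) ss0 js jd; have := IH (ltnW jm).
  rewrite -natr1 !mulrDl !mul1r => h1 h2.
  rewrite (_ : f _ - _ = (f (j%:R * s + s) - f (j%:R * s)) + (f (j%:R * s) - f 0));
    last by ring.
  by apply: le_trans (ler_normD _ _) _; lra.
have := IH m (leqnn m).
have -> : m%:R * s = delta by rewrite /s mulrC divfK// gt_eqF.
rewrite mulrA (_ : m%:R * s = delta); last by rewrite /s mulrC divfK// gt_eqF.
by rewrite mulrDr [delta * (e / delta)]mulrC divfK// gt_eqF.
Qed.

End convergence.

Section semigroup.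
Context {R : realType} {E : lmodType R}.
Variables (D : set E) (N : E -> \bar R) (n : E -> R).
Hypothesis D0 : D 0.
Hypothesis D_lin : forall a G H, D G -> D H -> D (a *: G + H).
Hypothesis Nn : forall G, D G -> N G = (n G)%:E.
Hypothesis nD : forall G H, D G -> D H -> n (G + H) <= n G + n H.
Hypothesis nZ : forall a G, D G -> n (a *: G) = `|a| * n G.

Let DZ a G : D G -> D (a *: G).
Proof. by move=> dG; rewrite -[_ *: _]addr0; exact: D_lin. Qed.

Let DB G H : D G -> D H -> D (G - H).
Proof. by move=> dG dH; rewrite -scaleN1r addrC; exact: D_lin. Qed.

Let nN G : D G -> n (- G) = n G.
Proof. by move=> dG; rewrite -scaleN1r nZ// normrN1 mul1r. Qed.

Let n0 : n 0 = 0.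
Proof. by rewrite -(scale0r 0) nZ// normr0 mul0r. Qed.

Let n_ge0 G : D G -> 0 <= n G.
Proof.
move=> dG; have := nD dG (DZ (-1) dG).
by rewrite scaleN1r subrr n0 nN//; lra.
Qed.

Definition bounded_functional (l : E -> R) (M : R) :=
  [/\ 0 <= M, forall a G H, D G -> D H -> l (a *: G + H) = a * l G + l H &
      forall G, D G -> `|l G| <= M * n G].

Let lB l M G H : bounded_functional l M -> D G -> D H -> l (G - H) = l G - l H.
Proof.
by move=> [_ lin _] dG dH; rewrite -scaleN1r addrC lin// mulN1r addrC.
Qed.

(** Semigroup identities hold only up to elements of norm 0, so this congruence takes the place of
    rewriting. *)
Let eqv G H := [/\ D G, D H & n (G - H) = 0].

Let eqv_refl G : D G -> eqv G G.
Proof. by move=> dG; split => //; rewrite subrr. Qed.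

Let eqv_sym G H : eqv G H -> eqv H G.
Proof. by move=> [dG dH e]; split => //; rewrite -opprB nN//; exact: DB. Qed.

Let eqv_trans G H K : eqv G H -> eqv H K -> eqv G K.
Proof.
move=> [dG dH e1] [_ dK e2]; split => //; apply/eqP; rewrite eq_le n_ge0 ?andbT; last exact: DB.
rewrite (_ : G - K = (G - H) + (H - K)); last by rewrite addrA subrK.
by apply: le_trans (nD (DB dG dH) (DB dH dK)) _; rewrite e1 e2 addr0.
Qed.

Let eqv_lin a G H G' H' : eqv G G' -> eqv H H' -> eqv (a *: G + H) (a *: G' + H').
Proof.
move=> [dG dG' e1] [dH dH' e2]; split; [exact: D_lin|exact: D_lin|].
apply/eqP; rewrite eq_le n_ge0 ?andbT; last by apply: DB; exact: D_lin.
rewrite (_ : _ - _ = a *: (G - G') + (H - H')); last first.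
  by rewrite scalerBr opprD addrACA.
apply: le_trans (nD (DZ a (DB dG dG')) (DB dH dH')) _.
by rewrite nZ ?e1 ?e2 ?mulr0 ?addr0//; exact: DB.
Qed.

Let eqv_n G H : eqv G H -> n G <= n H.
Proof.
move=> [dG dH e]; rewrite -[G](subrK H); apply: le_trans (nD (DB dG dH) dH) _.
by rewrite e add0r.
Qed.

Let eqv_l l M G H : bounded_functional l M -> eqv G H -> l G = l H.
Proof.
move=> lb [dG dH e]; apply/eqP; rewrite -subr_eq0 -(lB lb)// -normr_le0.
by case: lb => _ _ /(_ _ (DB dG dH)); rewrite e mulr0.
Qed.

Variable T : R -> E -> E.
Hypothesis T_contr : contraction_semigroup D N T.

Let DT t G : 0 <= t -> D G -> D (T t G).
Proof. by case: T_contr => + _ _ _ _ t0 dG; exact. Qed.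

Let Tn t G : 0 <= t -> D G -> n (T t G) <= n G.
Proof.
case: T_contr => _ _ + _ _ t0 dG => /(_ t t0 G dG).
by rewrite !Nn ?lee_fin//; exact: DT.
Qed.

Let TS s t G : 0 <= s -> 0 <= t -> D G -> eqv (T (s + t) G) (T s (T t G)).
Proof.
move=> s0 t0 dG; case: T_contr => _ _ _ [_ +] _ => /(_ s t s0 t0 G dG).
have st0 : 0 <= s + t by rewrite addr_ge0.
have d1 := DT st0 dG; have d2 := DT s0 (DT t0 dG).
by rewrite Nn; [move=> [e]; split|exact: DB].
Qed.

Let T0 G : D G -> eqv (T 0 G) G.
Proof.
move=> dG; case: T_contr => _ _ _ [+ _] _ => /(_ G dG).
have d1 := DT (lexx 0) dG.
by rewrite Nn; [move=> [e]; split|exact: DB].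
Qed.

Let Tlin t a G H : 0 <= t -> D G -> D H -> eqv (T t (a *: G + H)) (a *: T t G + T t H).
Proof.
move=> t0 dG dH; case: T_contr => _ + _ _ _ => /(_ t t0 a G H dG dH).
have d1 := DT t0 (D_lin a dG dH); have d2 := D_lin a (DT t0 dG) (DT t0 dH).
by rewrite Nn; [move=> [e]; split|exact: DB].
Qed.

Let Tzero t : 0 <= t -> eqv (T t 0) 0.
Proof.
move=> t0; split => //; first exact: DT.
apply/eqP; rewrite subr0 eq_le n_ge0 ?andbT; last exact: DT.
by have := Tn t0 D0; rewrite n0.
Qed.

Variables (dom : set E) (A : E -> E).
Hypothesis domD : dom `<=` D.
Hypothesis A_D : forall G, dom G -> D (A G).
Hypothesis T_gen : forall G H, generator D N T G H <-> op_closure D N dom A G H.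

(** The difference quotient minus [A G], spelled with a trailing 0 as nested combinations
    [a *: X + Y], the only form to which the linearity of [T] applies. *)
Let quot (s : R) G : E := (-1) *: A G + (s^-1 *: ((-1) *: G + T s G) + 0).

Let Dquot s G : 0 <= s -> dom G -> D (quot s G).
Proof.
move=> s0 dG; apply: D_lin; first exact: A_D.
by apply: D_lin => //; apply: D_lin; [exact: domD|exact/DT/domD].
Qed.

Let dom_gen G : dom G -> generator D N T G (A G).
Proof.
move=> dG; apply/T_gen; split; [exact: domD|exact: A_D|].
exists (fun=> G); split => //.
  rewrite (_ : (fun _ => _) = cst 0%E); first exact: cvg_cst.
  by apply/funext => i /=; rewrite subrr Nn// n0.
rewrite (_ : (fun _ => _) = cst 0%E); first exact: cvg_cst.
by apply/funext => i /=; rewrite subrr Nn// n0.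
Qed.

Let quot_small G e : dom G -> 0 < e ->
  exists2 s0, 0 < s0 & forall s, 0 < s < s0 -> n (quot s G) <= e.
Proof.
move=> dG e0; have [_ _ /cvge0_lt/(_ e0)/near_at_right0[s0 s00 H]] := dom_gen dG.
exists s0 => // s ss; have /H := ss.
rewrite (_ : s^-1 *: (T s G - G) - A G = quot s G); last first.
  by rewrite /quot addr0 !scaleN1r addrC [- G + _]addrC.
by rewrite Nn ?lte_fin => [/ltW//|]; apply: Dquot => //; case/andP: ss => /ltW.
Qed.

Let quot_shift s t G : 0 < s -> 0 <= t -> dom G ->
  eqv ((-1) *: T t (A G) + (s^-1 *: ((-1) *: T t G + T s (T t G)) + 0)) (T t (quot s G)).
Proof.
move=> s0 t0 dG; have dG' := domD dG; have s0' := ltW s0.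
have dsG := DT s0' dG'.
apply: eqv_sym; apply: eqv_trans (Tlin _ t0 (A_D dG) _) _.
  by apply: D_lin => //; apply: D_lin.
apply: eqv_lin; first by apply: eqv_refl; exact/DT/A_D.
apply: eqv_trans (Tlin _ t0 (D_lin _ dG' dsG) D0) _.
apply: eqv_lin; last exact: Tzero.
apply: eqv_trans (Tlin _ t0 dG' dsG) _.
apply: eqv_lin; first by apply: eqv_refl; exact: DT.
apply: eqv_trans (eqv_sym (TS t0 s0' dG')) _.
by rewrite addrC; exact: TS.
Qed.

(** The difference quotient at [T t G] is the image under [T t] of the one at [G], so contractivity
    carries the limit over. [T t G] need not lie in [dom], hence the statement about the
    generator. *)
Let gen_shift t G : 0 <= t -> dom G -> generator D N T (T t G) (T t (A G)).
Proof.
move=> t0 dG; have [_ _ cv] := dom_gen dG.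
split; [exact/DT/domD|exact/DT/A_D|].
have sq : forall s, 0 < s -> (0 <= N (s^-1 *: (T s (T t G) - T t G) - T t (A G)) <=
    N (s^-1 *: (T s G - G) - A G))%E.
  move=> s s0; have := quot_shift s0 t0 dG; set Y := (X in eqv X _) => YX.
  rewrite (_ : s^-1 *: (T s (T t G) - T t G) - T t (A G) = Y); last first.
    by rewrite /Y addr0 !scaleN1r addrC [- T t G + _]addrC.
  rewrite (_ : s^-1 *: (T s G - G) - A G = quot s G); last first.
    by rewrite /quot addr0 !scaleN1r addrC [- G + _]addrC.
  have dq := Dquot (ltW s0) dG; have [dY _ _] := YX.
  rewrite !Nn// !lee_fin n_ge0//=.
  by apply: le_trans (eqv_n YX) _; exact: Tn.
apply: (squeeze_cvge (f := cst 0%E) _ (cvg_cst _) cv).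
by near=> s; apply: sq; near: s; exact: nbhs_right_gt.
Unshelve. all: by end_near. Qed.

Section functional.
Variables (l l' : E -> R) (M M' : R).
Hypotheses (lb : bounded_functional l M) (lb' : bounded_functional l' M').
Hypothesis ll' : forall G, dom G -> l (A G) = l' G.

(** The identity [ll'] extends from [dom] to the closure of [A] by continuity of both functionals;
    it is applied at the elements [T t G]. *)
Let pair_gen G H : generator D N T G H -> l H = l' G.
Proof.
move=> /T_gen[dG dH [G_ [dG_ cG cH]]]; apply/eqP; rewrite -subr_eq0 -normr_le0.
have [M0 _ lM] := lb; have [M0' _ lM'] := lb'.
apply/ler_addgt0Pr => e e0; rewrite add0r.
have S0 : 0 < M + M' + 1 by lra.
have e1 : 0 < e / (M + M' + 1) by rewrite divr_gt0.
have [i [iG iH]] : exists i, (N (G_ i - G) < (e / (M + M' + 1))%:E)%E /\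
    (N (A (G_ i) - H) < (e / (M + M' + 1))%:E)%E.
  apply: (@filter_ex _ \oo); near=> i; split; near: i; exact: cvge0_lt.
have dGi := domD (dG_ i); have dAi := A_D (dG_ i).
rewrite Nn ?lte_fin in iG; last exact: DB.
rewrite Nn ?lte_fin in iH; last exact: DB.
rewrite (_ : l H - l' G = (l' (G_ i - G)) - l (A (G_ i) - H)); last first.
  by rewrite (lB lb')// (lB lb)// ll'//; ring.
apply: le_trans (ler_normB _ _) _.
have h1 := le_trans (lM' _ (DB dGi dG)) (ler_wpM2l M0' (ltW iG)).
have h2 := le_trans (lM _ (DB dAi dH)) (ler_wpM2l M0 (ltW iH)).
have -> : e = (M + M' + 1) * (e / (M + M' + 1)).
  by rewrite mulrC divfK// gt_eqF.
lra.
Unshelve. all: by end_near. Qed.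

(** The error is [l] at the image under [T t] of [quot s G]; contractivity makes its bound uniform
    in [t], as [telescope_bound] requires. *)
Lemma semigroup_increment s t G : 0 < s -> 0 <= t -> dom G ->
  `|l (T (t + s) G) - l (T t G) - s * l' (T t G)| <= s * (M * n (quot s G)).
Proof.
move=> s0 t0 dG; have dG' := domD dG; have s0' := ltW s0.
have [M0 lin lM] := lb.
have YX := quot_shift s0 t0 dG; set Y := (X in eqv X _) in YX.
have lY : l Y = s^-1 * (l (T (t + s) G) - l (T t G)) - l' (T t G).
  rewrite /Y -(pair_gen (gen_shift t0 dG)) lin; last first.
  - by apply: D_lin => //; apply: D_lin; [exact: DT|exact/DT/DT].
  - exact/DT/A_D.
  rewrite addr0 -[s^-1 *: _]addr0 lin//; last by apply: D_lin; [exact: DT|exact/DT/DT].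
  rewrite lin; [|exact: DT|exact/DT/DT].
  have l0 : l 0 = 0.
    by have := lin (-1) 0 0 D0 D0; rewrite scaler0 addr0; lra.
  by rewrite l0 addr0 addrC [t + s]addrC (eqv_l lb (TS s0' t0 dG')); ring.
have lYn : `|l Y| <= M * n (quot s G).
  have [dY dX _] := YX; apply: le_trans (lM _ dY) _; apply: ler_wpM2l => //.
  by apply: le_trans (eqv_n YX) _; apply: Tn => //; exact: Dquot.
have -> : l (T (t + s) G) - l (T t G) - s * l' (T t G) = s * l Y.
  by rewrite lY mulrBr mulrA divff ?mul1r// gt_eqF.
by rewrite normrM gtr0_norm// ler_wpM2l.
Qed.

Lemma semigroup_order1 G t : dom G -> 0 <= t -> `|l (T t G) - l G| <= t * (M' * n G).
Proof.
move=> dG t0; rewrite -(eqv_l lb (T0 (domD dG))).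
apply: (telescope_bound (f := fun t => l (T t G))) => // e e0.
have [M0 _ _] := lb; have [M0' _ lM'] := lb'.
have e1 : 0 < e / (M + 1) by rewrite divr_gt0// ltr_wpDl.
have [s0 s00 H] := quot_small dG e1; exists s0 => // s r ss r0 _.
have /andP[sp _] := ss.
have h1 := semigroup_increment sp r0 dG.
have h2 : M * n (quot s G) <= e.
  apply: le_trans (ler_wpM2l M0 (H _ ss)) _; rewrite mulrA ler_pdivrMr ?ltr_wpDl//.
  by nra.
have h3 : `|l' (T r G)| <= M' * n G.
  apply: le_trans (lM' _ (DT r0 (domD dG))) _; apply: ler_wpM2l => //.
  by apply: Tn => //; exact: domD.
have -> : l (T (r + s) G) - l (T r G) =
  (l (T (r + s) G) - l (T r G) - s * l' (T r G)) + s * l' (T r G) by ring.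
apply: le_trans (ler_normD _ _) _; rewrite normrM (gtr0_norm sp) mulrDr.
have := ler_wpM2l (ltW sp) h2; have := ler_wpM2l (ltW sp) h3; lra.
Qed.

End functional.

(** With the linear term subtracted, an increment from r to r + s is s (l' (T r G) - l' G) up to a
    small error, and [semigroup_order1] for l' bounds the difference by r M'' n(G). Estimating r by
    t gives the constant 1 in place of the 1/2 of Taylor's formula. *)
Lemma semigroup_order2 l l' l'' M M' M'' G t :
  bounded_functional l M -> bounded_functional l' M' -> bounded_functional l'' M'' ->
  (forall G, dom G -> l (A G) = l' G) -> (forall G, dom G -> l' (A G) = l'' G) ->
  dom G -> 0 <= t ->
  `|l (T t G) - l G - t * l' G| <= t ^+ 2 * (M'' * n G).
Proof.
move=> lb lb' lb'' ll' ll'' dG t0.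
have [M0 _ _] := lb; have [M0' _ lM'] := lb'; have [M0'' _ lM''] := lb''.
have G0 : 0 <= n G by apply: n_ge0; exact: domD.
have := @telescope_bound R (fun s => l (T s G) - s * l' G) t (t * (M'' * n G)) t0.
rewrite mul0r subr0 (eqv_l lb (T0 (domD dG))).
rewrite (_ : _ - _ - l G = l (T t G) - l G - t * l' G); last by ring.
move=> tb; rewrite expr2 -mulrA; apply: tb => e e0.
have e1 : 0 < e / (M + 1) by rewrite divr_gt0// ltr_wpDl.
have [s0 s00 H] := quot_small dG e1; exists s0 => // s r ss r0 rst.
have /andP[sp _] := ss.
have h1 := semigroup_increment lb lb' ll' sp r0 dG.
have h2 : M * n (quot s G) <= e.
  apply: le_trans (ler_wpM2l M0 (H _ ss)) _; rewrite mulrA ler_pdivrMr ?ltr_wpDl//.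
  by nra.
have h3 : `|l' (T r G) - l' G| <= t * (M'' * n G).
  apply: le_trans (semigroup_order1 lb' lb'' ll'' dG r0) _.
  by rewrite ler_wpM2r ?mulr_ge0//; lra.
rewrite (_ : _ - _ - _ = (l (T (r + s) G) - l (T r G) - s * l' (T r G)) +
  s * (l' (T r G) - l' G)); last by ring.
apply: le_trans (ler_normD _ _) _; rewrite normrM (gtr0_norm sp) mulrDr.
have := ler_wpM2l (ltW sp) h2; have := ler_wpM2l (ltW sp) h3; lra.
Qed.

End semigroup.

(** * The Glauber kernel *)

Section lebesgue_tuple.
Context {R : realType}.

Lemma measurable_tuple_fun d (T : measurableType d) n (f : T -> 'R[R]_n) :
  (forall i, measurable_fun setT (fun x => tnth (f x) i)) -> measurable_fun setT f.
Proof. by move=> mf; apply/measurable_fun_tnthP => i; exact: mf. Qed.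

Lemma measurable_tuple_diag n : measurable [set p : 'R[R]_n * 'R[R]_n | p.1 = p.2].
Proof.
rewrite (_ : [set _ | _] = \bigcap_(i in [set: 'I_n])
    ((fun p : 'R[R]_n * 'R[R]_n => (tnth p.1 i : R) - tnth p.2 i) @^-1` [set 0])).
  apply: fin_bigcap_measurable => // i _; rewrite -[_ @^-1` _]setTI.
  have mi : measurable_fun setT (fun p : 'R[R]_n * 'R[R]_n => (tnth p.1 i : R) - tnth p.2 i).
    by apply: measurable_funB; exact: measurableT_comp (measurable_tnth i) _.
  exact: (mi measurableT [set 0] (measurable_set1 0)).
apply/seteqP; split => [[x y] /= -> i _ /=|[x y] /= H]; first by rewrite /preimage/= subrr.
by apply: eq_from_tnth => i; apply/eqP; rewrite -subr_eq0; apply/eqP; exact: (H i).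
Qed.

(** Reflection moves the closed end of a half-open interval to the other side but keeps its length,
    and lengths of intervals determine Lebesgue measure. *)
Lemma lebesgue_measure_reflect (a : R) (f : measurableTypeR R -> \bar R) :
  measurable_fun setT f -> (forall x, 0 <= f x)%E ->
  (\int[lebesgue_measure]_x f (a - (x : R))%R = \int[lebesgue_measure]_x f x)%E.
Proof.
move=> mf f0.
have mr : measurable_fun setT (fun x : measurableTypeR R => (a - (x : R)) : measurableTypeR R).
  by apply: measurable_funB => //; exact: measurable_cst.
rewrite [RHS](eq_measure_integral (image_measure lebesgue_measure mr)).
  by rewrite ge0_integral_pushforward.
move=> A mA _; apply: lebesgue_measure_unique => //= _ [[x y]] _ <-.
rewrite /image_measure/= /pushforward.
rewrite (_ : _ @^-1` _ = `[a - y, a - x[%classic); last first.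
  by apply/seteqP; split => u /=; rewrite !in_itv /= /preimage/= ?in_itv/=;
    move=> /andP[? ?]; apply/andP; split; lra.
rewrite !lebesgue_measure_itv/= !lte_fin.
by rewrite (_ : (a - y < a - x) = (x < y)) ?ltrD2l ?ltrN2//; case: ifP => // _; congr EFin; ring.
Qed.

Lemma mu_powS_integral_tcons n (F : 'R[R]_n.+1 -> \bar R) : (forall x, 0 <= F x)%E ->
  measurable_fun setT F ->
  (\int[@leb R n.+1]_x F x = \int[lebesgue_measure]_a \int[@leb R n]_x F (tcons (a, x)))%E.
Proof.
move=> F0 mF.
transitivity (\int[lebesgue_measure \x @leb R n]_p F (tcons p))%E.
  exact: (ge0_integral_pushforward (@measurable_tcons _ _ n)
    (lebesgue_measure \x @leb R n)%E measurableT mF (fun x _ => F0 x)).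
by rewrite fubini_tonelli1//; exact: measurableT_comp mF (@measurable_tcons _ _ n).
Qed.

Lemma measurable_vsub n : measurable_fun setT (fun p : 'R[R]_n * 'R[R]_n => vsub p.1 p.2).
Proof.
apply: measurable_tuple_fun => i; under eq_fun do rewrite tnth_mktuple.
by apply: measurable_funB; apply: measurableT_comp (measurable_tnth i) _.
Qed.

Lemma integral_vsub n (v : 'R[R]_n) (F : 'R[R]_n -> \bar R) : (forall x, 0 <= F x)%E ->
  measurable_fun setT F -> (\int[leb]_x F (vsub v x) = \int[leb]_x F x)%E.
Proof.
elim: n v F => [|n IH] v F F0 mF.
  by apply: eq_integral => x _; congr F; rewrite [LHS]tuple0 [RHS]tuple0.
have mFv : measurable_fun setT (fun x => F (vsub v x)).
  exact: measurable_comp_pair (measurableT_comp mF (@measurable_vsub n.+1)) (measurable_cst v) _.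
rewrite !mu_powS_integral_tcons//.
pose H a := (\int[@leb R n]_x F (tcons (a, x)))%E.
rewrite -(lebesgue_measure_reflect (thead v : R) (f := H)).
- apply: eq_integral => a _.
  rewrite /H -(IH [tuple of behead v] (fun x => F (tcons (thead v - (a : R), x)))).
  + apply: eq_integral => x _; congr F; apply: eq_from_tnth => i; rewrite tnth_mktuple.
    rewrite (tuple_eta v); case: (unliftP ord0 i) => [j ->|->]; rewrite ?tnthS ?tnth0//.
    by rewrite /= tnth_mktuple !(tnth_nth (0 : R)).
  + by move=> x; exact: F0.
  + exact: (measurableT_comp mF (measurable_fun_pair2 _ (@measurable_tcons _ _ n))).
- apply: (measurable_fun_fubini_tonelli_F (F \o @tcons _ _ n)) => //=.
  exact: measurableT_comp mF (@measurable_tcons _ _ n).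
- by move=> a; exact: integral_ge0.
Qed.

(** Positive dimension matters: for n = 0 the measure is the unit mass on the empty tuple. Otherwise
    the head coordinate must equal a fixed number, already a null condition. *)
Lemma leb_set1 n (x : 'R[R]_n) : (0 < n)%N -> leb [set x] = 0%E.
Proof.
case: n x => // n x _.
have mx : measurable [set x] by exact: measurable_set1_diag (@measurable_tuple_diag _) x.
rewrite -[X in leb X]setIT -integral_indic// mu_powS_integral_tcons//; last first.
  exact/measurable_EFinP.
rewrite (ge0_ae_eq_integral _ _ (measurable_cst 0%E)) ?integral0//.
- apply: (measurable_fun_fubini_tonelli_F ((fun x' => (\1_[set x] x')%:E) \o @tcons _ _ n)) => //=.
  by apply: measurableT_comp (@measurable_tcons _ _ n); exact/measurable_EFinP.
- by move=> a _; apply: integral_ge0 => y _; rewrite lee_fin.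
exists [set thead x]; split; [exact: measurable_set1|exact: lebesgue_measure_set1|].
move=> a /= /not_implyP[_]; apply: contra_notP => ax.
apply: integral0_eq => y _; rewrite indicE memNset// => ayx.
by apply: ax; rewrite -ayx /tcons theadE.
Qed.

End lebesgue_tuple.

(** * Identification of P*_delta and Lhat with the operators of the kernel *)

Section glauber_kernel.
Context {R : realType} {d : nat}.
Local Notation Rd := 'R[R]_d.
Variable phi : Rd -> R.
Hypothesis d_gt0 : (0 < d)%N.
Hypothesis phi_meas : measurable_fun (~` [set vzero]) phi.
Hypothesis phi_ge0 : forall x : Rd, x != vzero -> 0 <= phi x.
Hypothesis phi_even : forall x : Rd, x != vzero -> phi (vopp x) = phi x.
Hypothesis Cphi_bnd : (0 < Cphi_int phi < +oo)%E.

(* The value of [phi] at the origin, on which nothing is assumed, is replaced by 0. *)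
Definition gker (x y : Rd) : R := expR (- (phi \_ (~` [set vzero])) (vsub x y)).

Let phi0 := phi \_ (~` [set vzero]).

Let phi0E x : phi0 x = if x == vzero then 0 else phi x.
Proof.
rewrite /phi0 patchE; case: eqP => [->|xn]; first by rewrite memNset//=; exact.
by rewrite mem_set.
Qed.

Let phi0_ge0 x : 0 <= phi0 x.
Proof. by rewrite phi0E; case: ifPn => // /phi_ge0. Qed.

Lemma vsub_eq0 (x y : Rd) : (vsub x y == vzero) = (x == y).
Proof.
apply/eqP/eqP => [xy|->]; last by apply: eq_from_tnth => i; rewrite !tnth_mktuple subrr.
apply: eq_from_tnth => i; have /(congr1 (fun v => tnth v i)) := xy.
by rewrite !tnth_mktuple => /eqP; rewrite subr_eq0 => /eqP.
Qed.

Lemma vopp_vsub (x y : Rd) : vopp (vsub x y) = vsub y x.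
Proof. by apply: eq_from_tnth => i; rewrite !tnth_mktuple opprB. Qed.

Lemma gkerC x y : gker x y = gker y x.
Proof.
rewrite /gker -/phi0 !phi0E !vsub_eq0 [y == x]eq_sym; case: eqP => // /eqP xy.
by rewrite -(vopp_vsub y x) phi_even// vsub_eq0 eq_sym.
Qed.

Lemma gker_neq x y : x != y -> gker x y = expR (- phi (vsub x y)).
Proof. by rewrite /gker -/phi0 phi0E vsub_eq0 => /negbTE ->. Qed.

Lemma gker_ge0 x y : 0 <= gker x y. Proof. exact: expR_ge0. Qed.

Lemma gker_le1 x y : gker x y <= 1.
Proof. by rewrite -expR0 ler_expR oppr_le0; exact: phi0_ge0. Qed.

Lemma measurable_vzero : measurable [set (vzero : Rd)].
Proof. exact: measurable_set1_diag (@measurable_tuple_diag R d) _. Qed.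

Let mphi0 : measurable_fun setT phi0.
Proof. by apply/(measurable_restrictT _ (measurableC measurable_vzero)). Qed.

Let mphi : measurable_fun setT phi.
Proof.
rewrite -(setUv [set vzero]); apply/measurable_funU; [exact: measurable_vzero| |].
  exact: measurableC measurable_vzero.
by split => //; exact: measurable_fun_set1.
Qed.

Let mexpN : measurable_fun setT (fun x : R => expR (- x)).
Proof. by apply: measurableT_comp; [exact: measurable_expR|exact: oppr_measurable]. Qed.

Lemma measurable_gker : measurable_fun setT (fun p : Rd * Rd => gker p.1 p.2).
Proof. exact: measurableT_comp mexpN (measurableT_comp mphi0 (@measurable_vsub R d)). Qed.

(** By symmetry and the reflection y -> x - y the integral does not depend on x; resetting phi at
    the origin changes the integrand on a null set. *)
Lemma gker_Cphi x : (\int[leb]_y (1 - gker y x)%:E <= (Cphi phi)%:E)%E.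
Proof.
have Ci : (Cphi phi)%:E = Cphi_int phi.
  by rewrite /Cphi fineK// ge0_fin_numE; case/andP: Cphi_bnd => // /ltW.
have m1 : measurable_fun setT (fun y => (1 - expR (- phi0 y))%:E).
  apply/measurable_EFinP; apply: measurable_funB; first exact: measurable_cst.
  exact: measurableT_comp mexpN mphi0.
under eq_integral do rewrite gkerC.
rewrite (integral_vsub x (F := fun y => (1 - expR (- phi0 y))%:E))//; last first.
  by move=> y; rewrite lee_fin subr_ge0 -expR0 ler_expR oppr_le0.
rewrite Ci /Cphi_int le_eqVlt; apply/orP; left; apply/eqP.
apply: ae_eq_integral => //.
  apply/measurable_EFinP; apply: measurable_funB; first exact: measurable_cst.
  exact: measurableT_comp mexpN mphi.
exists [set vzero]; split; [exact: measurable_vzero|exact: leb_set1|].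
move=> y /= /not_implyP[_]; apply: contra_notP => /eqP/negbTE yn.
by rewrite phi0E yn.
Qed.

Lemma Ephi_gprod y omega : y \notin omega -> expR (- Ephi phi y omega) = gprod gker y omega.
Proof.
move=> yo; rewrite /Ephi -sumrN expR_sum /gprod; apply: eq_big_seq => x xo.
by rewrite gker_neq//; apply: contraNneq yo => ->.
Qed.

Let mdiagd : measurable [set p : Rd * Rd | p.1 = p.2].
Proof. exact: measurable_tuple_diag. Qed.

Let leb_diffuse (x : Rd) : leb [set x] = 0%E.
Proof. exact: leb_set1. Qed.

Let mphi_vsub (y : Rd) : measurable_fun setT (fun x : Rd => phi (vsub x y)).
Proof. exact: measurableT_comp mphi (measurable_fun_pair1 _ (@measurable_vsub R d)). Qed.

Let mEphi (omega : {fset Rd}) : measurable_fun setT (fun x : Rd => expR (- Ephi phi x omega)).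
Proof.
apply: measurableT_comp mexpN _; apply: measurable_sum => y; exact: mphi_vsub.
Qed.

(** The value of phi at the origin enters only when a point of [xi] lies in [omega]. Such [xi] form
    a null set, so the operators agree at every configuration, which permits replacing one by the
    other under iteration. *)
Lemma Pstar_Pst z delta k : measurable_fun setT k ->
  Pstar phi z delta k = Pst leb gker z delta k.
Proof.
move=> mk; apply/funext => eta; rewrite /Pstar /Pst /splitsum.
apply: eq_big_seq => omega _; rewrite -mulrA; congr (_ * _); rewrite /Aop.
congr (_ * _).
  by apply: eq_big_seq => y; rewrite in_fsetD => /andP[yo _]; exact: Ephi_gprod.
set zeta := (_ `\` _)%fset.
have mkU : measurable_fun setT (fun xi => k (xi `|` zeta)%fset).
  apply/measurable_fun_fset; rewrite -[zeta]fset_of_enum.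
  exact: (measurable_fun_pair1 (enum_fset zeta) (measurable_fsetU mk)).
have mprod (v : Rd -> R) : measurable_fun setT v ->
    measurable_fun setT (fun xi : {fset Rd} => \prod_(y <- xi) v y).
  move=> mv; apply/measurable_fun_fset.
  have := @measurable_prod_fset _ _ _ mdiagd _ Rd (v \o snd) (measurableT_comp mv measurable_snd).
  by move=> /(measurable_fun_pair2 point).
have mB1 (v : Rd -> R) : measurable_fun setT v -> measurable_fun setT (fun y => v y - 1).
  by move=> mv; apply: measurable_funB => //; exact: measurable_cst.
have m1 := measurable_funM (mprod _ (mB1 _ (mEphi omega))) mkU.
have m2 := measurable_funM (mprod _ (mB1 _ (measurable_gprod1 mdiagd measurable_gker omega))) mkU.
rewrite (Rintegral_lebesgue_poisson _ m1) (Rintegral_lebesgue_poisson _ m2).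
apply: ae_eq_Rintegral.
- exact: measurableT_comp m1 (@measurable_fset_of _ Rd).
- exact: measurableT_comp m2 (@measurable_fset_of _ Rd).
have := @seq_measure_disjoint _ _ _ leb mdiagd leb_diffuse omega.
apply: filterS => s dso /=; congr (_ * _); apply: eq_big_seq => y ys.
by rewrite Ephi_gprod//; exact: (fdisjointP dso).
Qed.

(** Only integration points x inside the finite set [eta] could make the formulas differ, and these
    are null. *)
Lemma Lhat_Lh z (G : {fset Rd} -> R) : measurable_fun setT G ->
  Lhat phi z G = Lh leb gker z G.
Proof.
move=> mG; apply/funext => eta; rewrite /Lhat /Lh; congr (_ + z * _).
rewrite /splitsum; apply: eq_big_seq => xi; rewrite fpowersetE => xe; rewrite /Bop.
have mGx : measurable_fun setT (fun x => G (x |` xi)%fset).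
  have mc := measurable_comp_pair (@measurable_seq_cons _ Rd)
    (@measurable_id _ Rd setT) (measurable_cst (enum_fset xi)).
  have := measurableT_comp (measurableT_comp mG (@measurable_fset_of _ Rd)) mc.
  by congr measurable_fun; apply/funext => x /=; rewrite fset_of_cons fset_of_enum.
apply: ae_eq_Rintegral.
- apply: measurable_funM; first exact: measurable_funM.
  rewrite ?/e_lambda; apply: measurable_prod => y _.
  apply: measurable_funB; last exact: measurable_cst.
  exact: measurableT_comp mexpN (mphi_vsub y).
- apply: measurable_funM.
    by apply: measurable_funM => //; exact: (measurable_gprod1 mdiagd measurable_gker).
  rewrite ?/e_lambda; apply: measurable_prod => y _.
  apply: measurable_funB; last exact: measurable_cst.
  exact: measurable_fun_pair1 y measurable_gker.
have : {ae leb, forall x : Rd, x \notin eta}.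
  elim/(@fset_of_ind Rd): (eta) => [|a zeta _ IH].
    by apply: (filterS _ (filterT : {ae leb, forall x : Rd, True})).
  apply: filterS2 IH (_ : {ae leb, forall x : Rd, x != a}).
    by move=> x xz xa; rewrite !inE negb_or xa.
  exists [set a]; split; [exact: measurable_set1_diag mdiagd _|exact: leb_diffuse|].
  by move=> x /= /negP/negPn/eqP.
apply: filterS => x xe'.
have xn : x \notin xi by apply: contra xe'; exact: (fsubsetP xe).
rewrite Ephi_gprod// /e_lambda; congr (_ * _); apply: eq_big_seq => y.
rewrite in_fsetD => /andP[_ ye]; rewrite gker_neq//.
by apply: contraNneq xe' => ->.
Qed.

End glauber_kernel.

(** * The function x e^{-x} and the condition alpha > alpha0 *)

Section xexp.
Context {R : realType}.

(** With u = y - x > 0, the strict inequality e^{-u} > 1 - u gives y e^{-u} > y (1 - u) = x + u (1 -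
    y) >= x. *)
Lemma xexp_increasing (x y : R) : 0 <= x < y -> y <= 1 -> x * expR (- x) < y * expR (- y).
Proof.
move=> /andP[x0 xy] y1; have y0 : 0 < y by exact: le_lt_trans xy.
rewrite (_ : - y = - (y - x) + - x); last by ring.
rewrite expRD mulrA ltr_pM2r ?expR_gt0//.
have := @expR_gt1Dx R (- (y - x)); rewrite oppr_eq0 subr_eq0 (gt_eqF xy) => /(_ isT) h.
have {}h : 0 < y * (expR (- (y - x)) - (1 - (y - x))) by rewrite mulr_gt0 ?subr_gt0.
have : 0 <= (y - x) * (1 - y) by rewrite mulr_ge0 ?subr_ge0// ltW.
by move: h; set E := expR _; lra.
Qed.

Lemma xexp_decreasing (x y : R) : 1 <= x <= y -> y * expR (- y) <= x * expR (- x).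
Proof.
move=> /andP[x1 xy]; rewrite (_ : - x = (y - x) + - y); last by ring.
rewrite expRD mulrA ler_pM2r ?expR_gt0//.
have x0 : 0 < x by lra.
have h : 0 <= x * (expR (y - x) - (1 + (y - x))).
  by rewrite mulr_ge0 ?subr_ge0 ?expR_ge1Dx// ltW.
have : 0 <= (y - x) * (x - 1) by rewrite mulr_ge0 ?subr_ge0.
by move: h; set E := expR _; lra.
Qed.

Lemma xexp_root (c : R) : 0 < c < expR (- 1) -> exists x, 0 < x < 1 /\ x * expR (- x) = c.
Proof.
move=> /andP[c0 c1]; pose f (x : R) := x * expR (- x).
have cf : {within `[0, 1], continuous f}.
  apply: continuous_subspaceT => x; apply: cvgM; first exact: cvg_id.
  by apply: continuous_comp; [exact: opp_continuous|exact: continuous_expR].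
have [||x xI fx] := @IVT R f 0 1 c _ cf => //.
  by rewrite /f mul0r mul1r minEle maxEle expR_ge0 (ltW c0) (ltW c1).
exists x; split => //; move: xI; rewrite in_itv/= => /andP[x0 x1].
rewrite !lt_neqAle x0 x1 !andbT; apply/andP; split.
  by apply/eqP => x00; move: fx c0; rewrite -x00 /f mul0r => <-; rewrite ltxx.
by apply/eqP => x11; move: fx c1; rewrite x11 /f mul1r => <-; rewrite ltxx.
Qed.

(* For a = alpha C the last inequality reads z Cphi <= x e^{-x} at x = a Cphi, and
   x e^{-x} increases up to x = 1 and decreases afterwards; this is what the two
   cases in the definition of [alpha0] express. *)
Lemma alpha0_stable d (phi : 'R[R]_d -> R) (C z alpha : R) :
  0 < C -> 0 < z -> 0 < Cphi phi ->
  z <= Num.min (C * expR (- (C * Cphi phi))) (2 * C * expR (- (2 * C * Cphi phi))) ->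
  alpha0 phi z C < alpha < 1 ->
  [/\ 2^-1 < alpha, 1 < alpha * C & z * expR (alpha * C * Cphi phi) <= alpha * C].
Proof.
move=> C0 z0; set kap := Cphi phi => k0; rewrite le_min => /andP[z1 z2].
rewrite /alpha0 -/kap /=; set q := C * kap; have q0 : 0 < q by exact: mulr_gt0.
have zk1 : z * kap <= q * expR (- q).
  by rewrite /q mulrAC; apply: ler_wpM2r => //; exact: ltW.
have zk2 : z * kap <= 2 * q * expR (- (2 * q)).
  by rewrite /q !mulrA mulrAC; apply: ler_wpM2r => //; exact: ltW.
suff H : 2^-1 < alpha -> C^-1 < alpha -> z * kap <= alpha * q * expR (- (alpha * q)) ->
    [/\ 2^-1 < alpha, 1 < alpha * C & z * expR (alpha * C * kap) <= alpha * C].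
  have [q1|q1] := ltP 1 q; rewrite !gt_max => /andP[/andP[/andP[a2 aq] aC] a1]; apply: H => //.
    apply: le_trans zk1 _; apply: xexp_decreasing; rewrite -ler_pdivrMr// div1r (ltW aq)/=.
    by rewrite ler_piMl// ltW.
  have a0 : 0 < alpha by apply: lt_trans a2; rewrite invr_gt0.
  (* For q < 1 the bound [zk1] is strict by monotonicity up to 1; at q = 1 the bound [zk2] is used
     instead, with 2 e^{-2} < e^{-1}. *)
  have zke : 0 < z * kap < expR (- 1).
    rewrite mulr_gt0//=; move: q1; rewrite le_eqVlt => /predU1P[q1|q1].
      apply: le_lt_trans zk2 _; rewrite q1 mulr1 (_ : - 2 = - 1 + - 1 :> R); last by ring.
      rewrite expRD mulrA -[ltRHS]mul1r ltr_pM2r ?expR_gt0// expRN ltr_pdivrMr ?expR_gt0// mul1r.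
      by have := @expR_gt1Dx R 1 (oner_neq0 _).
    by apply: le_lt_trans zk1 _; rewrite -[ltRHS]mul1r xexp_increasing// q1 ltW.
  have [x [x01 xz]] := xexp_root zke.
  have : has_inf [set x : R | 0 < x < 1 /\ x * expR (- x) = z * kap].
    by split; [exists x|exists 0 => y /= [/andP[/ltW]]].
  move: aq; rewrite ltr_pdivrMr// /small_root -/kap -subr_gt0 => sq hi.
  (* Since the infimum lies below alpha q, some root y does, and x e^{-x} increases from y to alpha
     q. *)
  have [y /= [/andP[y0 y1] yz]] := inf_adherent sq hi.
  rewrite addrC subrK => yq; rewrite -yz ltW// xexp_increasing ?(ltW y0)//.
  by rewrite (le_trans _ q1)// ler_piMl// ltW.
move=> a2 aC; rewrite /q mulrA.
have kapE : alpha * C * kap * expR (- (alpha * C * kap)) = alpha * C / expR (alpha * C * kap) * kap.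
  by rewrite expRN mulrAC.
rewrite kapE ler_pM2r// ler_pdivlMr ?expR_gt0// => h.
by split => //; rewrite -ltr_pdivrMr// div1r.
Qed.

End xexp.

(** * The spaces L_C and K_C and their duality *)

Section norms.
Context d (T : measurableType d) (R : realType) (nu : {measure set T -> \bar R}).

Lemma LfunE p (f : T -> R) : f \in Lfun nu p <->
  measurable_fun setT f /\ (Lnorm nu p (EFin \o f) < +oo)%E.
Proof.
split=> [/andP[]|[mf fin]]; first by rewrite !inE.
by apply/andP; rewrite !inE.
Qed.

Lemma Lnormy_leP (f : T -> R) (M : R) : (0 < nu setT)%E ->
  (Lnorm nu +oo (EFin \o f) <= M%:E)%E <-> {ae nu, forall x, `|f x| <= M}.
Proof.
move=> nu0; rewrite unlock /Lnorm /= nu0; split.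
  by move=> /ess_supP; apply: filterS => x /=.
by move=> H; apply/ess_supP; apply: filterS H => x /=.
Qed.

End norms.

Section spaces.
Context {R : realType} {d : nat}.
Local Notation Rd := 'R[R]_d.
Local Notation Gamma0 := {fset Rd}.
Implicit Types (G k h : Gamma0 -> R) (C c M : R).

Let mdiagd : measurable [set p : Rd * Rd | p.1 = p.2].
Proof. exact: measurable_tuple_diag. Qed.

Let mpow c : measurable_fun setT (fun eta : Gamma0 => c ^+ #|` eta|).
Proof. exact: measurable_pow_card. Qed.

Let mpowV c : measurable_fun setT (fun eta : Gamma0 => c ^- #|` eta|).
Proof. by under eq_fun do rewrite -exprVn; exact: mpow. Qed.


(** The empty configuration has unit mass. Positivity of the total mass selects the branch of
    [Lnorm] in which the sup norm is an essential supremum. *)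
Lemma lambda_setT_gt0 : (0 < @lambda R d setT)%E.
Proof.
rewrite /lambda /lebesgue_poisson /= /mseries.
apply: lt_le_trans (nneseries_lim_ge 1 _) => [|n _ _]; last exact: measure_ge0.
rewrite big_nat1 /=.
rewrite (_ : mscale _ _ _ =
  ((0`!%:R^-1 : R)%:E * \d_([tuple] : 0.-tuple Rd) setT)%E)//.
by rewrite diracT mule1 lte_fin fact0 invr1.
Qed.

(* For [0 < C] and measurable [k], this says that the norm of [k] in K_C is at most [M]. *)
Definition abound C M k := measurable_fun setT k /\
  {ae @lambda R d, forall eta, `|k eta| <= M * C ^+ #|` eta|}.

Lemma Kspc_norm_leP C M k : 0 < C -> measurable_fun setT k ->
  (Kspc_norm C k <= M%:E)%E <-> abound C M k.
Proof.
move=> C0 mk; rewrite /Kspc_norm.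
rewrite (@Lnormy_leP _ _ _ lambda (fun eta : Gamma0 => C ^- #|` eta| * k eta) M lambda_setT_gt0).
have E eta : (`|C ^- #|` eta| * k eta| <= M) = (`|k eta| <= M * C ^+ #|` eta|).
  have Cn : 0 < C ^+ #|` eta| by rewrite exprn_gt0.
  by rewrite normrM gtr0_norm ?invr_gt0// mulrC ler_pdivrMr.
split=> [H|[_ H]]; [split => //|]; apply: filterS H => eta; by rewrite E.
Qed.

Lemma KspcP C k : 0 < C -> Kspc C k <-> exists M, abound C M k.
Proof.
move=> C0; split.
  move=> /LfunE[mk' fin]; have mk : measurable_fun setT k.
    have := measurable_funM (mpow C) mk'; congr measurable_fun; apply/funext => eta /=.
    by rewrite mulrA divff ?mul1r// expf_neq0 ?gt_eqF.
  have n0 : (0 <= Kspc_norm C k)%E by exact: Lnorm_ge0.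
  exists (fine (Kspc_norm C k)); apply/(Kspc_norm_leP _ C0 mk).
  by rewrite fineK// ge0_fin_numE.
move=> [M kM]; have mk := kM.1; apply/LfunE; split; first exact: measurable_funM.
by apply: le_lt_trans (ltry M); apply/(Kspc_norm_leP M C0 mk).
Qed.

Lemma Kspc_norm_fine C k : 0 < C -> Kspc C k -> abound C (fine (Kspc_norm C k)) k.
Proof.
move=> C0 kC; have [M kM] := (KspcP k C0).1 kC.
apply/(Kspc_norm_leP _ C0 kM.1); rewrite fineK// ge0_fin_numE; last exact: Lnorm_ge0.
by apply: le_lt_trans (ltry M); apply/(Kspc_norm_leP M C0 kM.1).
Qed.

Lemma Lspc_normE C G : 0 < C ->
  Lspc_norm C G = (\int[lambda]_eta (`|G eta| * C ^+ #|` eta|)%:E)%E.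
Proof.
move=> C0; rewrite /Lspc_norm Lnorm1; apply: eq_integral => eta _ /=.
by rewrite normrM (@ger0_norm _ (_ ^+ _)) ?exprn_ge0// ltW.
Qed.

Lemma LspcP C G : 0 < C -> Lspc C G <->
  measurable_fun setT G /\ (\int[lambda]_eta (`|G eta| * C ^+ #|` eta|)%:E < +oo)%E.
Proof.
move=> C0; rewrite -Lspc_normE//; split.
  move=> /LfunE[mG' fin]; split => //; have := measurable_funM mG' (mpowV C).
  congr measurable_fun; apply/funext => eta /=.
  by rewrite mulfK// expf_neq0 ?gt_eqF.
by move=> [mG fin]; apply/LfunE; split => //; exact: measurable_funM.
Qed.

Lemma measurable_Lspc C G : 0 < C -> Lspc C G -> measurable_fun setT G.
Proof. by move=> C0 /(LspcP _ C0)[]. Qed.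

Let mnormpow C G : measurable_fun setT G ->
  measurable_fun setT (fun eta => (`|G eta| * C ^+ #|` eta|)%:E).
Proof.
by move=> mG; apply/measurable_EFinP; apply: measurable_funM => //; exact: measurableT_comp.
Qed.

Section Lspc_theory.
Variable C : R.
Hypothesis C0 : 0 < C.

Lemma Lspc_norm_fin G : Lspc C G -> Lspc_norm C G = (fine (Lspc_norm C G))%:E.
Proof.
move=> /(LspcP _ C0)[mG fin]; rewrite fineK// Lspc_normE// ge0_fin_numE//.
by apply: integral_ge0 => eta _; rewrite lee_fin mulr_ge0// exprn_ge0// ltW.
Qed.

Let norm_ge0 G eta : (0 <= (`|G eta| * C ^+ #|` eta|)%:E)%E.
Proof. by rewrite lee_fin mulr_ge0// exprn_ge0// ltW. Qed.

Lemma Lspc_normD G H : measurable_fun setT G -> measurable_fun setT H ->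
  (Lspc_norm C (G + H)%R <= Lspc_norm C G + Lspc_norm C H)%E.
Proof.
move=> mG mH; rewrite !Lspc_normE// -ge0_integralD//; try exact: mnormpow.
apply: ge0_le_integral => //.
- exact: (mnormpow _ (measurable_funD mG mH)).
- by apply: emeasurable_funD; exact: mnormpow.
move=> eta _; rewrite -EFinD lee_fin -mulrDl ler_wpM2r ?exprn_ge0 ?(ltW C0)//.
exact: ler_normD.
Qed.

Lemma Lspc_normZ a G : measurable_fun setT G ->
  Lspc_norm C (a *: G) = (`|a|%:E * Lspc_norm C G)%E.
Proof.
move=> mG; rewrite !Lspc_normE// -ge0_integralZl//; try exact: mnormpow.
by apply: eq_integral => eta _; rewrite -EFinM mulrA -normrM.
Qed.

Lemma Lspc0 : Lspc C (0 : Gamma0 -> R).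
Proof.
apply/(LspcP _ C0); split; first exact: measurable_cst.
by rewrite integral0_eq ?ltry// => eta _; rewrite normr0 mul0r.
Qed.

Lemma Lspc_lin a G H : Lspc C G -> Lspc C H -> Lspc C (a *: G + H).
Proof.
move=> dG dH; have mG := measurable_Lspc C0 dG; have mH := measurable_Lspc C0 dH.
have maG : measurable_fun setT (a *: G) by apply: measurable_funM => //; exact: measurable_cst.
apply/(LspcP _ C0); split; first exact: measurable_funD.
rewrite -Lspc_normE//; apply: le_lt_trans (Lspc_normD maG mH) _.
rewrite Lspc_normZ// Lspc_norm_fin// (Lspc_norm_fin dH) -EFinM -EFinD.
exact: ltry.
Qed.

Lemma fine_Lspc_normD G H : Lspc C G -> Lspc C H ->
  fine (Lspc_norm C (G + H)%R) <= fine (Lspc_norm C G) + fine (Lspc_norm C H).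
Proof.
move=> dG dH; have mG := measurable_Lspc C0 dG; have mH := measurable_Lspc C0 dH.
rewrite -lee_fin EFinD -!Lspc_norm_fin//; first exact: Lspc_normD.
by rewrite -[G]scale1r; exact: Lspc_lin.
Qed.

Lemma fine_Lspc_normZ a G : Lspc C G ->
  fine (Lspc_norm C (a *: G)) = `|a| * fine (Lspc_norm C G).
Proof.
by move=> dG; rewrite (Lspc_normZ a (measurable_Lspc C0 dG)) (Lspc_norm_fin dG).
Qed.

Lemma pairing_integral_le M G k : 0 <= M -> measurable_fun setT G -> abound C M k ->
  (\int[lambda]_eta `|(G eta * k eta)%:E| <= M%:E * Lspc_norm C G)%E.
Proof.
move=> M0 mG [mk kM]; rewrite Lspc_normE// -ge0_integralZl//; try exact: mnormpow.
apply: ae_ge0_le_integral => //.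
- by apply/measurableT_comp => //; apply/measurable_EFinP; exact: measurable_funM.
- by move=> eta _; rewrite mule_ge0.
- by apply: measurable_funeM; exact: mnormpow.
apply: filterS kM => eta H _; rewrite /= lee_fin normrM mulrCA.
by rewrite ler_wpM2l.
Qed.

Lemma pairing_integrable M G k : 0 <= M -> Lspc C G -> abound C M k ->
  (@lambda R d).-integrable setT (EFin \o (fun eta => G eta * k eta)).
Proof.
move=> M0 dG kM; have mG := measurable_Lspc C0 dG.
apply/integrableP; split.
  by apply/measurable_EFinP; apply: measurable_funM => //; exact: kM.1.
apply: le_lt_trans (pairing_integral_le M0 mG kM) _.
by rewrite (Lspc_norm_fin dG) -EFinM ltry.
Qed.

Lemma ler_norm_pairing M G k : 0 <= M -> Lspc C G -> abound C M k ->
  `|pairing G k| <= M * fine (Lspc_norm C G).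
Proof.
move=> M0 dG kM; have mG := measurable_Lspc C0 dG.
rewrite -lee_fin EFinM -Lspc_norm_fin//.
apply: le_trans _ (pairing_integral_le M0 mG kM).
apply: le_EFin_norm_Rintegral; apply: measurable_funM => //; exact: kM.1.
Qed.

Lemma pairing_linl M a G H k : 0 <= M -> Lspc C G -> Lspc C H -> abound C M k ->
  pairing (a *: G + H) k = a * pairing G k + pairing H k.
Proof.
move=> M0 dG dH kM; have iG := pairing_integrable M0 dG kM; have iH := pairing_integrable M0 dH kM.
rewrite /pairing -RintegralZl// -RintegralD//.
  by apply: eq_Rintegral => eta _; rewrite mulrA -mulrDl.
have := integrableZl measurableT a iG; apply: eq_integrable => // eta _ /=.
Qed.

Lemma pairing_linr M1 M2 a G k1 k2 : 0 <= M1 -> 0 <= M2 -> Lspc C G ->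
  abound C M1 k1 -> abound C M2 k2 ->
  pairing G (a *: k1 + k2) = a * pairing G k1 + pairing G k2.
Proof.
move=> M10 M20 dG b1 b2.
have i1 := pairing_integrable M10 dG b1; have i2 := pairing_integrable M20 dG b2.
rewrite /pairing -RintegralZl// -RintegralD//.
  by apply: eq_Rintegral => eta _; rewrite mulrDr mulrCA.
have := integrableZl measurableT a i1; apply: eq_integrable => // eta _ /=.
Qed.

End Lspc_theory.

Lemma bounded_functional_pairing C M k : 0 < C -> 0 <= M -> abound C M k ->
  bounded_functional (Lspc C) (fun G => fine (Lspc_norm C G)) (pairing ^~ k) M.
Proof.
move=> C0 M0 kM; split => //.
- by move=> a G H dG dH; exact: pairing_linl kM.
- by move=> G dG; exact: ler_norm_pairing.
Qed.

End spaces.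

(** * Recovering bounds in K_C from pairings *)

Section duality_test.
Context {R : realType} {d : nat}.
Local Notation Rd := 'R[R]_d.
Local Notation Gamma0 := {fset Rd}.
Implicit Types (G k h : Gamma0 -> R) (C c M : R).
Hypothesis d_gt0 : (0 < d)%N.

Let mdiagd : measurable [set p : Rd * Rd | p.1 = p.2].
Proof. exact: measurable_tuple_diag. Qed.

Let mpow c : measurable_fun setT (fun eta : Gamma0 => c ^+ #|` eta|).
Proof. exact: measurable_pow_card. Qed.

Lemma fbound_abound C M k : fbound C M k -> abound C M k.
Proof. by move=> [mk kM]; split => //; exact: nearW. Qed.

(** Truncation at +- M C^{|eta|} changes [k] only where the bound fails. *)
Lemma abound_fbound C M k : 0 < C -> 0 <= M -> abound C M k ->
  exists2 k', fbound C M k' & {ae @lambda R d, forall eta, k' eta = k eta}.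
Proof.
move=> C0 M0 [mk kM].
have mb : measurable_fun setT (fun eta : Gamma0 => M * C ^+ #|` eta|).
  by apply: measurable_funM => //; exact: measurable_cst.
exists (fun eta => Num.max (- (M * C ^+ #|` eta|)) (Num.min (k eta) (M * C ^+ #|` eta|))).
  split; first by apply: measurable_maxr; [exact: measurableT_comp|exact: measurable_minr].
  move=> eta; have b0 : 0 <= M * C ^+ #|` eta| by rewrite mulr_ge0// exprn_ge0// ltW.
  rewrite ler_norml le_max lexx/= ge_max ge_min lexx orbT andbT.
  by lra.
apply: filterS kM => eta; rewrite ler_norml => /andP[k1 k2].
by rewrite (min_idPl k2) (max_idPr k1).
Qed.

(** A product over the points of a Gaussian density w, itself a product over coordinates. The
    exponential formula makes the integral against c^{|eta|} equal to the exponential of c times the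
    integral of w, finite for every c. *)
Lemma exists_positive_weight : exists2 W : Gamma0 -> R,
  measurable_fun setT W /\ (forall eta, 0 < W eta) &
  forall c, 0 <= c -> (\int[@lambda R d]_eta (W eta * c ^+ #|` eta|)%:E < +oo)%E.
Proof.
have n1 : (1 : R) != 0 by exact: oner_neq0.
pose v (x : measurableTypeR R) : R := normal_pdf 0 1 x.
have mv : measurable_fun setT v by exact: measurable_normal_pdf.
have v0 x : 0 < v x.
  rewrite /v normal_pdfE// mulr_gt0 ?normal_peak_gt0//.
  exact: expR_gt0.
have vi : (\int[lebesgue_measure]_x (v x)%:E = 1)%E by exact: integral_normal_pdf.
pose w (x : Rd) : R := \prod_(y <- x) v y.
have mw : measurable_fun setT w.
  exact: measurableT_comp (measurable_prod_seq1 mv) (@measurable_seq_of_tuple _ _ d).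
have w0 x : 0 < w x by exact: prodr_gt0.
have wi : (\int[leb]_x (w x)%:E < +oo)%E.
  rewrite /w /leb mu_pow_prod ?ltry//; first by move=> x; exact: ltW.
  by apply: le_lt_trans (ltry 1); rewrite vi.
pose W (eta : Gamma0) : R := \prod_(x <- eta) w x.
have mprod (u : Rd -> R) : measurable_fun setT u ->
    measurable_fun setT (fun xi : Gamma0 => \prod_(y <- xi) u y).
  move=> mu; apply/measurable_fun_fset.
  have := @measurable_prod_fset _ _ _ mdiagd _ Rd (u \o snd) (measurableT_comp mu measurable_snd).
  by move=> /(measurable_fun_pair2 point).
exists W; first by split; [exact: mprod|move=> eta; exact: prodr_gt0].
move=> c c0.
have WE eta : W eta * c ^+ #|` eta| = \prod_(x <- eta) (w x * c).
  by rewrite big_split /= big_const_seq count_predT iter_mulr_1.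
under eq_integral do rewrite WE.
have mwc : measurable_fun setT (fun x => w x * c).
  by apply: measurable_funM => //; exact: measurable_cst.
rewrite (integral_lebesgue_poisson leb
  (F := fun eta : Gamma0 => (\prod_(x <- eta) (w x * c))%:E)); last first.
  by apply/measurable_EFinP; exact: mprod.
rewrite (seq_measure_prod_fset mdiagd (fun x => leb_set1 x d_gt0) mwc) ?ltry//.
  by move=> x; rewrite mulr_ge0// ltW.
under eq_integral do rewrite EFinM.
rewrite ge0_integralZr//; last by move=> x _; rewrite lee_fin ltW.
  have wi0 : (0 <= \int[leb]_x (w x)%:E)%E.
    by apply: integral_ge0 => x _; rewrite lee_fin ltW.
  by rewrite -(fineK (_ : \int[leb]_x (w x)%:E \is a fin_num)%E) ?ge0_fin_numE// -EFinM ltry.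
exact/measurable_EFinP.
Qed.

Lemma Lspc_sub C c G : 0 < C <= c -> Lspc c G -> Lspc C G.
Proof.
move=> /andP[C0 Cc]; have c0 := lt_le_trans C0 Cc.
have mn b : measurable_fun setT G -> measurable_fun setT (fun eta => (`|G eta| * b ^+ #|` eta|)%:E).
  by move=> mG; apply/measurable_EFinP; apply: measurable_funM => //; exact: measurableT_comp.
move=> /(LspcP _ c0)[mG fin]; apply/(LspcP _ C0); split => //.
apply: le_lt_trans fin; apply: ge0_le_integral => //.
- by move=> eta _; rewrite lee_fin mulr_ge0// exprn_ge0// ltW.
- exact: mn.
- exact: mn.
by move=> eta _; rewrite lee_fin ler_wpM2l// lerXn2r// nnegrE ltW.
Qed.

(* Test against sgn(h) W on the set where |h| > M C^{|eta|}, for a positive weight W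
   that is integrable with all powers c^{|eta|}. *)
Lemma pairing_test C M (K : R) h : 0 < C -> 0 <= M -> 0 <= K -> abound C K h ->
  (forall G, Lspc (2 * C) G -> `|pairing G h| <= M * fine (Lspc_norm C G)) ->
  abound C M h.
Proof.
move=> C0 M0 K0 hK H; split; first exact: hK.1.
have mh := hK.1; have [W [mW W0] Wi] := exists_positive_weight.
have C20 : 0 < 2 * C by rewrite mulr_gt0.
have mMC : measurable_fun setT (fun eta : Gamma0 => M * C ^+ #|` eta|).
  by apply: measurable_funM => //; exact: measurable_cst.
have mnh : measurable_fun setT (fun eta => `|h eta|) by exact: measurableT_comp.
pose s (eta : Gamma0) : R :=
  if M * C ^+ #|` eta| < `|h eta| then (if 0 < h eta then 1 else - 1) else 0.
have ms : measurable_fun setT s.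
  apply: measurable_fun_ifT; [exact: measurable_fun_ltr| |exact: measurable_cst].
  apply: measurable_fun_ifT; [|exact: measurable_cst|exact: measurable_cst].
  by apply: measurable_fun_ltr => //; exact: measurable_cst.
have s1 eta : `|s eta| <= 1.
  by rewrite /s; case: ifP => _; [case: ifP => _|]; rewrite ?normrN ?normr0 ?normr1.
pose G (eta : Gamma0) : R := s eta * W eta.
have mG : measurable_fun setT G by exact: measurable_funM.
have GL : Lspc (2 * C) G.
  apply/(LspcP _ C20); split => //; apply: le_lt_trans (Wi _ (ltW C20)).
  apply: ge0_le_integral => //.
  - by move=> eta _; rewrite lee_fin mulr_ge0// exprn_ge0// ltW.
  - by apply/measurable_EFinP; apply: measurable_funM => //; exact: measurableT_comp.
  - by apply/measurable_EFinP; exact: measurable_funM.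
  move=> eta _; rewrite lee_fin ler_wpM2r ?exprn_ge0 ?(ltW C20)//.
  by rewrite normrM (gtr0_norm (W0 eta)) ler_piMl// ltW.
have GC : Lspc C G by apply: Lspc_sub GL; rewrite C0 /=; lra.
have i1 := pairing_integrable C0 K0 GC hK.
have b2 : abound C 1 (fun eta : Gamma0 => C ^+ #|` eta|).
  by split => //; apply: nearW => eta; rewrite mul1r ger0_norm ?exprn_ge0 ?(ltW C0).
have GC' : Lspc C (fun eta => `|G eta|).
  move: GC => /(LspcP _ C0)[_ fin]; apply/(LspcP _ C0); split; first exact: measurableT_comp.
  by under eq_integral do rewrite normr_id.
have i2 := pairing_integrable C0 ler01 GC' b2.
have i3 := integrableZl measurableT M i2.
(* Pointwise nonnegative by the choice of [G], while the hypothesis on pairings makes its integral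
   at most 0; hence it vanishes almost everywhere, and [W > 0] leaves no room for |h| > M
   C^{|eta|}. *)
pose u (eta : Gamma0) : R := G eta * h eta - M * (`|G eta| * C ^+ #|` eta|).
have uE eta : u eta =
    W eta * (if M * C ^+ #|` eta| < `|h eta| then `|h eta| - M * C ^+ #|` eta| else 0).
  rewrite /u /G /s normrM (gtr0_norm (W0 eta)); case: ifPn => _; last first.
    by rewrite normr0 !(mul0r, mulr0) subrr.
  by case: ltP => h0; rewrite ?normrN normr1; [rewrite gtr0_norm//|rewrite ler0_norm//]; ring.
have u0 eta : 0 <= u eta.
  rewrite uE mulr_ge0 ?(ltW (W0 _))//; case: ifP => // /ltW; rewrite subr_ge0//.
have iu : (@lambda R d).-integrable setT (EFin \o u).
  by have := integrableB measurableT i1 i3; apply: eq_integrable.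
have ule0 : \int[lambda]_eta u eta <= 0.
  rewrite RintegralB//= RintegralZl// subr_le0.
  have := H G GL; rewrite Lspc_normE// => /(le_trans (ler_norm _)).
  by [].
have mu : measurable_fun setT u by exact/measurable_EFinP/measurable_int/iu.
have : {ae @lambda R d, forall eta, u eta = 0}.
  have /(ae_eq_integral_abs _ measurableT ((measurable_EFinP _ _).2 mu)) :
      (\int[@lambda R d]_eta `|(u eta)%:E| = 0)%E.
    under eq_integral do rewrite gee0_abs ?lee_fin ?u0//.
    apply/eqP; rewrite eq_le integral_ge0 ?andbT => [|eta _]; last by rewrite lee_fin.
    rewrite -[leLHS]fineK ?lee_fin//; exact: integrable_fin_num iu.
  by apply: filterS => eta /(_ I) [].
apply: filterS => eta /eqP; rewrite uE mulf_eq0 (gt_eqF (W0 eta))/=.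
by case: ltP => // hM; rewrite subr_eq0 => /eqP e; rewrite e ltxx in hM.
Qed.

End duality_test.

(** * Calculus of almost everywhere bounds *)

Section abound_theory.
Context {R : realType} {d : nat}.
Local Notation Gamma0 := {fset 'R[R]_d}.
Implicit Types (k h : Gamma0 -> R) (C c M : R).

Lemma aboundD C M1 M2 k1 k2 :
  abound C M1 k1 -> abound C M2 k2 -> abound C (M1 + M2) (k1 + k2).
Proof.
move=> [m1 b1] [m2 b2]; split; first exact: measurable_funD.
apply: filterS2 b1 b2 => eta h1 h2; rewrite mulrDl.
by apply: le_trans (ler_normD _ _) _; exact: lerD.
Qed.

Lemma aboundZ C M a k : abound C M k -> abound C (`|a| * M) (a *: k).
Proof.
move=> [mk kM]; split; first by apply: measurable_funM => //; exact: measurable_cst.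
by apply: filterS kM => eta h; rewrite normrM -mulrA ler_wpM2l.
Qed.

Lemma aboundN C M k : abound C M k -> abound C M (- k).
Proof. by move=> /(aboundZ (-1)); rewrite normrN1 mul1r scaleN1r. Qed.

Lemma aboundB C M1 M2 k1 k2 :
  abound C M1 k1 -> abound C M2 k2 -> abound C (M1 + M2) (k1 - k2).
Proof. by move=> b1 /aboundN; exact: aboundD. Qed.

Lemma abound_le C M M' k : 0 < C -> M <= M' -> abound C M k -> abound C M' k.
Proof.
move=> C0 MM' [mk kM]; split => //; apply: filterS kM => eta /le_trans; apply.
by rewrite ler_wpM2r// exprn_ge0// ltW.
Qed.

Lemma abound_ae C M k k' : measurable_fun setT k' ->
  {ae @lambda R d, forall eta, k' eta = k eta} -> abound C M k -> abound C M k'.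
Proof. by move=> mk' e [_ b]; split => //; apply: filterS2 e b => eta ->. Qed.

Lemma fbound_sub C c M k : 0 < c <= C -> 0 <= M -> fbound c M k -> fbound C M k.
Proof.
move=> /andP[c0 cC] M0 [mk kM]; split => // eta; apply: le_trans (kM eta) _.
by rewrite ler_wpM2l// lerXn2r// nnegrE ltW// (lt_le_trans c0).
Qed.

Lemma Kspc_abound C k : 0 < C -> Kspc C k -> exists2 M, 0 <= M & abound C M k.
Proof.
move=> C0 kC; exists (fine (Kspc_norm C k)); last exact: Kspc_norm_fine.
by apply: fine_ge0; exact: Lnorm_ge0.
Qed.

End abound_theory.

(** * Convergence *)

Section glauber.
Context {R : realType} {d : nat}.
Local Notation Rd := 'R[R]_d.
Local Notation Gamma0 := {fset Rd}.
Variables (phi : Rd -> R) (C z : R).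
Variables (That Tstar : R -> (Gamma0 -> R) -> (Gamma0 -> R)).
Hypotheses (d_gt0 : (0 < d)%N)
    (phi_meas : measurable_fun (~` [set vzero]) phi)
    (phi_ge0 : forall x : Rd, x != vzero -> 0 <= phi x)
    (phi_even : forall x : Rd, x != vzero -> phi (vopp x) = phi x)
    (Cphi_bnd : (0 < Cphi_int phi < +oo)%E)
    (C_ge1 : 1 <= C) (z_gt0 : 0 < z)
    (z_leC : z * expR (C * Cphi phi) <= C)
    (ThatP : semigroup_of phi z C That)
    (TstarP : adjoint_semigroup C That Tstar).
Implicit Types (k h G : Gamma0 -> R).

Let C_gt0 : 0 < C. Proof. exact: lt_le_trans C_ge1. Qed.
Let C2_gt0 : 0 < 2 * C. Proof. by rewrite mulr_gt0. Qed.

Let n G : R := fine (Lspc_norm C G).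
Let g := gker phi.
Let P delta := Pst leb g z delta.
Let L := Lst leb g z.

Let mdiagd : measurable [set p : Rd * Rd | p.1 = p.2].
Proof. exact: measurable_tuple_diag. Qed.
Let diffuse (x : Rd) : leb [set x] = 0%E. Proof. exact: leb_set1. Qed.
Let mg := measurable_gker phi_meas.
Let g_ge0 : forall x y, 0 <= g x y := gker_ge0 phi.
Let g_le1 := gker_le1 phi_ge0.
Let gC := gkerC phi_even.
Let g_kappa := gker_Cphi d_gt0 phi_meas phi_ge0 phi_even Cphi_bnd.

Let mP delta k : measurable_fun setT k -> measurable_fun setT (P delta k).
Proof. exact: (measurable_Pst leb mdiagd mg z). Qed.

Let Lspc2C G : Lspc (2 * C) G -> Lspc C G.
Proof. by apply: Lspc_sub; rewrite C_gt0 ler_peMl ?(ltW C_gt0)// ler1n. Qed.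

Let Lspc2C_fin G : Lspc (2 * C) G -> measurable_fun setT G /\
  (\int[seq_measure leb]_s (`|G (fset_of s)| * (2 * C) ^+ #|` fset_of s|)%:E < +oo)%E.
Proof.
move=> /(LspcP _ C2_gt0)[mG fin]; split => //; move: fin.
rewrite (integral_lebesgue_poisson leb
  (F := fun eta : Gamma0 => (`|G eta| * (2 * C) ^+ #|` eta|)%:E))//.
apply/measurable_EFinP; apply: measurable_funM; first exact: measurableT_comp.
exact: measurable_pow_card.
Qed.

(** C^{|eta|} is itself an admissible dual function with constant 1; integrability of Lhat G against
    it is membership in L_C. *)
Let Lspc_Lhat G : Lspc (2 * C) G -> Lspc C (Lhat phi z G).
Proof.
move=> /Lspc2C_fin[mG fin]; rewrite (Lhat_Lh d_gt0 phi_meas z mG).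
have pb : fbound C 1 (fun eta : Gamma0 => C ^+ #|` eta|).
  split=> [|eta]; first exact: measurable_pow_card.
  by rewrite mul1r ger0_norm// exprn_ge0// ltW.
have mL := measurable_Lh mdiagd diffuse mg gC z mG.
apply/(LspcP _ C_gt0); split => //.
have /integrableP[_] :=
  integrable_Lh mdiagd diffuse mg g_ge0 g_le1 g_kappa gC C_ge1 pb mG fin z.
rewrite (integral_lebesgue_poisson leb
  (F := fun eta : Gamma0 => (`|Lh leb g z G eta| * C ^+ #|` eta|)%:E)); last first.
  apply/measurable_EFinP; apply: measurable_funM; first exact: measurableT_comp.
  exact: measurable_pow_card.
congr (_ < _)%E; apply: eq_integral => s _ /=.
by rewrite normrM (@ger0_norm _ (_ ^+ _)) ?exprn_ge0// ltW.
Qed.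

Let Lhat_pairing K k G : fbound C K k -> Lspc (2 * C) G ->
  pairing (Lhat phi z G) k = pairing G (L k).
Proof.
move=> kb /Lspc2C_fin[mG fin]; rewrite (Lhat_Lh d_gt0 phi_meas z mG).
exact: (Lh_duality mdiagd diffuse mg g_ge0 g_le1 g_kappa gC C_ge1 kb mG fin z).
Qed.

Let T_contr := ThatP.1.
Let T_gen := ThatP.2.

Let That_dom t G : 0 <= t -> Lspc C G -> Lspc C (That t G).
Proof. by move=> t0 dG; case: T_contr => + _ _ _ _; exact. Qed.

Let That_norm t G : 0 <= t -> Lspc C G -> n (That t G) <= n G.
Proof.
move=> t0 dG; rewrite -lee_fin -(Lspc_norm_fin C_gt0 dG).
rewrite -(Lspc_norm_fin C_gt0 (That_dom t0 dG)).
by case: T_contr => _ _ + _ _; exact.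
Qed.

Let Tstar_dom t k : 0 <= t -> Kspc C k -> Kspc C (Tstar t k).
Proof. by move=> t0 kC; have [] := TstarP t0 kC. Qed.

Let Tstar_pairing t k G : 0 <= t -> Kspc C k -> Lspc C G ->
  pairing (That t G) k = pairing G (Tstar t k).
Proof. by move=> t0 kC; have [_] := TstarP t0 kC; exact. Qed.

Let pairingB G h1 h2 : Lspc C G -> Kspc C h1 -> Kspc C h2 ->
  pairing G (h1 - h2) = pairing G h1 - pairing G h2.
Proof.
move=> dG /(Kspc_abound C_gt0)[M1 M10 b1] /(Kspc_abound C_gt0)[M2 M20 b2].
by rewrite -scaleN1r addrC (pairing_linr C_gt0 (-1) M20 M10 dG b2 b1) mulN1r addrC.
Qed.

Let pairingBl G1 G2 h : Lspc C G1 -> Lspc C G2 -> Kspc C h ->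
  pairing (G1 - G2) h = pairing G1 h - pairing G2 h.
Proof.
move=> d1 d2 /(Kspc_abound C_gt0)[M M0 b].
by rewrite -scaleN1r addrC (pairing_linl C_gt0 (-1) M0 d2 d1 b) mulN1r addrC.
Qed.

Let KspcB h1 h2 : Kspc C h1 -> Kspc C h2 -> Kspc C (h1 - h2).
Proof.
move=> /(KspcP _ C_gt0)[M1 b1] /(KspcP _ C_gt0)[M2 b2].
by apply/(KspcP _ C_gt0); exists (M1 + M2); exact: aboundB.
Qed.

Let Kspc_test M h : 0 <= M -> Kspc C h ->
  (forall G, Lspc (2 * C) G -> `|pairing G h| <= M * n G) -> abound C M h.
Proof.
move=> M0 /(Kspc_abound C_gt0)[K K0 hK] H.
exact: (pairing_test d_gt0 C_gt0 M0 K0 hK).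
Qed.

Let fbound_Kspc K k : fbound C K k -> Kspc C k.
Proof. by move=> kb; apply/(KspcP _ C_gt0); exists K; exact: fbound_abound. Qed.

(** Contractivity of T*(t) in K_C, inherited from T(t) by moving the semigroup to the test
    function. *)
Lemma abound_TstarB t M h1 h2 : 0 <= t -> 0 <= M -> Kspc C h1 -> Kspc C h2 ->
  abound C M (h1 - h2) -> abound C M (Tstar t h1 - Tstar t h2).
Proof.
move=> t0 M0 k1 k2 b; apply: Kspc_test => //.
  by apply: KspcB; exact: Tstar_dom.
move=> G /Lspc2C dG; rewrite pairingB//; try exact: Tstar_dom.
rewrite -!Tstar_pairing// -pairingB//; last exact: That_dom.
apply: le_trans (ler_norm_pairing C_gt0 M0 (That_dom t0 dG) b) _.
by rewrite ler_wpM2l//; exact: That_norm.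
Qed.

(** The bound 0 expresses equality almost everywhere. Passing to adjoints reverses the order of the
    two factors. *)
Lemma abound_TstarD s t h : 0 <= s -> 0 <= t -> Kspc C h ->
  abound C 0 (Tstar (s + t) h - Tstar t (Tstar s h)).
Proof.
move=> s0 t0 hC; have st0 : 0 <= s + t by rewrite addr_ge0.
have sC := Tstar_dom s0 hC.
apply: Kspc_test => //; first by apply: KspcB; do ?exact: Tstar_dom.
move=> G /Lspc2C dG; rewrite pairingB//; try by do ?exact: Tstar_dom.
rewrite -!Tstar_pairing//; try by do ?exact: That_dom.
have [M M0 b] := Kspc_abound C_gt0 hC.
have d1 := That_dom st0 dG; have d2 := That_dom s0 (That_dom t0 dG).
have dB : Lspc C (That (s + t) G - That s (That t G)).
  by rewrite -scaleN1r addrC; exact: Lspc_lin.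
rewrite -pairingBl//.
apply: le_trans (ler_norm_pairing C_gt0 M0 dB b) _.
case: T_contr => _ _ _ [_ /(_ s t s0 t0 G dG) ->] _.
by rewrite mulr0 mul0r.
Qed.

Let bounded_pairing K k : fbound C K k ->
  bounded_functional (Lspc C) n (pairing ^~ k) K.
Proof.
move=> kb; apply: bounded_functional_pairing => //; first exact: fbound_ge0 kb.
exact: fbound_abound.
Qed.

Let semigroup1 := semigroup_order1 (Lspc0 C_gt0) (Lspc_lin C_gt0)
  (Lspc_norm_fin C_gt0) (fine_Lspc_normD C_gt0) (fine_Lspc_normZ C_gt0)
  T_contr Lspc2C Lspc_Lhat T_gen.
Let semigroup2 := semigroup_order2 (Lspc0 C_gt0) (Lspc_lin C_gt0)
  (Lspc_norm_fin C_gt0) (fine_Lspc_normD C_gt0) (fine_Lspc_normZ C_gt0)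
  T_contr Lspc2C Lspc_Lhat T_gen.

(* [Lst] maps K_a into K_b and K_b into K_C, so that the second order Taylor
   expansions of <T(t) G, k> = <G, T*(t) k> and of P*_delta k can be compared in K_C
   when [k] lies in K_a. *)
Lemma Tstar_Pst_local a b : 1 <= a -> a < b -> b < C ->
  z * expR (a * Cphi phi) <= a -> z * expR (b * Cphi phi) <= b ->
  exists2 c, 0 <= c & forall K k, fbound a K k ->
    (forall t, 0 <= t -> abound C (t * (K * c)) (Tstar t k - k)) /\
    (forall delta, 0 < delta < 1 ->
      abound C (delta ^+ 2 * (K * c)) (Tstar delta k - P delta k)).
Proof.
move=> a1 ab bC za zb; have a0 : 0 < a by lra.
have b0 : 0 < b by lra.
have [c1 c10 abc] := sqr_pow_bound a0 ab.
have [c2 c20 bcC] := sqr_pow_bound b0 bC.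
(* Relative to K, [2 * c1] bounds L k and also the consistency error of P*_delta, and [4 * c1 * c2]
   bounds L (L k). *)
exists (2 * c1 + 4 * c1 * c2); first by rewrite addr_ge0// !mulr_ge0// ltW.
move=> K k kb; have K0 := fbound_ge0 kb.
have kC : fbound C K k by apply: fbound_sub kb => //; rewrite a0; lra.
have lb1 : fbound b (2 * K * c1) (L k).
  exact: (Lst_fbound mdiagd diffuse mg g_ge0 g_le1 g_kappa a1 z_gt0 za abc kb).
have K1 := fbound_ge0 lb1.
have lC : fbound C (2 * K * c1) (L k) by apply: fbound_sub lb1 => //; rewrite b0 ltW.
have b1 : 1 <= b by lra.
have llC : fbound C (2 * (2 * K * c1) * c2) (L (L k)).
  exact: (Lst_fbound mdiagd diffuse mg g_ge0 g_le1 g_kappa b1 z_gt0 zb bcC lb1).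
have kK := fbound_Kspc kC; have lK := fbound_Kspc lC.
have c12 : 0 <= K * (4 * c1 * c2) by rewrite !mulr_ge0// ltW.
split=> [t t0|delta d01].
  have tK := Tstar_dom t0 kK.
  apply: (@abound_le _ _ _ (t * (2 * K * c1))) => //.
    by rewrite ler_wpM2l//; lra.
  apply: Kspc_test; [by rewrite mulr_ge0|exact: KspcB|].
  move=> G dG; rewrite pairingB//; last exact: Lspc2C.
  rewrite -Tstar_pairing//; last exact: Lspc2C.
  rewrite -mulrA.
  exact: (semigroup1 (bounded_pairing kC) (bounded_pairing lC)
    (fun G => Lhat_pairing kC) dG t0).
have /andP[d0 _] := d01; have d0' := ltW d0.
have tK := Tstar_dom d0' kK.
have dl : abound C (`|- delta| * (2 * K * c1)) (- delta *: L k).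
  by apply: aboundZ; exact: fbound_abound.
have dlK : Kspc C (- delta *: L k) by apply/(KspcP _ C_gt0); eexists; exact: dl.
(* Second order remainder for T*(delta) k; [e2] is its counterpart for P*_delta k. The common terms
   k and delta L k cancel in the difference. *)
have e1 : abound C (delta ^+ 2 * (2 * (2 * K * c1) * c2)) (Tstar delta k - k + - delta *: L k).
  have [M M0 tkM] := Kspc_abound C_gt0 (KspcB tK kK).
  apply: Kspc_test.
  - by rewrite mulr_ge0 ?sqr_ge0// (fbound_ge0 llC).
  - by apply/(KspcP _ C_gt0); eexists; exact: aboundD tkM dl.
  move=> G dG; have dG' := Lspc2C dG.
  rewrite addrC (pairing_linr C_gt0 _ K1 M0 dG' (fbound_abound lC) tkM) pairingB//.
  rewrite -Tstar_pairing// -mulrA mulNr addrC.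
  exact: (semigroup2 (bounded_pairing kC) (bounded_pairing lC) (bounded_pairing llC)
    (fun G => Lhat_pairing kC) (fun G => Lhat_pairing lC) dG d0').
have e2 : abound C (2 * K * c1 * delta ^+ 2) (P delta k - k + - delta *: L k).
  apply: fbound_abound; apply: (@fbound_sub _ _ _ b); first by rewrite b0 ltW.
    by rewrite mulr_ge0// sqr_ge0.
  split.
    apply: measurable_funD; first apply: measurable_funB.
    - exact: (mP delta kb.1).
    - exact: kb.1.
    - by apply: measurable_funM; [exact: measurable_cst|exact: lC.1].
  move=> eta; have := Pst_consistency mdiagd diffuse mg g_ge0 g_le1 g_kappa
    a1 z_gt0 d01 za abc kb eta.
  by rewrite -mulNr.
have := aboundB e1 e2; rewrite opprD addrACA subrr addr0 opprB addrA subrK.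
by apply: abound_le => //; rewrite le_eqVlt; apply/orP; left; apply/eqP; ring.
Qed.

(** The pointwise estimates require representatives bounded everywhere: [h1] and [h2] make linearity
    available, [m] represents their difference with the bound [M], and [Pst_ae_eq] returns to [k1]
    and [k2]. *)
Let P_step delta M k1 k2 : 0 < delta < 1 -> 0 <= M -> Kspc C k1 -> Kspc C k2 ->
  abound C M (k1 - k2) -> abound C M (P delta k1 - P delta k2).
Proof.
move=> d01 M0 /(Kspc_abound C_gt0)[M1 M10 b1] /(Kspc_abound C_gt0)[M2 M20 b2] b12.
have [h1 h1b h1k] := abound_fbound C_gt0 M10 b1.
have [h2 h2b h2k] := abound_fbound C_gt0 M20 b2.
have [m mb mk] := abound_fbound C_gt0 M0 b12.
have Pae := Pst_ae_eq mdiagd diffuse mg z delta.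
have e1 := Pae _ _ h1b.1 b1.1 h1k; have e2 := Pae _ _ h2b.1 b2.1 h2k.
have m12 : {ae @lambda R d, forall eta, m eta = (h1 - h2) eta}.
  by apply: filterS3 mk h1k h2k => eta -> h1E h2E; rewrite !fctE h1E h2E.
have e3 := Pae _ _ mb.1 (measurable_funB h1b.1 h2b.1) m12.
apply: (@abound_ae _ _ C M (P delta m)).
- by apply: measurable_funB; apply: (mP delta); [exact: b1.1|exact: b2.1].
- apply: filterS3 e1 e2 e3 => eta E1 E2 E3.
  rewrite -[LHS]/(Pst leb (gker phi) z delta k1 eta - Pst leb (gker phi) z delta k2 eta).
  rewrite -E1 -E2 -[RHS]/(Pst leb (gker phi) z delta m eta) E3.
  exact/esym/(PstB mdiagd diffuse mg g_ge0 g_le1 g_kappa z delta eta C_ge1 h1b h2b).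
apply: fbound_abound.
exact: (Pst_fbound mdiagd diffuse mg g_ge0 g_le1 g_kappa C_ge1 z_gt0 d01 z_leC mb).
Qed.

Let P_Kspc delta k : 0 < delta < 1 -> Kspc C k -> Kspc C (P delta k).
Proof.
move=> d01 /(Kspc_abound C_gt0)[M1 M10 b1].
have [h1 h1b h1k] := abound_fbound C_gt0 M10 b1.
have e1 := Pst_ae_eq mdiagd diffuse mg z delta h1b.1 b1.1 h1k.
apply/(KspcP _ C_gt0); exists M1; apply: (@abound_ae _ _ C M1 (P delta h1)).
- exact: (mP delta b1.1).
- by apply: filterS e1 => eta /esym.
apply: fbound_abound.
exact: (Pst_fbound mdiagd diffuse mg g_ge0 g_le1 g_kappa C_ge1 z_gt0 d01 z_leC h1b).
Qed.

Lemma iter_Pst_Kspc delta j k : 0 < delta < 1 -> Kspc C k -> Kspc C (iter j (P delta) k).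
Proof. by move=> d01 kC; elim: j => //= j IH; exact: P_Kspc. Qed.

Lemma iter_PstarE delta j k : 0 < delta < 1 -> Kspc C k ->
  iter j (Pstar phi z delta) k = iter j (P delta) k.
Proof.
move=> d01 kC; elim: j => //= j ->; apply: Pstar_Pst => //.
by have /(KspcP _ C_gt0)[M []] := iter_Pst_Kspc j d01 kC.
Qed.

Lemma iter_PstB delta j M k1 k2 : 0 < delta < 1 -> 0 <= M -> Kspc C k1 -> Kspc C k2 ->
  abound C M (k1 - k2) -> abound C M (iter j (P delta) k1 - iter j (P delta) k2).
Proof.
move=> d01 M0 k1C k2C b; elim: j => //= j IH.
by apply: P_step => //; exact: iter_Pst_Kspc.
Qed.

Lemma iter_Pst_fbound a delta j K k : 1 <= a -> z * expR (a * Cphi phi) <= a ->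
  0 < delta < 1 -> fbound a K k -> fbound a K (iter j (P delta) k).
Proof.
move=> a1 za d01 kb; elim: j => //= j IH.
exact: (Pst_fbound mdiagd diffuse mg g_ge0 g_le1 g_kappa a1 z_gt0 d01 za IH).
Qed.

(** The local error is always taken at an iterate of P*_delta, which keeps the bound K a^{|eta|},
    while the accumulated error is propagated by the contraction T*(delta). With at most t / delta
    steps of error delta^2 K c, the total is of order delta. *)
Lemma Tstar_Pst_global a b : 1 <= a -> a < b -> b < C ->
  z * expR (a * Cphi phi) <= a -> z * expR (b * Cphi phi) <= b ->
  exists2 c, 0 <= c & forall K k, fbound a K k -> forall delta t, 0 < delta < 1 -> 0 <= t ->
    abound C (delta * ((t + 1) * (K * c)))
      (Tstar t k - iter (Num.truncn (t / delta)) (P delta) k).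
Proof.
move=> a1 ab bC za zb; have [c c0 H] := Tstar_Pst_local a1 ab bC za zb.
exists c => // K k kb delta t d01 t0; have [Ht Hd] := H K k kb.
have /andP[d0 _] := d01; have K0 := fbound_ge0 kb.
have Kc : 0 <= K * c by rewrite mulr_ge0.
have aC : 0 < a <= C by apply/andP; split; lra.
have fC k' : fbound a K k' -> Kspc C k' by move=> /(fbound_sub aC K0)/fbound_Kspc.
have kC := fC _ kb.
have iterb j := iter_Pst_fbound j a1 za d01 kb.
(* The three contributions to a step are the semigroup law, T*(delta) applied to the previous error,
   and the new local error. *)
have tele j : abound C (j%:R * (delta ^+ 2 * (K * c)))
    (Tstar (j%:R * delta) k - iter j (P delta) k).
  elim: j => [|j IH]; first by rewrite !mul0r /=; have := Ht 0 (lexx _); rewrite mul0r.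
  have jd : 0 <= j%:R * delta by rewrite mulr_ge0// ltW.
  have b1 := abound_TstarD jd (ltW d0) kC.
  have b2 := abound_TstarB (ltW d0) _ (Tstar_dom jd kC) (fC _ (iterb j)) IH.
  have b3 := (H K _ (iterb j)).2 delta d01.
  have := aboundD (aboundD b1 (b2 _)) b3; rewrite !addrA !subrK /= -natr1 !mulrDl !mul1r add0r.
  by apply; rewrite mulr_ge0// mulr_ge0// sqr_ge0.
set m := Num.truncn (t / delta); have td : 0 <= t / delta by rewrite divr_ge0// ltW.
have /andP[m1 m2] := truncn_itv td; rewrite -/m in m1 m2.
have mt : m%:R * delta <= t by rewrite -ler_pdivlMr.
have tm : t <= m%:R * delta + delta.
  by rewrite -[X in _ + X]mul1r -mulrDl natr1 -ler_pdivrMr// ltW.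
have md : 0 <= m%:R * delta by rewrite mulr_ge0// ltW.
(* The remainder s is at most delta. It is placed as the inner factor, so that the first order bound
   applies to k itself and T*(m delta) acts only as a contraction; this accounts for the summand 1
   in t + 1. *)
pose s := t - m%:R * delta; have s0 : 0 <= s by rewrite subr_ge0.
have b1 := abound_TstarD s0 md kC; rewrite subrK in b1.
have sb : abound C (s * (K * c)) (Tstar s k - k) by exact: Ht.
have b2 := abound_TstarB md _ (Tstar_dom s0 kC) kC sb.
have := aboundD (aboundD b1 (b2 _)) (tele m); rewrite !addrA !subrK add0r.
move=> bb; apply: abound_le (bb _) => //; last by rewrite mulr_ge0.
have h1 : s * (K * c) <= delta * (K * c) by rewrite ler_wpM2r// /s; lra.
have h2 : (m%:R * delta) * (delta * (K * c)) <= t * (delta * (K * c)).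
  by rewrite ler_wpM2r// mulr_ge0// ltW.
by lra.
Qed.

End glauber.

Theorem theorem4p16 (R : realType) (d : nat) (phi : 'R[R]_d -> R)
    (C z alpha : R)
    (That Tstar : R -> ({fset 'R[R]_d} -> R) -> ({fset 'R[R]_d} -> R))
    (k : {fset 'R[R]_d} -> R)
    (d_gt0 : (0 < d)%N)
    (phi_meas : measurable_fun (~` [set vzero]) phi)
    (phi_ge0 : forall x : 'R[R]_d, x != vzero -> 0 <= phi x)
    (phi_even : forall x : 'R[R]_d, x != vzero -> phi (vopp x) = phi x)
    (Cphi_bnd : (0 < Cphi_int phi < +oo)%E)
    (C_gt0 : 0 < C) (z_gt0 : 0 < z)
    (z_le : z <= Num.min (C * expR (- (C * Cphi phi)))
                         (2 * C * expR (- (2 * C * Cphi phi))))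
    (z_lt : C * Cphi phi <= ln 2 -> z < C * expR (- (C * Cphi phi)))
    (ThatP : semigroup_of phi z C That)
    (TstarP : adjoint_semigroup C That Tstar)
    (alpha_bnd : alpha0 phi z C < alpha < 1)
    (kP : Kspc_closure alpha C k) :
  [/\ forall delta t : R, 0 < delta < 1 -> 0 <= t ->
        Kspc_closure alpha C
          (iter (Num.truncn (t / delta)) (Pstar phi z delta) k),
      forall t : R, 0 <= t -> Kspc_closure alpha C (Tsun alpha C Tstar t k) &
      forall B eps : R, 0 < eps ->
        \forall delta \near 0^'+, forall t : R, 0 <= t <= B ->
          (Kspc_norm C (iter (Num.truncn (t / delta)) (Pstar phi z delta) k
                        - Tsun alpha C Tstar t k)%R < eps%:E)%E].
Proof.
have kap_gt0 : 0 < Cphi phi by exact: fine_gt0.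
have stable := alpha0_stable C_gt0 z_gt0 kap_gt0 z_le.
have [_ aC1 za] := stable _ alpha_bnd; have /andP[a0 a1] := alpha_bnd.
(* The midpoint still lies in (alpha0, 1), so alpha' C is an intermediate base satisfying the
   stability inequality. *)
pose alpha' := (alpha + 1) / 2.
have [_ _ zb] : [/\ 2^-1 < alpha', 1 < alpha' * C &
    z * expR (alpha' * C * Cphi phi) <= alpha' * C].
  by apply: stable; apply/andP; split; rewrite /alpha'; lra.
have ab : alpha * C < alpha' * C by rewrite ltr_pM2r// /alpha'; lra.
have bC : alpha' * C < C by rewrite gtr_pMl// /alpha'; lra.
have C1 : 1 <= C by lra.
have zC : z * expR (C * Cphi phi) <= C.
  by move: z_le; rewrite le_min expRN ler_pdivlMr ?expR_gt0// => /andP[].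
have aC0 : 0 < alpha * C by lra.
have [c c0 Hc] := Tstar_Pst_global d_gt0 phi_meas phi_ge0 phi_even Cphi_bnd C1
  z_gt0 ThatP TstarP (ltW aC1) ab bC za zb.
have [kC kcl] := kP.
(* Elements of the closure are approximated by functions bounded at every configuration, not merely
   almost everywhere. *)
have approx e : 0 < e -> exists K k', [/\ 0 <= K, fbound (alpha * C) K k' & abound C e (k - k')].
  move=> e0; have [y yK yk] := kcl e e0.
  have [M M0 yM] := Kspc_abound aC0 yK.
  have [k' k'M k'y] := abound_fbound aC0 M0 yM.
  have [K0 [mk _]] := (KspcP k C_gt0).1 kC.
  exists M, k'; split => //; apply: (@abound_ae _ _ C e (k - y)).
  - exact: measurable_funB k'M.1.
  - by apply: filterS k'y => eta e'; rewrite !fctE e'.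
  apply/(Kspc_norm_leP _ C_gt0); first exact: measurable_funB yM.1.
  exact: ltW.
have fC K (k' : {fset 'R[R]_d} -> R) : 0 <= K -> fbound (alpha * C) K k' -> Kspc C k'.
  move=> K0 kb; apply/(KspcP _ C_gt0); exists K; apply: fbound_abound.
  by apply: fbound_sub kb; rewrite // aC0 ltW// (lt_trans ab).
have iterC j delta : 0 < delta < 1 -> Kspc C (iter j (Pst leb (gker phi) z delta) k).
  by move=> d01; exact: (iter_Pst_Kspc d_gt0 phi_meas phi_ge0 phi_even Cphi_bnd C1 z_gt0 zC).
have normle e (h : {fset 'R[R]_d} -> R) : 0 < e -> abound C (e / 2) h -> (Kspc_norm C h < e%:E)%E.
  move=> e0 b; apply: (@le_lt_trans _ _ (e / 2)%:E).
    exact/(Kspc_norm_leP _ C_gt0 b.1).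
  by rewrite lte_fin; lra.
have TsunE t : Tsun alpha C Tstar t k = Tstar t k.
  by rewrite /Tsun patchE mem_set.
have TK t : 0 <= t -> Kspc C (Tstar t k) by move=> t0; have [] := TstarP t t0 k kC.
have PB := iter_PstB d_gt0 phi_meas phi_ge0 phi_even Cphi_bnd C1 z_gt0 zC.
have Pf delta j K k' : 0 < delta < 1 -> fbound (alpha * C) K k' ->
    fbound (alpha * C) K (iter j (Pst leb (gker phi) z delta) k').
  by apply: iter_Pst_fbound => //; exact: ltW.
have iterE := iter_PstarE d_gt0 phi_meas phi_ge0 phi_even Cphi_bnd C1 z_gt0 zC.
split.
- move=> delta t d01 t0; rewrite iterE//; set j := Num.truncn _.
  split; first exact: iterC.
  move=> e e0; have e20 : 0 < e / 2 by rewrite divr_gt0.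
  have [K [k' [K0 k'b kk']]] := approx _ e20.
  exists (iter j (Pst leb (gker phi) z delta) k').
    apply/(KspcP _ aC0); exists K; apply: fbound_abound; exact: Pf.
  apply: normle => //; apply: PB => //; [exact: ltW|exact: fC k'b].
(* Invariance follows from the error bound: T*(t) k is close to T*(t) k', which is close to an
   iterate of P*_delta at k', an element of K_{alpha C}. *)
- move=> t t0; rewrite TsunE; split; first exact: TK.
  move=> e e0; have e40 : 0 < e / 4 by rewrite divr_gt0.
  have [K [k' [K0 k'b kk']]] := approx _ e40.
  have Kc : 0 <= (t + 1) * (K * c) by rewrite !mulr_ge0// addr_ge0.
  (* The cap 1/2 keeps delta in (0, 1). The second entry makes the approximation error at most e /
     4; the added 1 keeps the denominator positive when [K * c] is 0. *)
  pose delta := Num.min (1 / 2) (e / 4 / ((t + 1) * (K * c) + 1)).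
  have d0 : 0 < delta by rewrite lt_min !divr_gt0// ltr_wpDl.
  have d01 : 0 < delta < 1 by rewrite d0 gt_min; apply/orP; left; lra.
  exists (iter (Num.truncn (t / delta)) (Pst leb (gker phi) z delta) k').
    by apply/(KspcP _ aC0); exists K; apply: fbound_abound; exact: Pf.
  have b1 := abound_TstarB d_gt0 C1 ThatP TstarP t0 (ltW e40) kC (fC _ _ K0 k'b) kk'.
  have b2 := Hc _ _ k'b _ _ d01 t0.
  apply: normle => //; have := aboundD b1 b2; rewrite addrA subrK.
  apply: abound_le => //.
  have : delta * ((t + 1) * (K * c) + 1) <= e / 4.
    by rewrite -ler_pdivlMr ?ltr_wpDl// ge_min lexx orbT.
  by lra.
(* Replacing k by k' costs eps/8 under each of the two families and the error at k' costs eps/4; the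
   total eps/2 leaves room for the strict inequality. As k' is chosen before delta and t, the
   estimate is uniform in t. *)
move=> B eps e0; have e80 : 0 < eps / 8 by rewrite divr_gt0.
have [K [k' [K0 k'b kk']]] := approx _ e80.
(* The absolute value keeps the constant nonnegative when B is negative and there is no t to
   consider. *)
have Kc : 0 <= (`|B| + 1) * (K * c) by rewrite !mulr_ge0// addr_ge0.
have X0 : 0 < eps / 4 / ((`|B| + 1) * (K * c) + 1) by rewrite !divr_gt0// ltr_wpDl.
near=> delta => t /andP[t0 tB].
have d0 : 0 < delta by near: delta; exact: nbhs_right_gt.
have d1 : delta < 1 by near: delta; exact: nbhs_right_lt.
have d01 : 0 < delta < 1 by rewrite d0.
have dX : delta < eps / 4 / ((`|B| + 1) * (K * c) + 1) by near: delta; exact: nbhs_right_lt.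
rewrite iterE// TsunE; set j := Num.truncn _.
have b1 := abound_TstarB d_gt0 C1 ThatP TstarP t0 (ltW e80) kC (fC _ _ K0 k'b) kk'.
have b2 := Hc _ _ k'b _ _ d01 t0; rewrite -/j in b2.
have b3 := PB _ j _ _ _ d01 (ltW e80) kC (fC _ _ K0 k'b) kk'.
have b12 := aboundD b1 b2; rewrite addrA subrK in b12.
apply: normle => //; have := aboundB b3 b12; rewrite opprB [X in abound _ _ X]addrA subrK.
apply: abound_le => //.
have h1 : delta * ((`|B| + 1) * (K * c) + 1) <= eps / 4.
  by rewrite -ler_pdivlMr ?ltr_wpDl// ltW.
have h2 : delta * ((t + 1) * (K * c)) <= delta * ((`|B| + 1) * (K * c)).
  apply: ler_wpM2l; first exact: ltW.
  apply: ler_wpM2r; first exact: mulr_ge0.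
  by rewrite lerD2r (le_trans tB)// ler_norm.
by lra.
Unshelve. all: by end_near. Qed.
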